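(* Let $k$ be a field of characteristic zero and let $\nu$ be an Abhyankar valuation on $k[[x]]$. The field $\overline K_\nu^{\mathrm{fg}}$ (resp. $\overline K_\nu$) is algebraically closed and it is the algebraic closure of $K_\nu^{\mathrm{fg}}$ (resp. $\widehat K_\nu$).
   Context: Valuations. $x=(x_1,\dots,x_n)$, $n\ge2$, $K_n=\mathrm{Frac}(k[[x]])$. A valuation $\nu$ on $k[[x]]$ takes values in $\Gamma\cap\mathbb{R}_{\ge0}=:\Gamma^+$ on nonzero series, $\Gamma$ a subgroup of $\mathbb{R}$, with the usual axioms, $\nu(0)=\infty$, and $\nu(f)>0$ iff $f$ is in the maximal ideal; it extends to $K_n$ and $\nu:K_n^*\to\Gamma$ is assumed surjective. $V_\nu$ is its valuation ring, $k_\nu$ its residue field. $\nu$ is an Abhyankar valuation if $\mathrm{tr.deg}_k k_\nu+\dim_{\mathbb{Q}}\Gamma\otimes\mathbb{Q}=n$. $\widehat V_\nu$ is the completion of $V_\nu$ for the topology given by the ideals $\{\nu\ge\lambda\}$, and $\widehat K_\nu=\mathrm{Frac}(\widehat V_\nu)$. Supports. There are (and one fixes) a regular local domain $(A,\mathfrak m_A)$, an injective morphism $k[x]\to A$ inducing an isomorphism of fraction fields, and a regular system of parameters $z_1,\dots,z_r$ of $A$ such that $\nu(z_1),\dots,\nu(z_r)$ freely generate $\Gamma$, $\widehat V_\nu$ is identified with the completed valuation ring of $\nu|_A$, $\widehat A\simeq L[[z_1,\dots,z_r]]$ with $L=A/\mathfrak m_A$ of transcendence degree $n-r$ over $k$,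 and $\nu$ extends to $\widehat A$ as the monomial valuation giving $z_j$ the weight $\nu(z_j)$. Then elements of $\widehat V_\nu$ are uniquely $\sum_{i\in\Lambda}w_i$, with $\Lambda\subset\Gamma^+$ finite or countable without accumulation point and $w_i\in G_i:=L\cdot z^{\beta(i)}$, where $\beta(i)\in\mathbb{Z}^r$ is defined by $\sum_j\beta(i)_j\nu(z_j)=i$. (When $\nu=\nu_\alpha$ is the monomial valuation $\nu_\alpha(x_j)=\alpha_j>0$ on $k[[x]]$, one takes instead $G_i$ = the set of $0$ and all fractions $a/b$ of nonzero polynomials of $k[x]$ weighted homogeneous for the weights $\alpha_j$, with $\nu_\alpha(a)-\nu_\alpha(b)=i$.) The $\nu$-support of $\sum_i w_i$ is $\{i:w_i\ne0\}$; $V_\nu^{\mathrm{fg}}$ is the set (a valuation ring) of elements of $\widehat V_\nu$ whose $\nu$-support is contained in a finitely generated sub-semigroup of $\mathbb{R}_{\ge0}$, and $K_\nu^{\mathrm{fg}}=\mathrm{Frac}(V_\nu^{\mathrm{fg}})$. Homogeneous elements. In a fixed algebraic closure $\Omega$ of $\widehat K_\nu$ (with the unique extension of $\nu$), a homogeneous element of order $d\ge0$ with respect to $\nu$ is $\gamma\in\Omega$ whose minimal polynomial is irreducible in $\widehat V_\nu[Z]$ and of the form $Z^q+g_1Z^{q-1}+\cdots+g_q$ with $g_k\in G_{dk}$ for all $k$ ($g_k=0$ if $dk\notin\Gamma$). For $B=\widehat V_\nu$ or $V_\nu^{\mathrm{fg}}$, $B[\langle\gamma_1,\dots,\gamma_s\rangle]$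 is the ring of elements of $\mathrm{Frac}(B)[\gamma_1,\dots,\gamma_s]$ of nonnegative valuation. $\overline V_\nu$ (resp. $\overline V_\nu^{\mathrm{fg}}$) is the direct limit (union in $\Omega$) of the rings $\widehat V_\nu[\langle\gamma_1,\dots,\gamma_s\rangle]$ (resp. $V_\nu^{\mathrm{fg}}[\langle\gamma_1,\dots,\gamma_s\rangle]$) over all finite sets of homogeneous elements with respect to $\nu$, and $\overline K_\nu$ (resp. $\overline K_\nu^{\mathrm{fg}}$) is its fraction field. *)

(* Defs.v *)
From HB Require Import structures.
From mathcomp Require Import all_boot all_order all_algebra.
From mathcomp Require Import mpoly.
From mathcomp Require Import boolp classical_sets functions cardinality fsbigop.
From mathcomp Require Import reals constructive_ereal ereal.
From mathcomp Require Import lra.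

Set Implicit Arguments.
Unset Strict Implicit.
Unset Printing Implicit Defensive.

Import Order.TTheory GRing.Theory Num.Theory.

Local Open Scope classical_set_scope.
Local Open Scope ring_scope.

Record powser (n : nat) (k : fieldType) := PowSer { pscoef : 'X_{1..n} -> k }.

Section PowerSeries.
Variables (n : nat) (k : fieldType).
Local Notation S := (powser n k).
Implicit Types (f g h : S) (m : 'X_{1..n}) (p q : {mpoly k[n]}).

HB.instance Definition _ := gen_eqMixin S.
HB.instance Definition _ := gen_choiceMixin S.

Lemma powserP f g : pscoef f =1 pscoef g -> f = g.
Proof. by case: f g => [f] [g] /= /funext ->. Qed.

Definition ps_zero : S := PowSer (fun=> 0).
Definition ps_opp f : S := PowSer (fun m => - pscoef f m).
Definition ps_add f g : S := PowSer (fun m => pscoef f m + pscoef g m).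

Lemma ps_addA : associative ps_add.
Proof. by move=> f g h; apply: powserP => m /=; rewrite addrA. Qed.
Lemma ps_addC : commutative ps_add.
Proof. by move=> f g; apply: powserP => m /=; rewrite addrC. Qed.
Lemma ps_add0 : left_id ps_zero ps_add.
Proof. by move=> f; apply: powserP => m /=; rewrite add0r. Qed.
Lemma ps_addN : left_inverse ps_zero ps_opp ps_add.
Proof. by move=> f; apply: powserP => m /=; rewrite addNr. Qed.

HB.instance Definition _ :=
  GRing.isZmodule.Build S ps_addA ps_addC ps_add0 ps_addN.

Definition ps_of_mpoly p : S := PowSer (fun m => p@_m).

Definition ps_mul f g : S := PowSer (fun m =>
  \sum_(u : 'X_{1..n < (mdeg m).+1, (mdeg m).+1} | m == (u.1 + u.2)%MM)
    pscoef f u.1 * pscoef g u.2).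

(* Ring identities are transported from polynomials: up to degree d, a series
   agrees with its truncation. *)
Definition ps_trunc d f : {mpoly k[n]} :=
  \sum_(m : 'X_{1..n < d}) pscoef f m *: 'X_[m].

Lemma ps_truncE d f m :
  (ps_trunc d f)@_m = if (mdeg m < d)%N then pscoef f m else 0.
Proof.
rewrite /ps_trunc raddf_sum /=; case: ifP => h.
  rewrite (bigD1 (BMultinom h)) //= mcoeffZ mcoeffX eqxx mulr1 big1 ?addr0 //.
  move=> i ne; rewrite mcoeffZ mcoeffX; case: eqP => [e|]; last by rewrite mulr0.
  by case/eqP: ne; apply: val_inj.
rewrite big1 // => i _; rewrite mcoeffZ mcoeffX; case: eqP => [e|].
  by move: (bmdeg i); rewrite e h.
by rewrite mulr0.
Qed.

Lemma ps_eq_mul f g p q m :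
    (forall u, (mdeg u <= mdeg m)%N -> pscoef f u = p@_u) ->
    (forall u, (mdeg u <= mdeg m)%N -> pscoef g u = q@_u) ->
  pscoef (ps_mul f g) m = (p * q)@_m.
Proof.
move=> fp gq; rewrite mcoeffM /=; apply: eq_bigr => u _.
by rewrite fp ?gq // -ltnS bmdeg.
Qed.

Lemma ps_mul_trunc d f g m : (mdeg m < d)%N ->
  pscoef (ps_mul f g) m = (ps_trunc d f * ps_trunc d g)@_m.
Proof.
by move=> h; apply: ps_eq_mul => u hu; rewrite ps_truncE (leq_ltn_trans hu h).
Qed.

Lemma ps_mulC : commutative ps_mul.
Proof.
move=> f g; apply: powserP => m.
by rewrite !(@ps_mul_trunc (mdeg m).+1) // mulrC.
Qed.

Lemma ps_mulA : associative ps_mul.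
Proof.
move=> f g h; apply: powserP => m; pose t := ps_trunc (mdeg m).+1.
transitivity (t f * (t g * t h))@_m.
  apply: ps_eq_mul => u hu; first by rewrite ps_truncE ltnS hu.
  by rewrite (@ps_mul_trunc (mdeg m).+1).
rewrite mulrA; apply/esym; apply: ps_eq_mul => u hu.
  by rewrite (@ps_mul_trunc (mdeg m).+1).
by rewrite ps_truncE ltnS hu.
Qed.

Lemma ps_mul1 : left_id (ps_of_mpoly 1) ps_mul.
Proof.
move=> f; apply: powserP => m.
rewrite (@ps_eq_mul _ _ 1 (ps_trunc (mdeg m).+1 f)) // => [|u hu].
  by rewrite mul1r ps_truncE ltnSn.
by rewrite ps_truncE ltnS hu.
Qed.

Lemma ps_mulDl : left_distributive ps_mul ps_add.
Proof.
move=> f g h; apply: powserP => m; pose t := ps_trunc (mdeg m).+1.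
rewrite (@ps_eq_mul _ _ (t f + t g) (t h)) => [|u hu|u hu].
- by rewrite mulrDl mcoeffD /= -!(@ps_mul_trunc (mdeg m).+1).
- by rewrite mcoeffD /= !ps_truncE ltnS hu.
- by rewrite ps_truncE ltnS hu.
Qed.

Lemma ps_one_neq0 : ps_of_mpoly 1 != 0.
Proof.
apply/eqP => /(congr1 (fun f => pscoef f 0%MM)) /=.
by rewrite mcoeff1 eqxx => /eqP; rewrite oner_eq0.
Qed.

HB.instance Definition _ := GRing.Zmodule_isComNzRing.Build S
  ps_mulA ps_mulC ps_mul1 ps_mulDl ps_one_neq0.

Lemma pscoefD f g m : pscoef (f + g) m = pscoef f m + pscoef g m.
Proof. by []. Qed.

Lemma ps_of_mpoly_is_zmod_morphism : zmod_morphism ps_of_mpoly.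
Proof. by move=> p q; apply: powserP => m /=; rewrite mcoeffB. Qed.
Lemma ps_of_mpoly_is_monoid_morphism : monoid_morphism ps_of_mpoly.
Proof.
split=> // p q; apply: powserP => m.
by rewrite [RHS](@ps_eq_mul _ _ p q).
Qed.
HB.instance Definition _ := GRing.isZmodMorphism.Build {mpoly k[n]} S
  ps_of_mpoly ps_of_mpoly_is_zmod_morphism.
HB.instance Definition _ := GRing.isMonoidMorphism.Build {mpoly k[n]} S
  ps_of_mpoly ps_of_mpoly_is_monoid_morphism.

Definition ps_unit : pred S := fun f => `[< exists g, g * f = 1 >].
Definition ps_inv f : S :=
  if pselect (exists g, g * f = 1) is left h then sval (cid h) else f.

Lemma ps_mulVf : {in ps_unit, left_inverse 1 ps_inv *%R}.
Proof.
move=> f /asboolP h; rewrite /ps_inv; case: pselect => // h'.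
by case: (cid h').
Qed.
Lemma ps_unitP f g : g * f = 1 -> ps_unit f.
Proof. by move=> h; apply/asboolP; exists g. Qed.
Lemma ps_inv_out : {in [predC ps_unit], ps_inv =1 id}.
Proof.
move=> f; rewrite inE /= => /asboolP nf; rewrite /ps_inv.
by case: pselect.
Qed.

HB.instance Definition _ := GRing.ComNzRing_hasMulInverse.Build S
  ps_mulVf ps_unitP ps_inv_out.

Lemma ps_ord_exists f : f != 0 -> exists a,
  (exists2 m, mdeg m = a & pscoef f m != 0) /\
  (forall m, (mdeg m < a)%N -> pscoef f m = 0).
Proof.
move=> f0; pose P a := `[< exists2 m, mdeg m = a & pscoef f m != 0 >].
have /ex_minnP[a /asboolP Pa amin] : exists a, P a.
  apply: contrapT => nP; case/eqP: f0; apply: powserP => m /=.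
  apply: contrapT => /eqP fm; apply: nP; exists (mdeg m).
  by apply/asboolP; exists m.
exists a; split=> // m ma; apply: contrapT => /eqP fm.
have /amin : P (mdeg m) by apply/asboolP; exists m.
by rewrite leqNgt ma.
Qed.

Lemma ps_idomain_axiom : GRing.integral_domain_axiom S.
Proof.
move=> f g fg0; apply/norP => -[].
move=> /ps_ord_exists[a [[mf mfa fm] fa]] /ps_ord_exists[b [[mg mgb gm] gb]].
pose p := ps_trunc a.+1 f; pose q := ps_trunc b.+1 g.
have p0 : p != 0.
  apply: contraNneq fm => /(congr1 (mcoeff mf)).
  by rewrite ps_truncE mfa ltnSn mcoeff0 => ->.
have q0 : q != 0.
  apply: contraNneq gm => /(congr1 (mcoeff mg)).
  by rewrite ps_truncE mgb ltnSn mcoeff0 => ->.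
suff pq0 : p * q = 0 by move: (mulf_neq0 p0 q0); rewrite pq0 eqxx.
apply/mpolyP => m; rewrite mcoeff0.
have pa u : (mdeg u < a)%N -> p@_u = 0.
  by move=> h; rewrite ps_truncE ltnW // fa.
have qb u : (mdeg u < b)%N -> q@_u = 0.
  by move=> h; rewrite ps_truncE ltnW // gb.
have [mab|mab] := eqVneq (mdeg m) (a + b)%N; last first.
  rewrite mcoeffM big1 // => -[[u _] [v _]] /= /eqP /(congr1 (@mdeg n)).
  rewrite mdegD => mE.
  have [h|h|h] := ltngtP (mdeg u) a; first by rewrite pa ?mul0r.
    by rewrite [p@__]ps_truncE ltnS leqNgt h mul0r.
  have [h'|h'|h'] := ltngtP (mdeg v) b; first by rewrite qb ?mulr0.
    by rewrite [q@__]ps_truncE ltnS leqNgt h' mulr0.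
  by move: mab; rewrite mE h h' eqxx.
transitivity (pscoef (f * g) m); last by rewrite fg0.
rewrite mcoeffM; apply: eq_bigr => -[[u _] [v _]] /= /eqP /(congr1 (@mdeg n)).
rewrite mdegD mab !ps_truncE !ltnS => uab.
have [h|h|h] := ltngtP (mdeg u) a.
- by rewrite fa // !mul0r.
- have h' : (mdeg v < b)%N by rewrite -(ltn_add2l a) uab ltn_add2r.
  by rewrite mul0r gb // mulr0.
- suff -> : (mdeg v <= b)%N by [].
  by rewrite -(leq_add2l a) uab h.
Qed.

HB.instance Definition _ := GRing.ComUnitRing_isIntegral.Build S ps_idomain_axiom.

End PowerSeries.

Record is_valuation (R : realType) (D : idomainType) (v : D -> \bar R) : Prop :=
  IsValuation {
    val_neqNy : forall a, v a != -oo%E;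
    val_eqy : forall a, (v a = +oo%E) <-> (a = 0);
    valM : forall a b, v (a * b) = (v a + v b)%E;
    valD : forall a b, (Order.min (v a) (v b) <= v (a + b)%R)%E
  }.

Record valuation (R : realType) (D : idomainType) := Valuation {
  val_fun :> D -> \bar R;
  val_funP : is_valuation val_fun
}.

Section ValuationTheory.
Variables (R : realType) (D : idomainType) (v : valuation R D).
Implicit Types a b : D.

Lemma val0 : v 0 = +oo%E. Proof. exact/(val_eqy (val_funP v)). Qed.

Lemma val_fin a : a != 0 -> v a \is a fin_num.
Proof.
move=> a0; rewrite fin_numE (val_neqNy (val_funP v)) /=.
by apply: contraNneq a0 => /(val_eqy (val_funP v)) ->.
Qed.

Lemma val_mul a b : v (a * b) = (v a + v b)%E.
Proof. exact: valM (val_funP v) a b. Qed.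

Lemma val1 : v 1 = 0%E.
Proof.
have := val_mul 1 1; rewrite mulr1 -{1}[v 1]adde0.
by rewrite -(fineK (val_fin (oner_neq0 D))) -!EFinD => -[/addrI <-].
Qed.

Lemma valN1 : v (-1) = 0%E.
Proof.
have N0 : (-1 : D) != 0 by rewrite oppr_eq0 oner_eq0.
have := val_mul (-1) (-1); rewrite mulrNN mulr1 val1.
rewrite -(fineK (val_fin N0)) -EFinD => -[/esym/eqP].
by rewrite -mulr2n mulrn_eq0 /= => /eqP ->.
Qed.

Lemma valN a : v (- a) = v a.
Proof. by rewrite -mulN1r val_mul valN1 add0e. Qed.

End ValuationTheory.

Section ValuationFrac.
Variables (R : realType) (D : idomainType) (v : valuation R D).
Local Open Scope quotient_scope.

Definition val_frac_fun (x : {fraction D}) : \bar R :=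
  (v \n_(repr x) - v \d_(repr x))%E.

Lemma frac_numden (x : {fraction D}) :
  x = tofrac \n_(repr x) / tofrac \d_(repr x).
Proof.
have d0 : tofrac \d_(repr x) != 0 by rewrite tofrac_eq0 denom_ratioP.
apply: (canRL (mulfK d0)); rewrite -[x in LHS]reprK.
set r := repr x; unlock FracField.tofrac; rewrite -[LHS]FracField.pi_mul.
apply/eqmodP; rewrite /= FracField.equivfE /FracField.mulf.
rewrite !numden_Ratio ?mulf_neq0 ?oner_eq0 ?denom_ratioP //.
by rewrite /r reprK !mulr1 mulrC.
Qed.

Lemma val_frac_funE a b : b != 0 ->
  val_frac_fun (tofrac a / tofrac b) = (v a - v b)%E.
Proof.
move=> b0; rewrite /val_frac_fun; set x : {fraction D} := tofrac a / tofrac b.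
set n := \n_ _; set d := \d_ _.
have d0 : d != 0 by exact: denom_ratioP.
have /eqP : tofrac a / tofrac b = tofrac n / tofrac d := frac_numden x.
rewrite eqr_div ?tofrac_eq0 // -!tofracM tofrac_eq => /eqP /(congr1 v).
rewrite !val_mul.
rewrite -(fineK (val_fin v b0)) -(fineK (val_fin v d0)).
by case: (v a) (v n) => [r| |] [s| |] //= [] e; congr _%:E; lra.
Qed.

Lemma val_frac_subproof : is_valuation val_frac_fun.
Proof.
split.
- move=> x; rewrite /val_frac_fun -(fineK (val_fin v (denom_ratioP (repr x)))).
  by move: (val_neqNy (val_funP v) \n_(repr x)); case: (v _).
- move=> x; have [-> |x0] := eqVneq x 0.
    split=> // _; rewrite -[0](mul0r (tofrac 1)^-1) -tofrac0.
    by rewrite val_frac_funE ?oner_neq0 // val0 val1 oppe0.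
  split=> [|/eqP]; last by rewrite (negPf x0).
  have n0 : \n_(repr x) != 0.
    apply: contra_neq x0 => n0.
    by rewrite (frac_numden x) n0 tofrac0 mul0r.
  rewrite /val_frac_fun -(fineK (val_fin v (denom_ratioP (repr x)))).
  by rewrite -(fineK (val_fin v n0)).
- move=> x y; rewrite {1}(frac_numden x) {1}(frac_numden y) mulf_div -!tofracM.
  rewrite val_frac_funE ?mulf_neq0 ?denom_ratioP // !val_mul /val_frac_fun.
  rewrite -(fineK (val_fin v (denom_ratioP (repr x)))).
  rewrite -(fineK (val_fin v (denom_ratioP (repr y)))).
  move: (val_neqNy (val_funP v) \n_(repr x)).
  move: (val_neqNy (val_funP v) \n_(repr y)).
  case: (v \n_(repr x)) (v \n_(repr y)) => [r| |] [s| |] //= _ _.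
  by congr _%:E; lra.
- move=> x y; rewrite [in leRHS](frac_numden x) [in leRHS](frac_numden y).
  have dx := denom_ratioP (repr x); have dy := denom_ratioP (repr y).
  rewrite addf_div ?tofrac_eq0 // -!tofracM -tofracD.
  rewrite val_frac_funE ?mulf_neq0 // /val_frac_fun.
  rewrite leeBrDr ?val_fin ?mulf_neq0 //.
  apply: le_trans (valD (val_funP v) _ _); rewrite !val_mul.
  rewrite -(fineK (val_fin v dx)) -(fineK (val_fin v dy)).
  move: (val_neqNy (val_funP v) \n_(repr x)).
  move: (val_neqNy (val_funP v) \n_(repr y)).
  case: (v \n_(repr x)) (v \n_(repr y)) => [r| |] [s| |] //= _ _.
  - rewrite -!EFin_min -EFinD lee_fin !minEle.
    by do 2![case: ifP]; lra.
  - by rewrite !minEle !leey /= lee_fin; lra.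
  - by rewrite !minEle ?leey /= lee_fin; lra.
Qed.

Definition val_frac : valuation R {fraction D} := Valuation val_frac_subproof.

End ValuationFrac.

Section ValRing.
Local Open Scope quotient_scope.
Variables (R : realType) (K : fieldType) (v : valuation R K).

Definition valring_pred : {pred K} := fun x => (0 <= v x)%E.

Lemma valring_predE x : (x \in valring_pred) = (0 <= v x)%E.
Proof. by []. Qed.

Lemma valring_subring : subring_closed valring_pred.
Proof.
split=> [|x y xV yV|x y xV yV]; rewrite valring_predE.
- by rewrite val1.
- apply: le_trans (valD (val_funP v) _ _).
  by rewrite valN le_min; apply/andP; split.
- by rewrite val_mul adde_ge0.
Qed.

HB.instance Definition _ := GRing.isSubringClosed.Build K valring_pred
  valring_subring.

Record valring := ValRing { valring_val :> K; _ : valring_val \in valring_pred }.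

HB.instance Definition _ := [isSub for valring_val].
HB.instance Definition _ := [Choice of valring by <:].
HB.instance Definition _ := [SubChoice_isSubComNzRing of valring by <:].

Definition valring_unit : pred valring := fun x => v (val x) == 0%E.
Definition valring_inv (x : valring) : valring :=
  if valring_unit x then insubd x (val x)^-1 else x.

Lemma valring_ge0 (x : valring) : (0 <= v (val x))%E.
Proof. exact: valP x. Qed.

Lemma valV (x : K) : x != 0 -> v x^-1 = (- v x)%E.
Proof.
move=> x0; have xV0 : x^-1 != 0 by rewrite invr_eq0.
have := val_mul v x x^-1; rewrite divff // val1.
rewrite -(fineK (val_fin v x0)) -(fineK (val_fin v xV0)) -EFinD => -[e].
by rewrite -EFinN; congr _%:E; lra.
Qed.

Lemma valring_unit_neq0 (x : valring) : valring_unit x -> val x != 0.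
Proof. by apply: contraTneq => x0; rewrite /valring_unit x0 val0. Qed.

Lemma valring_invE (x : valring) :
  valring_unit x -> val (valring_inv x) = (val x)^-1.
Proof.
move=> ux; rewrite /valring_inv ux insubdK // valring_predE.
by rewrite valV ?valring_unit_neq0 // (eqP ux) oppe0.
Qed.

Lemma valring_mulVx : {in valring_unit, left_inverse 1 valring_inv *%R}.
Proof.
move=> x ux; apply: val_inj.
by rewrite rmorphM rmorph1 /= valring_invE // mulVf ?valring_unit_neq0.
Qed.

Lemma valring_unitP (x y : valring) : y * x = 1 -> valring_unit x.
Proof.
move=> /(congr1 (fun z => v (val z))); rewrite rmorphM rmorph1 /= val_mul val1.
move: (valring_ge0 x) (valring_ge0 y); rewrite /valring_unit /=.
case: (v _) (v _) => [r| |] [s| |] //=; rewrite !lee_fin => r0 s0 [] e.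
by rewrite eqe; apply/eqP; lra.
Qed.

Lemma valring_inv_out : {in [predC valring_unit], valring_inv =1 id}.
Proof. by move=> x; rewrite inE => /negPf nu; rewrite /valring_inv (_ : valring_unit x = false). Qed.

HB.instance Definition _ := GRing.ComNzRing_hasMulInverse.Build valring
  valring_mulVx valring_unitP valring_inv_out.

Lemma valring_idomain : GRing.integral_domain_axiom valring.
Proof.
move=> x y /(congr1 val); rewrite rmorphM rmorph0 => /eqP.
by rewrite mulf_eq0 !(raddf_eq0 _ val_inj).
Qed.

HB.instance Definition _ := GRing.ComUnitRing_isIntegral.Build valring
  valring_idomain.

(* The residue field is the quotient of the valuation ring by the maximal
   ideal {x | 0 < v x}. *)
Definition valmax : {pred valring} := fun x => (0 < v (val x))%E.

Lemma valmax_zmod : zmod_closed valmax.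
Proof.
split=> [|x y xm ym]; rewrite !unfold_in ?rmorph0 ?val0 ?ltry //.
rewrite rmorphB; apply: lt_le_trans (valD (val_funP v) _ _).
by rewrite valN lt_min; apply/andP; split.
Qed.
HB.instance Definition _ := GRing.isZmodClosed.Build valring valmax valmax_zmod.

Lemma valmax_proper :
  1 \notin valmax /\ forall a, {in valmax, forall u, a * u \in valmax}.
Proof.
split=> [|x y ym]; rewrite !unfold_in ?rmorph1 ?val1 ?ltxx //.
apply: lt_le_trans ym _.
by rewrite rmorphM val_mul -[leLHS]add0e leeD2r ?valring_ge0.
Qed.
HB.instance Definition _ := isProperIdeal.Build valring valmax valmax_proper.

Definition residue_field := {ideal_quot valmax}.
HB.instance Definition _ := GRing.ComNzRing.on residue_field.

Definition residue (x : valring) : residue_field := \pi_residue_field x.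

Lemma residue_is_zmod_morphism : zmod_morphism residue.
Proof. exact: rmorphB. Qed.
Lemma residue_is_monoid_morphism : monoid_morphism residue.
Proof. by split; [exact: rmorph1 | exact: rmorphM]. Qed.
HB.instance Definition _ := GRing.isZmodMorphism.Build valring residue_field
  residue residue_is_zmod_morphism.
HB.instance Definition _ := GRing.isMonoidMorphism.Build valring residue_field
  residue residue_is_monoid_morphism.

Lemma residue_eq0 (x : valring) : (residue x == 0) = (0 < v (val x))%E.
Proof. by rewrite -(rmorph0 residue) -Quotient.idealrBE subr0. Qed.

Definition residue_inv (x : residue_field) : residue_field :=
  residue (repr x)^-1.

Lemma residue_mulVx x : x != 0 -> residue_inv x * x = 1.
Proof.
rewrite -{1 3}[x]reprK -[\pi_residue_field _]/(residue _) residue_eq0 => v0.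
rewrite -rmorphM mulVr ?rmorph1 //.
by rewrite unfold_in /= /valring_unit eq_le valring_ge0 andbT leNgt.
Qed.

Lemma residue_inv0 : residue_inv 0 = 0.
Proof.
have : residue (repr (0 : residue_field)) == 0 by rewrite /residue reprK.
rewrite /residue_inv residue_eq0 => v0.
rewrite invr_out -?[residue _]/(\pi_residue_field _) ?reprK //.
by rewrite unfold_in /= /valring_unit gt_eqF.
Qed.

HB.instance Definition _ :=
  GRing.ComNzRing_isField.Build residue_field residue_mulVx residue_inv0.

End ValRing.

Lemma val_frac_tofrac (R : realType) (D : idomainType) (v : valuation R D)
  (a : D) : val_frac v (tofrac a) = v a.
Proof.
rewrite -[tofrac a]divr1 -tofrac1 [LHS]val_frac_funE ?oner_neq0 //.
by rewrite val1 oppe0 adde0.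
Qed.

Record ps_valuation (R : realType) (n : nat) (k : fieldType) := PsValuation {
  psval :> valuation R (powser n k);
  psval_ge0 : forall f, (0 <= psval f)%E;
  psval_gt0 : forall f, (0 < psval f)%E <-> pscoef f 0%MM = 0
}.

Section SubsetsOfField.
Variable F : fieldType.
Implicit Types S E : set F.

Definition subfield E : Prop :=
  [/\ E 1, forall x y, E x -> E y -> E (x - y)
    & forall x y, E x -> E y -> E (x / y)].

Definition fracs S : set F :=
  [set x | exists a b, [/\ S a, S b, b != 0 & x = a / b]].

Definition adjoin S (s : nat) (b : 'I_s -> F) : set F :=
  [set x | exists2 P : {mpoly F[s]}, forall m, S P@_m & x = P.@[b]].

Definition algebraic_over S (x : F) : Prop :=
  exists P : {poly F}, [/\ P != 0, forall i, S P`_i & root P x].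

Definition alg_independent S (s : nat) (b : 'I_s -> F) : Prop :=
  forall P : {mpoly F[s]}, (forall m, S P@_m) -> P.@[b] = 0 -> P = 0.

Definition is_trdeg S (s : nat) : Prop :=
  exists b : 'I_s -> F,
    alg_independent S b /\ forall x, algebraic_over (fracs (adjoin S b)) x.

Definition is_alg_closed_field E : Prop :=
  subfield E /\
  forall P : {poly F}, (forall i, E P`_i) -> (1 < size P)%N ->
    exists2 x, E x & root P x.

Definition is_alg_closure S E : Prop :=
  [/\ subfield S, S `<=` E, forall x, E x -> algebraic_over S x
    & is_alg_closed_field E].

End SubsetsOfField.

(* dim_Q (Gamma (x) Q) = e, where Gamma (x) Q is realized inside R as the set of
   reals having a positive integral multiple in Gamma. *)
Definition is_rational_rank (R : realType) (Gamma : set R) (e : nat) : Prop :=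
  exists b : 'I_e -> R,
    (forall c : 'I_e -> rat,
       \sum_i ratr (c i) * b i = 0 -> forall i, c i = 0) /\
    (forall x, (exists2 m : nat, (0 < m)%N & Gamma (x *+ m)) <->
       exists c : 'I_e -> rat, x = \sum_i ratr (c i) * b i).

Section CommutativeAlgebra.
Variable A : idomainType.
Implicit Type I : set A.

Definition is_ideal I : Prop :=
  [/\ I 0, forall x y, I x -> I y -> I (x + y)
    & forall a x, I x -> I (a * x)].

Definition gen_ideal (d : nat) (g : 'I_d -> A) : set A :=
  [set x | exists c : 'I_d -> A, x = \sum_i c i * g i].

Definition ideal_pow I (N : nat) : set A :=
  [set x | exists d (c : 'I_d -> A) (p : 'I_d -> 'I_N -> A),
     (forall i j, I (p i j)) /\ x = \sum_i c i * \prod_j p i j].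

Definition is_prime_ideal I : Prop :=
  [/\ is_ideal I, ~ I 1 & forall x y, I (x * y) -> I x \/ I y].

Definition noetherian : Prop :=
  forall I, is_ideal I -> exists d (g : 'I_d -> A), I = gen_ideal g.

Definition prime_chain (d : nat) : Prop :=
  exists P : nat -> set A,
    (forall i, (i <= d)%N -> is_prime_ideal (P i)) /\
    (forall i, (i < d)%N -> P i `<` P i.+1).

Definition is_krull_dim (d : nat) : Prop :=
  prime_chain d /\ forall e, prime_chain e -> (e <= d)%N.

Definition nonunits : set A := [set a | a \isn't a GRing.unit].

Definition is_regular_system (r : nat) (z : 'I_r -> A) : Prop :=
  [/\ noetherian, is_ideal nonunits, is_krull_dim r & nonunits = gen_ideal z].

(* c exhibits L[[z_1, ..., z_r]] as the completion of the local domain A for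
   the topology of its maximal ideal; the case N = 1 identifies L with the
   residue field of A. *)
Definition is_adic_completion (r : nat) (L : fieldType)
    (c : A -> powser r L) : Prop :=
  (forall N a, ideal_pow nonunits N a <->
     (forall m, (mdeg m < N)%N -> pscoef (c a) m = 0)) /\
  (forall N f, exists a,
     forall m, (mdeg m < N)%N -> pscoef (f - c a) m = 0).

End CommutativeAlgebra.

Definition is_completion (R : realType) (V Vh : idomainType)
    (v : V -> \bar R) (vh : valuation R Vh) (iota : V -> Vh) : Prop :=
  [/\ forall a, vh (iota a) = v a,
      forall (f : Vh) (l : R), exists a, (l%:E <= vh (f - iota a)%R)%E
    & forall u : nat -> Vh,
        (forall l : R, exists N, forall p q, (N <= p)%N -> (N <= q)%N ->
           (l%:E <= vh (u p - u q)%R)%E) ->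
        exists f, forall l : R, exists N, forall p, (N <= p)%N ->
           (l%:E <= vh (f - u p)%R)%E].

Section MonomialValuations.
Variables (R : realType) (n : nat) (k : fieldType) (alpha : 'I_n -> R).

Definition weight (m : 'X_{1..n}) : R := \sum_i alpha i *+ m i.

Definition monomial_val (f : powser n k) : \bar R :=
  ereal_inf [set (weight m)%:E | m in [set m | pscoef f m != 0]].

Definition weighted_homog (p : {mpoly k[n]}) : Prop :=
  exists d : R, forall m, m \in msupp p -> weight m = d.

End MonomialValuations.

Section CompletedValuationRing.
Variables (R : realType) (n : nat) (k : fieldType) (nu : ps_valuation R n k).

Definition nuK : valuation R {fraction (powser n k)} := val_frac nu.
Definition Vnu := valring nuK.

Lemma ps_valring_subproof (f : powser n k) : tofrac f \in valring_pred nuK.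
Proof. by rewrite valring_predE /nuK val_frac_tofrac psval_ge0. Qed.
Definition ps_valring (f : powser n k) : Vnu := ValRing (ps_valring_subproof f).

Definition value_group : set R := [set g | exists x, nuK x = g%:E].

Definition residue_const (x : k) : residue_field nuK :=
  residue (ps_valring (ps_of_mpoly x%:MP)).

Definition is_abhyankar : Prop :=
  exists t e, [/\ is_trdeg (range residue_const) t,
                  is_rational_rank value_group e & (t + e)%N = n].

Variables (Vh : idomainType) (vh : valuation R Vh) (iota : {rmorphism Vnu -> Vh}).

Local Notation Kh := {fraction Vh}.

Record abhyankar_model := AbhyankarModel {
  am_ring : idomainType;
  am_poly : {rmorphism {mpoly k[n]} -> am_ring};
  am_poly_inj : injective am_poly;
  (* k[x] and A have the same fraction field *)
  am_poly_frac : forall a, exists p q, q != 0 /\ a * am_poly q = am_poly p;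
  am_dim : nat;
  am_par : 'I_am_dim -> am_ring;
  am_regular : is_regular_system am_par;
  (* the inclusion of A in K_n, which lands in V_nu *)
  am_incl : {rmorphism am_ring -> Vnu};
  am_incl_poly : forall p, am_incl (am_poly p) = ps_valring (ps_of_mpoly p);
  (* the restriction of nu to A, with the same completed valuation ring *)
  am_val : valuation R am_ring;
  am_valE : forall a, am_val a = nuK (valring_val (am_incl a));
  am_iota : {rmorphism valring (val_frac am_val) -> Vh};
  am_iotaE : forall a x,
    valring_val x = tofrac a -> am_iota x = iota (am_incl a);
  am_completion :
    is_completion (fun x => val_frac am_val (valring_val x)) vh am_iota;
  am_weight := fun j => fine (am_val (am_par j));
  am_weight_gt0 : forall j, 0 < am_weight j;
  am_weight_gen : forall g, value_group g <->
    exists b : 'I_am_dim -> int, g = \sum_j am_weight j *~ b j;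
  am_weight_free : forall b : 'I_am_dim -> int,
    \sum_j am_weight j *~ b j = 0 -> forall j, b j = 0;
  am_field : fieldType;
  am_series : {rmorphism am_ring -> powser am_dim am_field};
  am_series_completion : is_adic_completion am_series;
  am_series_par : forall j, am_series (am_par j) = ps_of_mpoly 'X_j;
  am_dim_le : (am_dim <= n)%N;
  am_trdeg : is_trdeg
    (range (fun x : k => pscoef (am_series (am_poly x%:MP)) 0%MM)) (n - am_dim);
  am_val_monomial : forall a, am_val a = monomial_val am_weight (am_series a);
  (* the continuous extension to L[[z]] of the inclusion of A in the completed
     valuation ring *)
  am_ext : {rmorphism powser am_dim am_field -> Vh};
  am_ext_series : forall a, am_ext (am_series a) = iota (am_incl a);
  am_ext_monomial : forall f, vh (am_ext f) = monomial_val am_weight f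
}.

(* L . z^(beta(i)), which is {0} when i is not in Gamma *)
Definition model_pieces (M : abhyankar_model) (i : R) : set Kh :=
  [set h | h = 0 \/
     exists (l : am_field M) (b : 'I_(am_dim M) -> int),
       \sum_j am_weight j *~ b j = i /\
       h = tofrac (am_ext M (ps_of_mpoly l%:MP))
           * \prod_j tofrac (am_ext M (ps_of_mpoly 'X_j)) ^ b j].

Definition monomial_pieces (alpha : 'I_n -> R) (i : R) : set Kh :=
  [set h | h = 0 \/
     exists a b : {mpoly k[n]},
       [/\ a != 0, b != 0, weighted_homog alpha a, weighted_homog alpha b
         & (nu (ps_of_mpoly a) - nu (ps_of_mpoly b))%E = i%:E /\
           h = tofrac (iota (ps_valring (ps_of_mpoly a)))
               / tofrac (iota (ps_valring (ps_of_mpoly b)))]].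

Definition is_pieces (G : R -> set Kh) : Prop :=
  (exists M : abhyankar_model, G = model_pieces M) \/
  (exists alpha : 'I_n -> R,
     [/\ forall j, 0 < alpha j, forall f, nu f = monomial_val alpha f
       & G = monomial_pieces alpha]).

Variable G : R -> set Kh.

Definition vhK : valuation R Kh := val_frac vh.

Definition is_discrete (Lambda : set R) : Prop :=
  countable Lambda /\
  forall x, exists2 e, 0 < e &
    forall y, Lambda y -> y != x -> e <= `|y - x|.

Definition is_expansion (h : Kh) (w : R -> Kh) : Prop :=
  let Lambda := [set i | w i != 0] in
  [/\ forall i, G i (w i),
      forall i, Lambda i -> value_group i /\ 0 <= i,
      is_discrete Lambda
    & forall l : R, exists F, [/\ finite_set F, F `<=` Lambda
        & forall F', finite_set F' -> F `<=` F' -> F' `<=` Lambda ->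
          (l%:E <= vhK (h - \sum_(i \in F') w i)%R)%E]].

Definition is_support (h : Kh) (Lambda : set R) : Prop :=
  exists2 w, is_expansion h w & Lambda = [set i | w i != 0].

Definition semigroup_gen (d : nat) (s : 'I_d -> R) : set R :=
  [set x | exists c : 'I_d -> nat, x = \sum_j s j *+ c j].

Definition Vfg : set Vh :=
  [set a | exists2 Lambda, is_support (tofrac a) Lambda &
     exists d (s : 'I_d -> R),
       (forall j, 0 <= s j) /\ Lambda `<=` semigroup_gen s].

Variables (Om : fieldType) (emb : {rmorphism Kh -> Om}) (nuO : valuation R Om).

Definition is_minpoly (gamma : Om) (Q : {poly Kh}) : Prop :=
  [/\ Q \is monic, root (map_poly emb Q) gamma
    & forall Q', root (map_poly emb Q') gamma -> Q %| Q'].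

Definition irreducible_elt (D : idomainType) (p : D) : Prop :=
  [/\ p != 0, p \isn't a GRing.unit
    & forall a b, p = a * b -> (a \is a GRing.unit) \/ (b \is a GRing.unit)].

(* In P = Z^q + g_1 Z^(q-1) + ... + g_q one has size P = q + 1. *)
Definition is_homogeneous (d : R) (gamma : Om) : Prop :=
  0 <= d /\
  exists P : {poly Vh},
    [/\ is_minpoly gamma (map_poly (@tofrac Vh) P), irreducible_elt P
      & forall j, (0 < j < size P)%N ->
          G (d * j%:R) (tofrac P`_((size P).-1 - j))].

(* For a subring B of the completed valuation ring: Frac(B), the union of the
   rings B[<gamma_1, ..., gamma_s>], and the fraction field of this union. *)
Definition Kof (B : set Vh) : set Om :=
  [set emb x | x in fracs [set tofrac a | a in B]].

Definition Vbar (B : set Vh) : set Om :=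
  [set x | exists s (gamma : 'I_s -> Om),
     [/\ forall i, exists d, is_homogeneous d (gamma i),
         adjoin (Kof B) gamma x & (0 <= nuO x)%E]].

Definition Kbar (B : set Vh) : set Om := fracs (Vbar B).

End CompletedValuationRing.

(* Main.v *)
Require Import Defs.
From HB Require Import structures.
From mathcomp Require Import all_boot all_order all_algebra.
From mathcomp Require Import mpoly.
From mathcomp Require Import boolp classical_sets functions cardinality fsbigop.
From mathcomp Require Import reals constructive_ereal ereal.
From mathcomp Require Import ring lra.
Set Implicit Arguments.
Unset Strict Implicit.
Unset Printing Implicit Defensive.
Import Order.TTheory GRing.Theory Num.Theory.
Local Open Scope classical_set_scope.
Local Open Scope ring_scope.

(** Let K be the fraction field of the completed valuation ring, v its valuation,
    and w the extension of v to the algebraic closure Om.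

    The pieces G make the finite sums of homogeneous elements of K a graded field
    that is dense in K ([pieces_graded], [pieces_dense]). This grading extends to
    Om: call c homogeneous of degree d if some power c^N is the product of an
    element of G (N d) and of an element algebraic over G 0. Homogeneous elements
    of Om again form graded pieces ([homog_graded]), and for d >= 0 they are
    exactly the roots of the homogeneous minimal polynomials used to define the
    two algebraic closures ([homogeneous_iff]).

    The field F generated over K by the homogeneous elements is all of Om
    ([homog_span_full]). Indeed every x in Om has a leading form, a homogeneous h
    with w (x - h) > w x ([homog_leading_form]), and conjugates over the complete
    field K have the same value ([conjugates_val]). Thus if t in F is the mean of
    the conjugates of x over F, a leading form h of x - t is a leading form of
    y - t for every conjugate y; the sum of the y - t being 0, a nonzero multiple
    n h would have a value larger than that of h. In characteristic zero this is
    impossible, so that x = t. This settles the closure of the whole field K.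

    For finitely generated supports, let W be the set of limits in Om of finite
    sums of homogeneous elements whose degrees lie in one finitely generated
    semigroup of nonnegative reals. A root x of a polynomial over W with
    w x >= 0 is in W ([fg_supported_integrally_closed]). To see this, approximate
    x by a finite homogeneous sum, rescale, and observe that the remaining
    equation is a contraction with coefficients in W. The division by a
    homogeneous element that this requires is harmless because the part of a
    finitely generated semigroup above a bound, translated to 0, lies in a
    finitely generated semigroup ([sgen_shift]). So Frac W is algebraically
    closed. Conversely, an element of W is a combination over K of linearly
    independent homogeneous elements. Such a family is orthogonal for w
    ([coords_orthogonal]), so an expansion of x yields expansions of its
    coordinates, whose supports are finitely generated up to a homogeneous
    denominator ([fg_supported_coords]). Hence W is the ring of elements of
    nonnegative value obtained by adjoining homogeneous elements to the field of
    elements with finitely generated supports ([Vbar_Vfg]). *)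

(** * Bounds for real valuations *)

Section Archimedean.
Variable R : realType.
Implicit Types l e : R.

Lemma nat_above l : exists N : nat, forall p, (N <= p)%N -> l <= p%:R.
Proof.
exists (Num.bound (Num.max 0 l)) => p Np; apply: (@le_trans _ _ (Num.max 0 l)).
  by rewrite le_max lexx orbT.
apply: ltW; apply: lt_le_trans (Num.Theory.archi_boundP _) _; last by rewrite ler_nat.
by rewrite le_max lexx.
Qed.

Lemma mulrn_above e l : 0 < e -> exists N, (0 < N)%N /\ l < e *+ N.
Proof.
move=> e0; have [N hN] := nat_above (l / e); exists N.+1; split=> //.
rewrite -mulr_natl -ltr_pdivrMr //; apply: le_lt_trans (hN N (leqnn N)) _.
by rewrite ltr_nat.
Qed.

End Archimedean.

Section ValuationBounds.
Variables (R : realType) (K : fieldType) (v : valuation R K).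
Implicit Types (x y z : K) (a b d l : R).

Definition vge l x : Prop := (l%:E <= v x)%E.
Definition vgt l x : Prop := (l%:E < v x)%E.

Lemma vge0r l : vge l 0. Proof. by rewrite /vge val0 leey. Qed.
Lemma vgt0r l : vgt l 0. Proof. by rewrite /vgt val0 ltry. Qed.

Lemma vge_trans l' l x : l' <= l -> vge l x -> vge l' x.
Proof. by move=> h; apply: le_trans; rewrite lee_fin. Qed.

Lemma vgt_trans l' l x : l' <= l -> vgt l x -> vgt l' x.
Proof. by move=> h; apply: le_lt_trans; rewrite lee_fin. Qed.

Lemma vgt_ge l x : vgt l x -> vge l x. Proof. exact: ltW. Qed.

Lemma vge_gt l' l x : l' < l -> vge l x -> vgt l' x.
Proof. by move=> h; apply: lt_le_trans; rewrite lte_fin. Qed.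

Lemma vgeD l x y : vge l x -> vge l y -> vge l (x + y).
Proof.
by move=> hx hy; apply: le_trans (valD (val_funP v) _ _); rewrite le_min; apply/andP.
Qed.
Lemma vgtD l x y : vgt l x -> vgt l y -> vgt l (x + y).
Proof.
by move=> hx hy; apply: lt_le_trans (valD (val_funP v) _ _); rewrite lt_min; apply/andP.
Qed.
Lemma vgeN l x : vge l (- x) <-> vge l x. Proof. by rewrite /vge valN. Qed.
Lemma vgtN l x : vgt l (- x) <-> vgt l x. Proof. by rewrite /vgt valN. Qed.
Lemma vgeB l x y : vge l x -> vge l y -> vge l (x - y).
Proof. by move=> hx hy; apply: vgeD => //; apply/vgeN. Qed.
Lemma vgtB l x y : vgt l x -> vgt l y -> vgt l (x - y).
Proof. by move=> hx hy; apply: vgtD => //; apply/vgtN. Qed.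
Lemma vgeBC l x y : vge l (x - y) -> vge l (y - x).
Proof. by move=> h; rewrite -opprB; apply/vgeN. Qed.
Lemma vgtBC l x y : vgt l (x - y) -> vgt l (y - x).
Proof. by move=> h; rewrite -opprB; apply/vgtN. Qed.
Lemma vge_dist l y x z : vge l (x - y) -> vge l (y - z) -> vge l (x - z).
Proof. by move=> h1 h2; rewrite -(subrK y x) -addrA; apply: vgeD. Qed.
Lemma vgt_dist l y x z : vgt l (x - y) -> vgt l (y - z) -> vgt l (x - z).
Proof. by move=> h1 h2; rewrite -(subrK y x) -addrA; apply: vgtD. Qed.

Lemma vge_sum l (I : Type) (r : seq I) (P : pred I) (F : I -> K) :
  (forall i, P i -> vge l (F i)) -> vge l (\sum_(i <- r | P i) F i).
Proof. by move=> h; elim/big_ind: _ => //; [exact: vge0r | exact: vgeD]. Qed.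
Lemma vgt_sum l (I : Type) (r : seq I) (P : pred I) (F : I -> K) :
  (forall i, P i -> vgt l (F i)) -> vgt l (\sum_(i <- r | P i) F i).
Proof. by move=> h; elim/big_ind: _ => //; [exact: vgt0r | exact: vgtD]. Qed.

Lemma vgeM a b x y : vge a x -> vge b y -> vge (a + b) (x * y).
Proof. by move=> hx hy; rewrite /vge val_mul EFinD leeD. Qed.
Lemma vgtM a b x y : vgt a x -> vge b y -> vgt (a + b) (x * y).
Proof.
rewrite /vgt /vge val_mul EFinD.
have := val_neqNy (val_funP v) x; have := val_neqNy (val_funP v) y.
case: (v x) (v y) => [r| |] [s| |] //= _ _; rewrite ?ltry // -?EFinD !lte_fin ?lee_fin.
by move=> ? ?; rewrite ltr_leD.
Qed.
Lemma vgeM0 x y : vge 0 x -> vge 0 y -> vge 0 (x * y).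
Proof. by move=> hx hy; rewrite -(addr0 0); exact: vgeM. Qed.
Lemma vgtM0 x y : vgt 0 x -> vge 0 y -> vgt 0 (x * y).
Proof. by move=> hx hy; rewrite -(addr0 0); exact: vgtM. Qed.
Lemma vgeX n x : vge 0 x -> vge 0 (x ^+ n).
Proof.
move=> h; elim: n => [|n IH]; first by rewrite expr0 /vge Defs.val1.
by rewrite exprS; exact: vgeM0.
Qed.

Lemma vgeXn e n x : vge e x -> vge (e *+ n) (x ^+ n).
Proof.
move=> h; elim: n => [|n IH]; first by rewrite expr0 /vge Defs.val1.
by rewrite exprS mulrS; exact: vgeM.
Qed.

Lemma val_real x : x != 0 -> exists d, v x = d%:E.
Proof. by move=> /(val_fin v) h; exists (fine (v x)); rewrite fineK. Qed.

Lemma val_real_neq0 x d : v x = d%:E -> x != 0.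
Proof. by move=> h; apply/eqP => x0; move: h; rewrite x0 val0. Qed.

Lemma val_vge d x : v x = d%:E -> vge d x.
Proof. by move=> h; rewrite /vge h. Qed.
Lemma val_vge_le d l x : v x = d%:E -> vge l x -> l <= d.
Proof. by move=> h; rewrite /vge h lee_fin. Qed.
Lemma val_vgt_lt d l x : v x = d%:E -> vgt l x -> l < d.
Proof. by move=> h; rewrite /vgt h lte_fin. Qed.

Lemma vge_eq0 x : (forall l, vge l x) -> x = 0.
Proof.
move=> h; apply/eqP/negPn/negP => /val_real[d dx].
by have := val_vge_le dx (h (d + 1)); lra.
Qed.

Lemma val_between d x : vge d x -> ~ vgt d x -> v x = d%:E.
Proof.
by rewrite /vge /vgt => h1 /negP; rewrite -leNgt => h2; apply/eqP; rewrite eq_le h1 h2.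
Qed.
Lemma val_nvgt d x : v x = d%:E -> ~ vgt d x.
Proof. by rewrite /vgt => ->; rewrite ltxx. Qed.

Lemma val_addl d x y : v x = d%:E -> vgt d y -> v (x + y) = d%:E.
Proof.
move=> hx hy; apply: val_between; first by apply: vgeD; [exact: val_vge | exact: vgt_ge].
move=> h; apply: (val_nvgt hx); rewrite -(addrK y x).
by apply: vgtB.
Qed.
Lemma val_near d x y : v x = d%:E -> vgt d (x - y) -> v y = d%:E.
Proof.
move=> hx hy; rewrite -(subrK x y) addrC; apply: val_addl => //.
exact: vgtBC.
Qed.

Lemma valM_real a b x y : v x = a%:E -> v y = b%:E -> v (x * y) = (a + b)%:E.
Proof. by rewrite val_mul => -> ->. Qed.
Lemma valV_real a x : v x = a%:E -> v x^-1 = (- a)%:E.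
Proof. by move=> h; rewrite (valV _ (val_real_neq0 h)) h. Qed.
Lemma valX_real a n x : v x = a%:E -> v (x ^+ n) = (a *+ n)%:E.
Proof.
move=> h; elim: n => [|n IH]; first by rewrite expr0 Defs.val1.
by rewrite exprS mulrS; exact: valM_real.
Qed.

Lemma vge_div a b x y : v y = b%:E -> vge a x -> vge (a - b) (x / y).
Proof. by move=> hy hx; apply: vgeM => //; exact/val_vge/valV_real. Qed.
Lemma vgt_div a b x y : v y = b%:E -> vgt a x -> vgt (a - b) (x / y).
Proof. by move=> hy hx; apply: vgtM => //; exact/val_vge/valV_real. Qed.

Lemma vge_finite (I : eqType) (r : seq I) (F : I -> K) :
  exists l, forall i, i \in r -> vge l (F i).
Proof.
elim: r => [|i r [l IH]]; first by exists 0.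
have [l' hl'] : exists l', vge l' (F i).
  have [->|/val_real[d /val_vge ?]] := eqVneq (F i) 0; first by exists 0; exact: vge0r.
  by exists d.
exists (Order.min l l') => j; rewrite inE => /predU1P[-> | /IH h].
  by apply: vge_trans hl'; rewrite ge_min lexx orbT.
by apply: vge_trans h; rewrite ge_min lexx.
Qed.

Lemma vgt_finite (I : eqType) (r : seq I) (F : I -> K) a :
  (forall i, i \in r -> vgt a (F i)) ->
  exists2 l, a < l & forall i, i \in r -> vge l (F i).
Proof.
elim: r => [|i r IH] h; first by exists (a + 1) => //; lra.
have [|l al {}IH] := IH; first by move=> j jr; apply: h; rewrite inE jr orbT.
have [l' al' hl'] : exists2 l', a < l' & vge l' (F i).
  have := h _ (mem_head i r).
  have [->|/val_real[d hd]] := eqVneq (F i) 0.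
    by exists (a + 1); [lra | exact: vge0r].
  by move/(val_vgt_lt hd) => ad; exists d => //; exact: val_vge.
exists (Order.min l l') => [|j]; first by rewrite lt_min al.
rewrite inE => /predU1P[-> | /IH hj].
  by apply: vge_trans hl'; rewrite ge_min lexx orbT.
by apply: vge_trans hj; rewrite ge_min lexx.
Qed.

(** Values of a product add up, so an excess of the product is an excess of some
    factor; with the factors x - c_i this turns a small value of a split
    polynomial at x into a root close to x. *)
Lemma vgt_prod (d e : R) (c : K) (s : seq K) : v c = e%:E ->
  vgt (e + d *+ size s) (c * \prod_(x <- s) x) -> exists2 x, x \in s & vgt d x.
Proof.
elim: s c e => [|x s IH] c e ce.
  by rewrite big_nil mulr1 addr0 => /(val_nvgt ce).
rewrite big_cons mulrA => h.
case: (pselect (vgt d x)) => [hx | nx]; first by exists x; rewrite ?mem_head.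
have [x0 | /val_real[f xf]] := eqVneq x 0.
  by case: nx; rewrite x0; exact: vgt0r.
have fd : f <= d by move/negP: nx; rewrite /vgt xf -leNgt lee_fin.
have [|y ys hy] := IH (c * x) (e + f) (valM_real ce xf).
  by apply: vgt_trans h; rewrite /= mulrS; lra.
by exists y => //; rewrite inE ys orbT.
Qed.

Lemma val_min_exists (I : eqType) (r : seq I) (F : I -> K) i0 : i0 \in r -> F i0 != 0 ->
  exists mu, (exists2 i, i \in r & v (F i) = mu%:E) /\ forall i, i \in r -> vge mu (F i).
Proof.
elim: r i0 => // i r IH i0 i0r Fi0.
have [[j jr Fj]|none] := pselect (exists2 j, j \in r & F j != 0); last first.
  move: i0r; rewrite inE => /predU1P[e|i0r]; last by case: none; exists i0.
  have [mu hmu] := val_real Fi0; exists mu; split.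
    by exists i; rewrite ?mem_head // -e.
  move=> j; rewrite inE => /predU1P[->|jr]; first by rewrite -e; exact: val_vge.
  have [->|Fj] := eqVneq (F j) 0; first exact: vge0r.
  by case: none; exists j.
have [mu [[k kr hk] hmu]] := IH j jr Fj.
have [Fi|/val_real[m hm]] := eqVneq (F i) 0.
  exists mu; split; first by exists k; rewrite // inE kr orbT.
  by move=> l; rewrite inE => /predU1P[->|/hmu //]; rewrite Fi; exact: vge0r.
have [mmu|mum] := leP m mu.
  exists m; split; first by exists i; rewrite ?mem_head.
  move=> l; rewrite inE => /predU1P[->|/hmu]; first exact: val_vge.
  exact: vge_trans.
exists mu; split; first by exists k; rewrite // inE kr orbT.
move=> l; rewrite inE => /predU1P[->|/hmu //].
exact: vge_trans (ltW mum) (val_vge hm).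
Qed.

End ValuationBounds.

(** * Subfields and minimal polynomials *)

Section SubfieldTheory.
Variables (F : fieldType) (E : set F) (hE : subfield E).

Lemma subfield1 : E 1. Proof. by case: hE. Qed.
Lemma subfieldB x y : E x -> E y -> E (x - y). Proof. by case: hE => _ h _; exact: h. Qed.
Lemma subfield_div x y : E x -> E y -> E (x / y). Proof. by case: hE => _ _; apply. Qed.
Lemma subfield0 : E 0. Proof. by rewrite -(subrr 1); apply: subfieldB subfield1 subfield1. Qed.

Definition subfield_pred of subfield E : {pred F} := fun x => `[< E x >].
Local Notation P := (subfield_pred hE).

Lemma subfield_predP x : reflect (E x) (x \in P). Proof. exact: asboolP. Qed.

Lemma subfield_pred_closed : divring_closed P.
Proof.
split=> [|x y /subfield_predP hx /subfield_predP hy|x y /subfield_predP hx /subfield_predP hy].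
- exact/subfield_predP/subfield1.
- exact/subfield_predP/subfieldB.
- exact/subfield_predP/subfield_div.
Qed.
HB.instance Definition _ := GRing.isDivringClosed.Build F P subfield_pred_closed.

(** A subset of a field known to be a subfield, as a field in its own right, so
    that minimal polynomials over it are available. *)
Record subfield_type := SubfieldElt { subfield_val :> F; _ : subfield_val \in P }.
HB.instance Definition _ := [isSub for subfield_val].
HB.instance Definition _ := [Choice of subfield_type by <:].
HB.instance Definition _ := [SubChoice_isSubIntegralDomain of subfield_type by <:].
HB.instance Definition _ := [SubIntegralDomain_isSubField of subfield_type by <:].

Definition subfield_incl : {rmorphism subfield_type -> F} := val.

Lemma subfield_inclP x : E (subfield_incl x).
Proof. exact/subfield_predP/(valP x). Qed.

Lemma subfield_inclE x : E x -> exists y, subfield_incl y = x.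
Proof. by move=> /subfield_predP h; exists (SubfieldElt h). Qed.

End SubfieldTheory.

Lemma poly_lift (K L : idomainType) (f : {rmorphism K -> L}) (p : {poly L}) :
  (forall i, exists a, f a = p`_i) -> exists q, map_poly f q = p.
Proof.
move=> h; pose g i := projT1 (cid (h i)); exists (\poly_(i < size p) g i).
apply/polyP => i; rewrite coef_map coef_poly.
case: ltnP => hi; first by rewrite /g; case: (cid (h i)).
by apply: (etrans (rmorph0 f)); rewrite nth_default.
Qed.

Section MinimalPolynomials.
Variables (K L : fieldType) (f : {rmorphism K -> L}).

Lemma minpoly_exists x : algebraicOver f x ->
  exists p : {poly K}, [/\ p \is monic, root (map_poly f p) x &
    forall q, root (map_poly f q) x -> p %| q].
Proof.
move=> [q0 q00 q0x].
pose A m := `[< exists q : {poly K}, [/\ q != 0, root (map_poly f q) x & size q = m] >].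
have /ex_minnP[m /asboolP[p [p0 px pm]] mmin] : exists m, A m.
  by exists (size q0); apply/asboolP; exists q0.
have lp : (lead_coef p)^-1 != 0 by rewrite invr_eq0 lead_coef_eq0.
exists ((lead_coef p)^-1 *: p); split.
- by rewrite monicE lead_coefZ mulVf // lead_coef_eq0.
- by rewrite map_polyZ /= rootZ // fmorph_eq0.
move=> q qx; rewrite dvdpZl //.
apply: contraT => /negPf; rewrite /dvdp => /negP/negP r0.
have : A (size (q %% p)).
  apply/asboolP; exists (q %% p); split=> //.
  have : root (map_poly f (q %/ p * p + q %% p)) x by rewrite -divp_eq.
  by rewrite rootE rmorphD rmorphM /= hornerD hornerM (rootP px) mulr0 add0r.
by move/mmin; rewrite leqNgt -pm ltn_modp p0.
Qed.

End MinimalPolynomials.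

(** Algebraic closedness as a property of a plain field. *)
Definition splits (L : fieldType) : Prop :=
  forall p : {poly L}, exists s : seq L, p = lead_coef p *: \prod_(x <- s) ('X - x%:P).

Lemma closed_split (L : fieldType) (p : {poly L}) : splits L ->
  exists s : seq L, p = lead_coef p *: \prod_(x <- s) ('X - x%:P) /\
    (p != 0 -> size p = (size s).+1).
Proof.
move=> splitL; have [r e] := splitL p; exists r; split=> // p0.
by rewrite e size_scale ?lead_coef_eq0 // size_prod_XsubC.
Qed.

Lemma splits_root (L : fieldType) (p : {poly L}) : splits L ->
  (1 < size p)%N -> exists x, root p x.
Proof.
move=> splitL sp; have [s [e sE]] := closed_split p splitL.
have p0 : p != 0 by rewrite -size_poly_gt0 ltnW.
move: sp; rewrite sE //; case: s e sE => // x s e _ _; exists x.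
by rewrite e rootZ ?lead_coef_eq0 // root_prod_XsubC mem_head.
Qed.

(** * Finitely generated semigroups of real numbers *)

Section FinitelyGeneratedSemigroups.
Variable R : realType.
Implicit Types (s t : seq R) (a b x l : R).

Inductive sgen s : R -> Prop :=
| sgen0 : sgen s 0
| sgenD a b : a \in s -> sgen s b -> sgen s (a + b).

Definition nonneg_seq s := forall a, a \in s -> 0 <= a.

Lemma sgen_add s a b : sgen s a -> sgen s b -> sgen s (a + b).
Proof.
by move=> sa sb; elim: sa => [|c d cs _ IH]; rewrite ?add0r // -addrA; exact: sgenD.
Qed.

Lemma sgen_gen s a : a \in s -> sgen s a.
Proof. by move=> h; rewrite -[a]addr0; apply: sgenD h (sgen0 s). Qed.

Lemma sgen_sub s t : {subset s <= t} -> sgen s `<=` sgen t.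
Proof.
move=> st x; elim=> [|a b /st ta _ IH]; first exact: sgen0.
exact: sgenD.
Qed.

Lemma sgen_ge0 s x : nonneg_seq s -> sgen s x -> 0 <= x.
Proof. by move=> hs; elim=> // a b /hs a0 _ b0; exact: addr_ge0. Qed.

Lemma sgen_cons a s x : sgen (a :: s) x -> exists n y, sgen s y /\ x = a *+ n + y.
Proof.
elim=> [|c b + _ [n [y [sy ->]]]].
  by exists 0%N, 0; split; [exact: sgen0 | rewrite addr0].
rewrite inE => /predU1P[-> | cs]; first by exists n.+1, y; rewrite mulrS addrA.
by exists n, (c + y); split; [exact: sgenD | ring].
Qed.

Lemma sgen_mulrn s a n : sgen s a -> sgen s (a *+ n).
Proof.
move=> sa; elim: n => [|n IH]; first exact: sgen0.
by rewrite mulrS; exact: sgen_add.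
Qed.

Lemma sgen_locally_finite s l : nonneg_seq s ->
  exists r : seq R, forall x, sgen s x -> x <= l -> x \in r.
Proof.
elim: s l => [|a s IH] l hs.
  by exists [:: 0] => x [_|b c //]; rewrite inE.
have [|r hr] := IH l; first by move=> b bs; apply: hs; rewrite inE bs orbT.
have hs' : nonneg_seq s by move=> b bs; apply: hs; rewrite inE bs orbT.
have := hs a (mem_head _ _); rewrite le_eqVlt => /predU1P[a0 | a0].
  by exists r => x /sgen_cons[n [y [sy ->]]]; rewrite -a0 mul0rn add0r; exact: hr.
have [N [_ lN]] := mulrn_above l a0.
exists [seq a *+ n + y | n <- iota 0 N, y <- r] => x /sgen_cons[n [y [sy ->]]] xl.
have y0 := sgen_ge0 hs' sy.
have nN : n \in iota 0 N.
  rewrite mem_iota add0n /= ltnNge; apply/negP => /(ler_wpMn2l (ltW a0)) Nn.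
  by lra.
apply/allpairsP; exists (n, y); split=> //; apply: hr => //=.
by have := mulrn_wge0 n (ltW a0); lra.
Qed.

(** Build an element of the semigroup by adding generators one at a time: the
    first partial sum above i0 exceeds i0 by at most one generator, so it is one
    of finitely many elements, and the remaining summands are generators. *)
Lemma sgen_shift s (i0 : R) : nonneg_seq s ->
  exists2 t, nonneg_seq t & forall x, sgen s x -> i0 < x -> sgen t (x - i0).
Proof.
move=> hs; have [i00 | i00] := ltP i0 0.
  exists (- i0 :: s) => [a|x sx _].
    by rewrite inE => /predU1P[->|/hs //]; lra.
  rewrite addrC; apply: sgenD; first exact: mem_head.
  by apply: sgen_sub sx => a; rewrite inE orbC => ->.
have [M hM] : exists M, forall a, a \in s -> a <= M.
  exists (\sum_(a <- s) a) => a sa; rewrite (big_rem a) //= lerDl.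
  by rewrite big_seq sumr_ge0 // => b /mem_rem /hs.
have [r hr] := sgen_locally_finite (i0 + M) hs.
exists (s ++ [seq y - i0 | y <- r & i0 < y]) => [a|x].
  rewrite mem_cat => /orP[/hs //|/mapP[y]].
  by rewrite mem_filter => /andP[h _] ->; lra.
elim=> [|a b sa sb IH] hx; first lra.
have [bi|bi] := ltP i0 b.
  rewrite -addrA; apply: sgenD; last exact: IH.
  by rewrite mem_cat sa.
apply: sgen_gen; rewrite mem_cat; apply/orP; right; apply: map_f.
rewrite mem_filter hx /= hr //; first exact: sgenD.
by have := hM a sa; lra.
Qed.

End FinitelyGeneratedSemigroups.

(** * Convergent sums of homogeneous elements *)

Section GradedFields.
Variables (R : realType) (K : fieldType) (v : valuation R K) (X : R -> set K).
Implicit Types (x y h : K) (S : set R) (l : R) (w : R -> K).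

(** The homogeneous pieces of a graded field inside K whose degree map is the
    valuation. *)
Record graded_pieces : Prop := GradedPieces {
  gr0 : forall i, X i 0;
  grD : forall i x y, X i x -> X i y -> X i (x + y);
  grN : forall i x, X i x -> X i (- x);
  gr1 : X 0 1;
  grM : forall i j x y, X i x -> X j y -> X (i + j) (x * y);
  grV : forall i x, X i x -> X (- i) x^-1;
  gr_val : forall i x, X i x -> x != 0 -> v x = i%:E
}.

Hypothesis gX : graded_pieces.

Lemma grX i x n : X i x -> X (i *+ n) (x ^+ n).
Proof.
move=> h; elim: n => [|n IH]; first exact: (gr1 gX).
by rewrite exprS mulrS; exact: (grM gX).
Qed.

Lemma gr_div i j x y : X i x -> X j y -> X (i - j) (x / y).
Proof. by move=> hx hy; apply: (grM gX) => //; exact: (grV gX). Qed.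

Lemma gr_vge i x : X i x -> vge v i x.
Proof.
have [-> _|x0 h] := eqVneq x 0; first exact: vge0r.
exact/val_vge/(gr_val gX).
Qed.

Lemma gr_bigsum i (I : Type) (r : seq I) (P : pred I) (F : I -> K) :
  (forall j, P j -> X i (F j)) -> X i (\sum_(j <- r | P j) F j).
Proof.
by move=> h; elim/big_ind: _ => //; [exact: (gr0 gX) | move=> *; exact: (grD gX)].
Qed.

Lemma gr_vgt_eq0 i x : X i x -> vgt v i x -> x = 0.
Proof.
move=> h hv; apply/eqP/negPn/negP => x0.
exact: (val_nvgt (gr_val gX h x0)).
Qed.

Lemma gr_leading_unique i h h' : X i h -> X i h' -> vgt v i (h - h') -> h = h'.
Proof.
move=> hh hh' hv; apply/eqP; rewrite -subr_eq0; apply/eqP.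
by apply: gr_vgt_eq0 hv; apply: (grD gX) => //; exact: (grN gX).
Qed.

Inductive homog_sum S : K -> Prop :=
| homog_sum0 : homog_sum S 0
| homog_sum_cons i h y : S i -> X i h -> homog_sum S y -> homog_sum S (h + y).

Lemma homog_sum_homog S i h : S i -> X i h -> homog_sum S h.
Proof. by move=> Si hh; rewrite -[h]addr0; apply: homog_sum_cons hh (homog_sum0 S). Qed.

Lemma homog_sum_mono S S' : S `<=` S' -> homog_sum S `<=` homog_sum S'.
Proof.
by move=> sub x; elim=> [|i h y /sub Si hh _ IH]; [exact: homog_sum0 | exact: homog_sum_cons hh IH].
Qed.

Lemma homog_sum_add S x y : homog_sum S x -> homog_sum S y -> homog_sum S (x + y).
Proof.
move=> hx hy; elim: hx => [|i h z Si hh _ IH]; first by rewrite add0r.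
by rewrite -addrA; exact: homog_sum_cons hh IH.
Qed.

Lemma homog_sum_opp S x : homog_sum S x -> homog_sum S (- x).
Proof.
elim=> [|i h z Si hh _ IH]; first by rewrite oppr0; exact: homog_sum0.
by rewrite opprD; exact: homog_sum_cons Si (grN gX hh) IH.
Qed.

Lemma homog_sum_bigsum S (I : Type) (r : seq I) (P : pred I) (F : I -> K) :
  (forall j, P j -> homog_sum S (F j)) -> homog_sum S (\sum_(j <- r | P j) F j).
Proof.
move=> h; elim/big_ind: _ => //; [exact: homog_sum0 | exact: homog_sum_add].
Qed.

Lemma homog_sum_scale S S' e h x : (forall i, S i -> S' (e + i)) ->
  X e h -> homog_sum S x -> homog_sum S' (h * x).
Proof.
move=> SS' hh; elim=> [|i h' z Si hh' _ IH]; first by rewrite mulr0; exact: homog_sum0.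
by rewrite mulrDr; apply: homog_sum_cons IH; [exact: SS' Si | exact: (grM gX)].
Qed.

Lemma homog_sum_mul S x y : (forall i j, S i -> S j -> S (i + j)) ->
  homog_sum S x -> homog_sum S y -> homog_sum S (x * y).
Proof.
move=> SS hx hy; elim: hx => [|i h z Si hh _ IH]; first by rewrite mul0r; exact: homog_sum0.
by rewrite mulrDl; apply: homog_sum_add IH; apply: homog_sum_scale hh hy => j; exact: SS.
Qed.

Definition support_in w (r : seq R) := forall i, w i != 0 -> i \in r.

Lemma support_in_sum w r r' : uniq r -> uniq r' -> support_in w r ->
  support_in w r' -> \sum_(i <- r) w i = \sum_(i <- r') w i.
Proof.
move=> ur ur' wr wr'.
rewrite (bigID (fun i => w i != 0)) /= [X in _ + X]big1 ?addr0; last first.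
  by move=> i /negPn/eqP.
rewrite [RHS](bigID (fun i => w i != 0)) /= [X in _ = _ + X]big1 ?addr0; last first.
  by move=> i /negPn/eqP.
rewrite -!(big_filter _ (fun i => w i != 0)); apply: perm_big.
apply: uniq_perm; rewrite ?filter_uniq // => i; rewrite !mem_filter.
by case: (boolP (w i != 0)) => //= wi; rewrite wr ?wr'.
Qed.

Lemma homog_sum_normal_form S x : homog_sum S x ->
  exists w r, [/\ forall i, X i (w i), forall i, w i != 0 -> S i,
    support_in w r, uniq r & x = \sum_(i <- r) w i].
Proof.
elim=> [|d h z Sd hh _ [w [r [wX wS wr ur ->]]]].
  exists (fun=> 0), [::]; split=> // [i|i|i|]; rewrite ?eqxx ?big_nil //.
  exact: (gr0 gX).
pose w' i := w i + (if i == d then h else 0).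
pose r' := if d \in r then r else d :: r.
have ur' : uniq r' by rewrite /r'; case: ifPn => //= ->.
have dr' : d \in r' by rewrite /r'; case: ifPn => // _; exact: mem_head.
have rr' : {subset r <= r'}.
  by rewrite /r'; case: ifPn => _ i ir //; rewrite inE ir orbT.
exists w', r'; split=> //.
- move=> i; apply: (grD gX) => //; case: eqP => [->//|_]; exact: (gr0 gX).
- move=> i; rewrite /w'; have [->//|_] := eqVneq i d; rewrite addr0; exact: wS.
- move=> i; rewrite /w'; have [->//|_] := eqVneq i d; rewrite addr0 => /wr; exact: rr'.
- rewrite big_split /= addrC (support_in_sum ur ur') // => [|i /wr /rr' //].
  congr (_ + _); rewrite (bigD1_seq d) //= eqxx big1 ?addr0 // => i /negPf -> //.
Qed.

(** The nonzero term of least degree gives the value of the sum, since a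
    homogeneous element has its degree as its value. *)
Lemma homog_sum_coef_eq0 w r l : (forall i, X i (w i)) -> uniq r ->
  vgt v l (\sum_(i <- r) w i) -> forall i, i \in r -> i <= l -> w i = 0.
Proof.
move=> wX ur; rewrite -(perm_big _ (permEl (perm_sort <=%R r))) /= => hl i.
rewrite -(mem_sort <=%R); move: hl i.
have : sorted <%R (sort <=%R r).
  by rewrite lt_sorted_uniq_le sort_uniq ur /= sort_sorted //; exact: le_total.
elim: (sort _ _) => // j s IH /= js hv i.
have vs : vgt v j (\sum_(i <- s) w i).
  rewrite big_seq; apply: vgt_sum => k ks.
  apply: (vge_gt _ (gr_vge (wX k))).
  by move: js; rewrite (path_sortedE lt_trans) => /andP[/allP/(_ k ks)].
move: hv; rewrite big_cons => hv.
have wj : j <= l -> w j = 0.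
  move=> jl; apply/eqP/negPn/negP => wj0.
  have := val_addl (gr_val gX (wX j) wj0) vs.
  by move/val_nvgt; apply; exact: vgt_trans hv.
rewrite inE => /predU1P[-> //|ir il].
move: js; rewrite (path_sortedE lt_trans) => /andP[/allP/(_ i ir) ji js].
apply: (IH js) => //; move: hv; rewrite wj ?add0r //.
exact/ltW/(lt_le_trans ji).
Qed.

Lemma homog_sum_above S x l : homog_sum S x -> vgt v l x ->
  homog_sum [set i | S i /\ l < i] x.
Proof.
move=> /homog_sum_normal_form[w [r [wX wS wr ur ->]]] hl.
have w0 := homog_sum_coef_eq0 wX ur hl.
rewrite big_seq; apply: homog_sum_bigsum => i ir.
have [->|wi] := eqVneq (w i) 0; first exact: homog_sum0.
apply: homog_sum_homog (wX i); split; first exact: wS.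
by rewrite ltNge; apply/negP => /(w0 _ ir) /eqP; rewrite (negPf wi).
Qed.

Lemma homog_sum_from S x l : homog_sum S x -> vge v l x -> homog_sum [set i | S i /\ l <= i] x.
Proof.
move=> /homog_sum_normal_form[w [r [wX wS wr ur ->]]] hl.
rewrite big_seq; apply: homog_sum_bigsum => i ir.
have [->|wi] := eqVneq (w i) 0; first exact: homog_sum0.
apply: homog_sum_homog (wX i); split; first exact: wS.
rewrite leNgt; apply/negP => il; move/eqP: wi; apply.
exact: (homog_sum_coef_eq0 wX ur (vge_gt il hl) ir).
Qed.

(** The elements of K having an expansion with support in S; expansions enter
    through their finite approximations, which makes sums and products
    immediate. *)
Definition homog_closure S x := forall l, exists2 y, homog_sum S y & vge v l (x - y).

Lemma homog_sum_closure S x : homog_sum S x -> homog_closure S x.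
Proof. by move=> h l; exists x => //; rewrite subrr; exact: vge0r. Qed.

Lemma homog_closure_mono S S' : S `<=` S' -> homog_closure S `<=` homog_closure S'.
Proof. by move=> sub x h l; have [y hy ?] := h l; exists y => //; exact: homog_sum_mono hy. Qed.

Lemma homog_closure_add S x y : homog_closure S x -> homog_closure S y -> homog_closure S (x + y).
Proof.
move=> hx hy l; have [x' sx vx] := hx l; have [y' sy vy] := hy l.
by exists (x' + y'); [exact: homog_sum_add | rewrite opprD addrACA; exact: vgeD].
Qed.

Lemma homog_closure_opp S x : homog_closure S x -> homog_closure S (- x).
Proof.
move=> hx l; have [x' sx vx] := hx l; exists (- x'); first exact: homog_sum_opp.
by rewrite opprK addrC; exact: vgeBC.
Qed.

Lemma homog_closure_closed S x : (forall l, exists2 y, homog_closure S y & vge v l (x - y)) -> homog_closure S x.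
Proof.
move=> h l; have [y hy vy] := h l; have [z sz vz] := hy l.
by exists z => //; exact: vge_dist vy vz.
Qed.

Lemma homog_closure_scale S S' e h x : (forall i, S i -> S' (e + i)) ->
  X e h -> homog_closure S x -> homog_closure S' (h * x).
Proof.
move=> SS' hh hx l; have [y sy vy] := hx (l - e).
exists (h * y); first exact: (homog_sum_scale SS' hh sy).
by rewrite -mulrBr -(subrKC e l); apply: vgeM => //; exact: gr_vge.
Qed.

Lemma homog_closure_mul S x y : (forall i j, S i -> S j -> S (i + j)) ->
  homog_closure S x -> homog_closure S y -> homog_closure S (x * y).
Proof.
move=> SS hx hy l.
have [b hb] := vge_finite v [:: x; y] id.
pose b' := Order.min b 0; pose L := Order.max l 0 - b'.
have b'0 : b' <= 0 by rewrite ge_min lexx orbT.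
have L0 : 0 <= Order.max l 0 by rewrite le_max lexx orbT.
have Ll : l <= Order.max l 0 by rewrite le_max lexx.
have hb' z : z \in [:: x; y] -> vge v b' z.
  by move=> /hb; apply: vge_trans; rewrite ge_min lexx.
have [x' sx vx] := hx L; have [y' sy vy] := hy L.
exists (x' * y'); first exact: homog_sum_mul.
have -> : x * y - x' * y' = (x - x') * y + x' * (y - y') by ring.
have bx' : vge v b' x'.
  rewrite -(subrK x x'); apply: vgeD; last by apply: hb'; rewrite !inE eqxx.
  by apply: vgeBC; apply: vge_trans vx; rewrite /L; lra.
apply: vgeD.
  apply: (@vge_trans _ _ _ _ (L + b')); first by rewrite /L subrK.
  by apply: vgeM => //; apply: hb'; rewrite !inE eqxx orbT.
apply: (@vge_trans _ _ _ _ (b' + L)); first by rewrite /L subrKC.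
exact: vgeM.
Qed.

Lemma homog_closure_above S x l : homog_closure S x -> vgt v l x -> homog_closure [set i | S i /\ l < i] x.
Proof.
move=> hx hl l'; have [y sy vy] := hx (Order.max l' (l + 1)).
exists y; last by apply: vge_trans vy; rewrite le_max lexx.
apply: homog_sum_above => //; rewrite -(subrK x y).
apply: vgtD => //; apply: (@vge_gt _ _ _ _ (l + 1)); first lra.
by apply: vgeBC; apply: vge_trans vy; rewrite le_max lexx orbT.
Qed.

(** The leading form of x is the term of degree i of any approximation that is
    precise beyond i. *)
Lemma homog_closure_leading S x i : homog_closure S x -> v x = i%:E ->
  exists2 h, X i h & h != 0 /\ vgt v i (x - h).
Proof.
move=> hx xi; have [y /homog_sum_normal_form[w [r [wX _ wr ur ->]]] vy] := hx (i + 1).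
have vy' : vgt v i (x - \sum_(j <- r) w j) by apply: vge_gt vy; lra.
have iS : v (\sum_(j <- r) w j) = i%:E by exact: val_near xi vy'.
suff hgt : vgt v i (x - w i).
  exists (w i); [exact: wX | split=> //].
  exact: val_real_neq0 (val_near xi hgt).
pose w' j := if j == i then 0 else w j.
have w'X j : X j (w' j) by rewrite /w'; case: eqP => // _; exact: (gr0 gX).
have E : \sum_(j <- r) w j = w i + \sum_(j <- r) w' j.
  have [ir|ir] := boolP (i \in r).
    rewrite (bigD1_seq i) //=; congr (_ + _).
    by rewrite [RHS](bigD1_seq i) //= /w' eqxx add0r; apply: eq_bigr => j /negPf ->.
  have -> : w i = 0 by apply/eqP/negPn/negP => /wr; exact/negP.
  rewrite add0r !big_seq; apply: eq_bigr => j jr; rewrite /w'; case: eqP => // ji.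
  by rewrite -ji jr in ir.
have w'0 j : j \in r -> j < i -> w j = 0.
  move=> jr ji; pose m := (i + j) / 2.
  have hm : vgt v m (\sum_(j <- r) w j) by apply: vge_gt (val_vge iS); rewrite /m; lra.
  by apply: (homog_sum_coef_eq0 wX ur hm jr); rewrite /m; lra.
apply: (vgt_dist vy'); rewrite E addrC addKr.
rewrite big_seq; apply: vgt_sum => j jr; rewrite /w'; case: eqP => [_|/eqP ji].
  exact: vgt0r.
have [jlt|ij|e] := ltgtP j i; last by rewrite e eqxx in ji.
  by rewrite w'0 //; exact: vgt0r.
by apply: vge_gt ij (gr_vge (wX j)).
Qed.

Definition fg_supported x := exists2 s, nonneg_seq s & homog_closure (sgen s) x.

Lemma fg_supported_common (xs : seq K) : (forall x, x \in xs -> fg_supported x) ->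
  exists2 s, nonneg_seq s & forall x, x \in xs -> homog_closure (sgen s) x.
Proof.
elim: xs => [|x xs IH] h; first by exists [::].
have [s s0 hs] := h x (mem_head _ _).
have [|t t0 ht] := IH; first by move=> y yxs; apply: h; rewrite inE yxs orbT.
exists (s ++ t) => [a|y]; first by rewrite mem_cat => /orP[/s0|/t0].
rewrite inE => /predU1P[->|/ht].
  by apply: homog_closure_mono hs; apply: sgen_sub => a; rewrite mem_cat => ->.
by apply: homog_closure_mono; apply: sgen_sub => a; rewrite mem_cat orbC => ->.
Qed.

Lemma fg_supported_add x y : fg_supported x -> fg_supported y -> fg_supported (x + y).
Proof.
move=> hx hy; have [|s s0 hs] := @fg_supported_common [:: x; y].
  by move=> z; rewrite !inE => /orP[] /eqP ->.
by exists s => //; apply: homog_closure_add; apply: hs; rewrite !inE eqxx ?orbT.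
Qed.

Lemma fg_supported_mul x y : fg_supported x -> fg_supported y -> fg_supported (x * y).
Proof.
move=> hx hy; have [|s s0 hs] := @fg_supported_common [:: x; y].
  by move=> z; rewrite !inE => /orP[] /eqP ->.
by exists s => //; apply: homog_closure_mul; try (by apply: hs; rewrite !inE eqxx ?orbT); exact: sgen_add.
Qed.

Lemma fg_supported_opp x : fg_supported x -> fg_supported (- x).
Proof. by case=> s s0 hs; exists s => //; exact: homog_closure_opp. Qed.

Lemma fg_supported_homog i h : 0 <= i -> X i h -> fg_supported h.
Proof.
move=> i0 hh; exists [:: i] => [a|]; first by rewrite inE => /eqP ->.
by apply/homog_sum_closure/(homog_sum_homog _ hh)/sgen_gen; rewrite inE.
Qed.

Lemma fg_supported0 : fg_supported 0. Proof. exact: fg_supported_homog (lexx 0) (gr0 gX 0). Qed.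
Lemma fg_supported1 : fg_supported 1. Proof. exact: fg_supported_homog (lexx 0) (gr1 gX). Qed.

Lemma fg_supported_exp x n : fg_supported x -> fg_supported (x ^+ n).
Proof.
move=> hx; elim: n => [|n IH]; first exact: fg_supported1.
by rewrite exprS; exact: fg_supported_mul.
Qed.

Lemma fg_supported_sum (I : Type) (r : seq I) (P : pred I) (F : I -> K) :
  (forall j, P j -> fg_supported (F j)) -> fg_supported (\sum_(j <- r | P j) F j).
Proof. by move=> h; elim/big_ind: _ => //; [exact: fg_supported0 | exact: fg_supported_add]. Qed.

Lemma fg_supported_horner (p : {poly K}) x : (forall i, fg_supported p`_i) -> fg_supported x -> fg_supported p.[x].
Proof.
move=> hp hx; rewrite horner_coef; apply: fg_supported_sum => i _.
by apply: fg_supported_mul => //; exact: fg_supported_exp.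
Qed.

Lemma fg_supported_vge0 x : fg_supported x -> vge v 0 x.
Proof.
move=> [s s0 hs]; have [y sy] := hs 0.
rewrite -{2}(subrK y x) => h; apply: vgeD => //.
elim: sy => [|i h' z Si hh _ IH]; first exact: vge0r.
by apply: vgeD => //; apply: vge_trans (gr_vge hh); exact: sgen_ge0 s0 Si.
Qed.

(** Terms of degree at most e do not occur in x, and what remains of the
    semigroup above e is finitely generated after translation. *)
Lemma fg_supported_shift x e h : X e h -> h != 0 -> vgt v e x -> fg_supported x -> fg_supported (x / h).
Proof.
move=> hh h0 ex [s s0 hs]; have [t t0 ht] := sgen_shift e s0.
exists t => //; rewrite mulrC.
apply: (homog_closure_scale _ (grV gX hh) (homog_closure_above hs ex)) => i [si ei].
by rewrite addrC; exact: ht.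
Qed.

Lemma fg_supported_homog_sum S x : (forall i, S i -> 0 <= i) -> homog_sum S x -> fg_supported x.
Proof.
move=> S0; elim=> [|i h y Si hh _ IH]; first exact: fg_supported0.
by apply: fg_supported_add IH; exact: fg_supported_homog (S0 _ Si) hh.
Qed.

Lemma horner_contract (p : {poly K}) (e : R) x y :
  (forall i, vge v e p`_i) -> vge v 0 x -> vge v 0 y ->
  forall l, vge v l (x - y) -> vge v (e + l) (p.[x] - p.[y]).
Proof.
move=> hp x0 y0 l hxy; rewrite !horner_coef -sumrB.
apply: vge_sum => i _; rewrite -mulrBr; apply: vgeM => //.
rewrite subrXX -[l]addr0; apply: vgeM => //.
by apply: vge_sum => j _; apply: vgeM0; exact: vgeX.
Qed.

(** The iterates of p from 0 are finite polynomial expressions in the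
    coefficients and converge to x, because p contracts by the least value of
    its coefficients. *)
Lemma fg_supported_fixpoint (p : {poly K}) x : (forall i, fg_supported p`_i) ->
  (forall i, vgt v 0 p`_i) -> vge v 0 x -> x = p.[x] -> fg_supported x.
Proof.
move=> pW p0 x0 xE.
have [|s s0 hs] := @fg_supported_common (polyseq p).
  by move=> y /(nthP 0)[i _ <-].
have [|e e0 he] := @vgt_finite _ _ v _ (polyseq p) id 0.
  by move=> y /(nthP 0)[i _ <-].
have he' i : vge v e p`_i.
  have [ip|ip] := ltnP i (size p); first by apply: he; exact: mem_nth.
  by rewrite nth_default //; exact: vge0r.
have hs' i : homog_closure (sgen s) p`_i.
  have [ip|ip] := ltnP i (size p); first by apply: hs; exact: mem_nth.
  by rewrite nth_default //; apply: homog_sum_closure; exact: homog_sum0.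
pose u n := iter n (horner p) 0.
have uW n : homog_closure (sgen s) (u n).
  elim: n => [|n IH]; first by apply: homog_sum_closure; exact: homog_sum0.
  rewrite /u /= -/(u n) horner_coef; elim/big_ind: _ => [||i _].
  - by apply: homog_sum_closure; exact: homog_sum0.
  - exact: homog_closure_add.
  - apply: homog_closure_mul => //; first exact: sgen_add.
    elim: (nat_of_ord i) => [|m IHm].
      by apply/homog_sum_closure/(homog_sum_homog (sgen0 s))/(gr1 gX).
    by rewrite exprS; apply: homog_closure_mul => //; exact: sgen_add.
have u0 n : vge v 0 (u n) by apply: fg_supported_vge0; exists s.
exists s => //; apply: homog_closure_closed => l.
have ul n : vge v (e *+ n) (x - u n).
  elim: n => [|n IH]; first by rewrite subr0.
  by rewrite mulrS {1}xE; apply: horner_contract.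
have [N [_ lN]] := mulrn_above l e0.
by exists (u N) => //; exact: vge_trans (ltW lN) (ul N).
Qed.

(** The coefficient of degree i is the same in all approximations that are
    precise beyond i, so reading it off at precision i + 1 defines the
    expansion. *)
Lemma homog_closure_expansion S x : homog_closure S x ->
  exists w, [/\ forall i, X i (w i), forall i, w i != 0 -> S i &
    forall l, exists r : seq R, [/\ uniq r, {in r, forall i, w i != 0} &
      forall r', uniq r' -> {subset r <= r'} -> vge v l (x - \sum_(i <- r') w i)]].
Proof.
move=> hx.
have nf l : exists wr : (R -> K) * seq R, [/\ forall i, X i (wr.1 i),
    forall i, wr.1 i != 0 -> S i, support_in wr.1 wr.2, uniq wr.2 &
    vge v l (x - \sum_(i <- wr.2) wr.1 i)].
  have [y /homog_sum_normal_form[w [r [h1 h2 h3 h4 ->]]] h] := hx l.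
  by exists (w, r).
pose W l := (projT1 (cid (nf l))).1; pose T l := (projT1 (cid (nf l))).2.
have WX l i : X i (W l i) by rewrite /W; case: cid => ? [].
have WS l i : W l i != 0 -> S i by rewrite /W; case: cid => ? [] /= _ + _ _ _; apply.
have WT l : support_in (W l) (T l) by rewrite /W /T; case: cid => ? [].
have uT l : uniq (T l) by rewrite /T; case: cid => ? [].
have hW l : vge v l (x - \sum_(i <- T l) W l i) by rewrite /W /T; case: cid => ? [].
have stable l l' i : i < l -> i < l' -> W l i = W l' i.
  move=> il il'; apply/eqP; rewrite -subr_eq0; apply/eqP.
  pose r := undup (T l ++ T l').
  have ur : uniq r by exact: undup_uniq.
  have sub1 : support_in (W l) r by move=> j /WT; rewrite mem_undup mem_cat => ->.
  have sub2 : support_in (W l') r by move=> j /WT; rewrite mem_undup mem_cat orbC => ->.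
  have [ir|ir] := boolP (i \in r); last first.
    have -> : W l i = 0 by apply/eqP/negPn/negP => /sub1; exact/negP.
    have -> : W l' i = 0 by apply/eqP/negPn/negP => /sub2; exact/negP.
    by rewrite subr0.
  apply: (@homog_sum_coef_eq0 (fun j => W l j - W l' j) r i) => //.
    by move=> j; apply: (grD gX) => //; exact: (grN gX).
  rewrite sumrB -(support_in_sum (uT l) ur (@WT l) sub1).
  rewrite -(support_in_sum (uT l') ur (@WT l') sub2).
  apply: (@vgt_dist _ _ _ _ x); last exact: vge_gt il' (hW l').
  exact/vgtBC/(vge_gt il)/hW.
exists (fun i => W (i + 1) i); split=> // [i|l]; first exact: WS.
have wE i : i < l -> W (i + 1) i = W l i by move=> il; apply: stable => //; lra.
exists [seq i <- T l | (i < l) && (W l i != 0)]; split.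
- by rewrite filter_uniq.
- by move=> i; rewrite mem_filter => /andP[/andP[il h] _]; rewrite wE.
move=> r' ur' sub; apply: (vge_dist (hW l)).
pose r := undup (T l ++ r').
have ur : uniq r by exact: undup_uniq.
rewrite (support_in_sum (uT l) ur (@WT l)); last first.
  by move=> j /WT; rewrite mem_undup mem_cat => ->.
pose w' i := if i \in r' then W (i + 1) i else 0.
have -> : \sum_(i <- r') W (i + 1) i = \sum_(i <- r) w' i.
  rewrite (support_in_sum ur ur').
  - by rewrite !big_seq; apply: eq_bigr => i ir; rewrite /w' ir.
  - by move=> i; rewrite /w'; case: ifP; rewrite ?eqxx // mem_undup mem_cat orbC => ->.
  - by move=> i; rewrite /w'; case: ifP; rewrite ?eqxx.
rewrite -sumrB; apply: vge_sum => i _; have [li|il] := leP l i.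
  apply: vgeB; first exact: vge_trans li (gr_vge (WX _ _)).
  by rewrite /w'; case: ifP => _; [exact: vge_trans li (gr_vge (WX _ _)) | exact: vge0r].
rewrite /w' wE //; case: ifPn => [_|ir']; first by rewrite subrr; exact: vge0r.
suff -> : W l i = 0 by rewrite subr0; exact: vge0r.
apply/eqP/negPn/negP => W0; move/negP: ir'; apply; apply: sub.
by rewrite mem_filter il W0 WT.
Qed.

End GradedFields.

(** * Values of conjugates over a complete field *)

Section CompleteFields.
Variables (R : realType) (K L : fieldType) (f : {rmorphism K -> L}).
Variables (vK : valuation R K) (vL : valuation R L).
Hypothesis vLf : forall x, vL (f x) = vK x.

Definition val_complete := forall u : nat -> K,
  (forall l, exists N, forall p q, (N <= p)%N -> (N <= q)%N -> vge vK l (u p - u q)) ->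
  exists x, forall l, exists N, forall p, (N <= p)%N -> vge vK l (x - u p).

Definition independent m (b : 'I_m -> L) :=
  forall c : 'I_m -> K, \sum_i f (c i) * b i = 0 -> forall i, c i = 0.

Lemma vge_emb l x : vge vL l (f x) <-> vge vK l x. Proof. by rewrite /vge vLf. Qed.
Lemma vgt_emb l x : vgt vL l (f x) <-> vgt vK l x. Proof. by rewrite /vgt vLf. Qed.

Definition ord_extend m (a : K) (c : 'I_m -> K) : 'I_m.+1 -> K :=
  fun i => oapp c a (unlift ord0 i).

Lemma ord_extend0 m a (c : 'I_m -> K) : ord_extend a c ord0 = a.
Proof. by rewrite /ord_extend unlift_none. Qed.
Lemma ord_extendS m a (c : 'I_m -> K) i : ord_extend a c (lift ord0 i) = c i.
Proof. by rewrite /ord_extend liftK. Qed.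

Lemma ord_extend_sum m a (c : 'I_m -> K) (b : 'I_m.+1 -> L) :
  \sum_i f (ord_extend a c i) * b i =
  f a * b ord0 + \sum_i f (c i) * b (lift ord0 i).
Proof.
rewrite big_ord_recl ord_extend0; congr (_ + _).
by apply: eq_bigr => i _; rewrite ord_extendS.
Qed.

Hypothesis complete : val_complete.

(** All norms on a finite-dimensional space over a complete field are
    equivalent. By induction the span of the first vectors is complete, so the
    next vector stays at a bounded distance from it: approximations of
    unbounded precision would converge to a linear relation. *)
Lemma independent_bound m (b : 'I_m -> L) : independent b ->
  exists C, forall l (c : 'I_m -> K), vge vL l (\sum_i f (c i) * b i) -> forall i, vge vK (l - C) (c i).
Proof.
elim: m b => [|m IH] b ib; first by exists 0 => l c _ [].
pose b' i := b (lift ord0 i).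
have ib' : independent b'.
  move=> c c0 i; rewrite -(ord_extendS 0 c i); apply: (ib (ord_extend 0 c)).
  by rewrite ord_extend_sum rmorph0 mul0r add0r.
have [C hC] := IH b' ib'.
have [C' hC'] : exists C', forall c, ~ vge vL C' (b ord0 + \sum_i f (c i) * b' i).
  apply: contrapT => /forallNP far.
  have {far} near (n : nat) : exists c, vge vL n%:R (b ord0 + \sum_i f (c i) * b' i).
    by apply: contrapT => /forallNP; exact: far.
  pose c n := projT1 (cid (near n)).
  have hc n : vge vL n%:R (b ord0 + \sum_i f (c n i) * b' i) by rewrite /c; case: cid.
  have hd l n n' : l <= n%:R -> l <= n'%:R -> forall i, vge vK (l - C) (c n i - c n' i).
    move=> ln ln'; apply: (hC l (fun i => c n i - c n' i)).
    under eq_bigr do rewrite rmorphB mulrBl.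
    rewrite sumrB -(addrKA (b ord0)) ![_ + b ord0]addrC.
    by apply: vgeB; [exact: vge_trans (hc n) | exact: vge_trans (hc n')].
  have lim i : exists x, forall l, exists N, forall p, (N <= p)%N -> vge vK l (x - c p i).
    apply: complete => l; have [N hN] := nat_above (l + C); exists N => p q Np Nq.
    by rewrite -(addrK C l); apply: hd; exact: hN.
  pose x i := projT1 (cid (lim i)).
  have hx i l : exists N, forall p, (N <= p)%N -> vge vK l (x i - c p i).
    by rewrite /x; case: cid.
  have [B hB] := vge_finite vL (index_enum _) b'.
  suff z0 : b ord0 + \sum_i f (x i) * b' i = 0.
    have := @ib (ord_extend 1 x); rewrite ord_extend_sum rmorph1 mul1r => /(_ z0 ord0).
    by rewrite ord_extend0 => /eqP; rewrite oner_eq0.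
  apply: (@vge_eq0 _ _ vL) => l.
  pose N i := projT1 (cid (hx i (l - B))).
  have hN i p : (N i <= p)%N -> vge vK (l - B) (x i - c p i).
    by rewrite /N; case: cid => N0 /= h; exact: h.
  have [N0 hN0] := nat_above l; pose M := (N0 + \sum_i N i)%N.
  have hM : vge vL l (b ord0 + \sum_i f (c M i) * b' i).
    by apply: vge_trans (hc M); apply: hN0; exact: leq_addr.
  rewrite -[X in vge _ _ X](subrK (b ord0 + \sum_i f (c M i) * b' i)).
  apply: vgeD => //; rewrite opprD addrACA subrr add0r -sumrB.
  apply: vge_sum => i _; rewrite -mulrBl -rmorphB -(subrK B l).
  apply: vgeM; last by apply: hB; rewrite mem_index_enum.
  by apply/vge_emb/hN; rewrite /M (bigD1 i) //= addnCA leq_addr.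
have [B hB] := vge_finite vL [:: b ord0] id.
have {}hB : vge vL B (b ord0) by apply: hB; rewrite inE.
pose D := Num.max C' 0.
have hD : C' <= D by rewrite le_max lexx.
pose E := Num.max D (C + Num.max 0 (D - B)).
exists E => l c; rewrite big_ord_recl => hl.
have h0 : vge vK (l - D) (c ord0).
  have [->|c0] := eqVneq (c ord0) 0; first exact: vge0r.
  have [e he] := val_real vK c0.
  have he' : vL (f (c ord0)) = e%:E by rewrite vLf.
  have := vge_div he' hl; rewrite mulrDl mulrAC divff ?fmorph_eq0 // mul1r mulr_suml.
  under eq_bigr do rewrite mulrAC -fmorph_div.
  move=> h; rewrite /vge he lee_fin leNgt; apply/negP => elt.
  by apply: (hC' (fun i => c (lift ord0 i) / c ord0)); apply: vge_trans h; lra.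
move=> i; case: (unliftP ord0 i) => [j ->|->]; last first.
  by apply: vge_trans h0; rewrite lerD2l lerN2 le_max lexx.
pose l' := Num.min l (l - D + B).
have : vge vL l' (\sum_i f (c (lift ord0 i)) * b' i).
  rewrite -[X in vge _ _ X](addKr (f (c ord0) * b ord0)) addrC; apply: vgeB.
    by apply: vge_trans hl; rewrite ge_min lexx.
  apply: (@vge_trans _ _ _ _ (l - D + B)); first by rewrite ge_min lexx orbT.
  by apply: vgeM => //; apply/vge_emb.
move=> /(hC l' (fun i => c (lift ord0 i)))/(_ j); apply: vge_trans.
apply: (@le_trans _ _ (l - (C + Num.max 0 (D - B)))).
  by rewrite lerD2l lerN2 le_max lexx orbT.
rewrite /l' /Num.min; case: ltP => _; rewrite /Num.max; case: ltP; lra.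
Qed.

(** The powers of x and of y have the same coordinates modulo p, and both
    valuations are within a constant of the norm of these coordinates. So the
    values of x^n and y^n differ by a bounded amount, for every n. *)
Lemma conjugates_vge (p : {poly K}) (x y : L) : p \is monic ->
  (forall q, root (map_poly f q) x -> p %| q) ->
  (forall q, root (map_poly f q) y -> p %| q) ->
  root (map_poly f p) x -> root (map_poly f p) y ->
  forall d, vL x = d%:E -> vge vL d y.
Proof.
move=> pm px py rx ry d xd.
pose m := (size p).-1; have p0 := monic_neq0 pm.
have pS : size p = m.+1 by rewrite polySpred.
have evalE z (q : {poly K}) : (size q <= m)%N ->
    (map_poly f q).[z] = \sum_(i < m) f q`_i * z ^+ i.
  move=> qm; rewrite (@horner_coef_wide _ m) ?size_map_poly //.
  by apply: eq_bigr => i _; rewrite coef_map.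
have ind z : (forall q, root (map_poly f q) z -> p %| q) ->
    independent (fun i : 'I_m => z ^+ i).
  move=> pz c c0; pose q := \poly_(i < m) (if insub i is Some j then c j else 0).
  have qc (i : 'I_m) : q`_i = c i.
    by rewrite coef_poly ltn_ord insubT // => h; congr c; exact: val_inj.
  have qm : (size q <= m)%N by exact: size_poly.
  suff q0 : q = 0 by move=> i; rewrite -qc q0 coef0.
  apply/eqP; apply: contraTT qm => q0.
  have : p %| q.
    apply: pz; rewrite rootE evalE ?size_poly //; apply/eqP; rewrite -[RHS]c0.
    by apply: eq_bigr => i _; rewrite qc.
  by move/(dvdp_leq q0); rewrite pS -ltnNge.
have [C hC] := independent_bound (ind x px).
have [B hB] := vge_finite vL (index_enum _) (fun i : 'I_m => y ^+ i).
have key n : vge vL (d *+ n - C + B) (y ^+ n).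
  pose q := 'X^n %% p.
  have qm : (size q <= m)%N by rewrite -ltnS -pS ltn_modp.
  have powE z : root (map_poly f p) z -> z ^+ n = \sum_(i < m) f q`_i * z ^+ i.
    move=> rz; rewrite -evalE //.
    have -> : z ^+ n = (map_poly f 'X^n).[z] by rewrite map_polyXn hornerXn.
    rewrite (divp_eq 'X^n p) rmorphD rmorphM /= hornerD hornerM.
    by rewrite (rootP rz) mulr0 add0r.
  have := hC (d *+ n) (fun i => q`_i); rewrite -powE // => /(_ (val_vge (valX_real n xd))).
  move=> h; rewrite powE //; apply: vge_sum => i _; apply: vgeM.
    exact/vge_emb/h.
  by apply: hB; rewrite mem_index_enum.
have [->|/(val_real vL)[e ye]] := eqVneq y 0; first exact: vge0r.
rewrite /vge ye lee_fin leNgt; apply/negP => ed.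
have ed0 : 0 < d - e by lra.
have [n [_]] := mulrn_above (C - B) ed0; rewrite mulrnBl => h1.
have h2 := val_vge_le (valX_real n ye) (key n).
by clear xd ye pS; lra.
Qed.

(** Irreducibility makes p the minimal polynomial of each of its roots, so
    [conjugates_vge] applies in both directions. *)
Lemma conjugates_val (p : {poly K}) (x y : L) : p \is monic ->
  (forall q, root (map_poly f q) x -> p %| q) ->
  root (map_poly f p) x -> root (map_poly f p) y -> vL x = vL y.
Proof.
move=> pm px rx ry.
have p0 := monic_neq0 pm.
have py q : root (map_poly f q) y -> p %| q.
  move=> qy; have [p' [p'm p'y p'min]] : exists p' : {poly K}, [/\ p' \is monic,
      root (map_poly f p') y & forall q, root (map_poly f q) y -> p' %| q].
    by apply: minpoly_exists; exists p.
  have /dvdpP[r pE] := p'min p ry.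
  suff : p %| p' by move/dvdp_trans; apply; exact: p'min.
  move: rx; rewrite pE rmorphM rootM => /orP[rx|rx].
    have r0 : r != 0 by apply: contraNneq p0; rewrite pE => ->; rewrite mul0r.
    have := dvdp_leq r0 (px _ rx); rewrite pE size_mul //; last exact: monic_neq0.
    have : (1 < size p')%N.
      rewrite -(size_map_poly f); apply: root_size_gt1 p'y.
      by rewrite map_poly_eq0 monic_neq0.
    case: (size p') => [|[|k]] // _; rewrite !addnS /= -ltn_subRL subnn //.
  by have := px _ rx; rewrite {1}pE.
have [x0|x0] := eqVneq x 0.
  have [->|y0] := eqVneq y 0; first by rewrite x0.
  have : p %| 'X by apply: px; rewrite x0 map_polyX rootX.
  move=> /dvdpP[r /(congr1 (fun q => (map_poly f q).[y]))].
  by rewrite rmorphM hornerM (rootP ry) mulr0 map_polyX hornerX => /eqP; rewrite (negPf y0).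
have [d xd] := val_real vL x0.
have hy := conjugates_vge pm px py rx ry xd.
have y0 : y != 0.
  apply: contraNneq x0 => y0.
  have : p %| 'X by apply: py; rewrite y0 map_polyX rootX.
  move=> /dvdpP[r /(congr1 (fun q => (map_poly f q).[x]))].
  by rewrite rmorphM hornerM (rootP rx) mulr0 map_polyX hornerX => ->.
have [e ye] := val_real vL y0.
have hx := conjugates_vge pm py px ry rx ye.
by rewrite xd ye; congr (_%:E); apply/eqP; rewrite eq_le (val_vge_le xd hx) (val_vge_le ye hy).
Qed.

End CompleteFields.

(** * Homogeneous elements of an algebraically closed extension *)

Section HomogeneousElements.
Variables (R : realType) (K : fieldType) (L : fieldType) (f : {rmorphism K -> L}).
Variables (vK : valuation R K) (vL : valuation R L).
Hypothesis splitL : splits L.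
Hypothesis vLf : forall x, vL (f x) = vK x.
Variable G : R -> set K.
Hypothesis gG : graded_pieces vK G.
Implicit Types (d e : R) (c : L).

Lemma subfield_degree0 : subfield (G 0).
Proof.
split=> [|x y hx hy|x y hx hy]; first exact: gr1 gG.
- by apply: (grD gG) => //; exact: (grN gG).
- by rewrite -(subrr 0); exact: gr_div gG _ _ _ _ hx hy.
Qed.

Definition degree0_emb : {rmorphism subfield_type subfield_degree0 -> L} :=
  f \o subfield_incl subfield_degree0.

(** The degree-zero homogeneous elements of L. They play the role of the residue
    field of L, here lifted to a subfield. *)
Definition degree0_alg c : Prop := algebraicOver degree0_emb c.
Local Notation A0 := degree0_alg.

Lemma alg0_emb x : G 0 x -> A0 (f x).
Proof.
move=> /(subfield_inclE subfield_degree0)[y <-].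
exact: (algebraic_id degree0_emb y).
Qed.

Lemma alg0_root (p : {poly L}) c : p != 0 -> root p c -> (forall i, A0 p`_i) -> A0 c.
Proof.
move=> p0 pc hp; apply/integral_algebraic; apply: integral_root p0 pc _.
by move=> _ /(nthP 0)[i _ <-]; apply/integral_algebraic; exact: hp.
Qed.

Lemma alg0_mul c c' : A0 c -> A0 c' -> A0 (c * c'). Proof. exact: algebraic_mul. Qed.
Lemma alg0_add c c' : A0 c -> A0 c' -> A0 (c + c'). Proof. exact: algebraic_add. Qed.
Lemma alg0_inv c : A0 c -> A0 c^-1. Proof. exact: algebraic_inv. Qed.
Lemma alg0_1 : A0 1. Proof. exact: algebraic1. Qed.
Lemma alg0_0 : A0 0. Proof. exact: algebraic0. Qed.
Lemma alg0_exp c n : A0 c -> A0 (c ^+ n).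
Proof.
by move=> h; elim: n => [|n IH]; [exact: alg0_1 | rewrite exprS; exact: alg0_mul].
Qed.

Lemma alg0_exp_inv c n : (0 < n)%N -> A0 (c ^+ n) -> A0 c.
Proof.
move=> n0 h; apply: (@alg0_root ('X^n - (c ^+ n)%:P)).
- by rewrite -size_poly_gt0 size_XnsubC.
- by rewrite rootE !hornerE subrr.
- move=> i; rewrite coefB coefXn coefC.
  apply: algebraic_sub; first by case: (i == n); [exact: alg0_1 | exact: alg0_0].
  by case: (i == 0%N) => //; exact: alg0_0.
Qed.

(** In the minimal polynomial over G 0 the constant coefficient has value 0,
    while all other terms at c have positive value. *)
Lemma alg0_vgt_eq0 c : A0 c -> vgt vL 0 c -> c = 0.
Proof.
move=> hc vc; have [p [pm pc pmin]] := minpoly_exists hc.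
apply/eqP/negPn/negP => c0.
have p00 : p`_0 != 0.
  apply: contraTneq pc => p00.
  have /dvdpP[q pE] : 'X %| p by rewrite -['X]subr0 -polyC0 dvdp_XsubCl rootE horner_coef0 p00.
  have eX : map_poly degree0_emb 'X = 'X := map_polyX degree0_emb.
  apply/negP; rewrite pE rmorphM rootM => /orP[/pmin|]; last by rewrite [X in root X _]eX rootX (negPf c0).
  have q0 : q != 0.
    by apply: contraNneq (monic_neq0 pm); rewrite pE => ->; rewrite mul0r.
  by move/(dvdp_leq q0); rewrite pE size_mulX // ltnn.
have v0 i : vge vL 0 (degree0_emb p`_i).
  by rewrite /vge /= vLf; apply: (gr_vge gG); exact: subfield_inclP.
move: pc; rewrite rootE (@horner_coef_wide _ (size p)) ?size_map_poly //.
rewrite polySpred ?monic_neq0 // big_ord_recl expr0 mulr1 coef_map => /eqP/addr0_eq e.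
have : vgt vL 0 (- degree0_emb p`_0).
  rewrite e; apply: vgt_sum => i _; rewrite mulrC exprS -mulrA coef_map.
  by apply: vgtM0 => //; apply: vgeM0; [exact/vgeX/vgt_ge | exact: v0].
move=> /vgtN; apply: val_nvgt => /=.
rewrite vLf; apply: (gr_val gG); first exact: subfield_inclP.
by move: p00; rewrite -(fmorph_eq0 (subfield_incl subfield_degree0)).
Qed.

Lemma alg0_val c : A0 c -> c != 0 -> vL c = 0%:E.
Proof.
move=> hc c0; have [d cd] := val_real vL c0.
have [d0|d0|d0] := ltgtP d 0; last by rewrite cd d0.
  have c00 := @alg0_vgt_eq0 c^-1 (alg0_inv hc).
  have : c^-1 != 0 by rewrite invr_eq0.
  rewrite c00 ?eqxx //; apply: vge_gt (val_vge (valV_real cd)).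
  by rewrite oppr_gt0.
have c00 := @alg0_vgt_eq0 c hc.
by move: c0; rewrite c00 ?eqxx //; apply: vge_gt d0 (val_vge cd).
Qed.

(** Homogeneous elements of degree d, described multiplicatively: up to a
    factor algebraic over G 0, a radical of an element of a piece of K. In this
    form products are evident and sums reduce to degree zero, the ratio of two
    elements of the same degree being algebraic over G 0. *)
Definition homogeneous d : set L := [set c | c = 0 \/
  exists N g a, [/\ (0 < N)%N, G (d *+ N) g, g != 0, A0 a & c ^+ N = a * f g]].

Lemma homog_emb d g : G d g -> homogeneous d (f g).
Proof.
have [->|g0 hg] := eqVneq g 0; first by rewrite rmorph0; left.
by right; exists 1%N, g, 1; split=> //; [exact: alg0_1 | rewrite mul1r].
Qed.

Lemma homog_ratio d c c' : homogeneous d c -> homogeneous d c' -> A0 (c' / c).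
Proof.
case=> [-> _|[N [g [a [N0 hg g0 ha cE]]]]]; first by rewrite invr0 mulr0; exact: alg0_0.
case=> [->|[M [h [b [M0 hh h0 hb c'E]]]]]; first by rewrite mul0r; exact: alg0_0.
apply: (@alg0_exp_inv _ (N * M)); first by rewrite muln_gt0 N0.
rewrite expr_div_n mulnC [in X in X / _]exprM c'E mulnC [in X in _ / X]exprM cE !exprMn -!rmorphXn.
rewrite invfM mulrACA -fmorphV -rmorphM; apply: alg0_mul.
  by apply: alg0_mul; [exact: alg0_exp | apply: alg0_inv; exact: alg0_exp].
apply: alg0_emb; rewrite -(subrr (d *+ (N * M))); apply: (gr_div gG).
  by rewrite mulnC mulrnA; exact: (grX gG).
by rewrite mulrnA; exact: (grX gG).
Qed.

Lemma homog_scale d c t : homogeneous d c -> A0 t -> homogeneous d (t * c).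
Proof.
case=> [->|[N [g [a [N0 hg g0 ha cE]]]]] ht; first by rewrite mulr0; left.
right; exists N, g, (t ^+ N * a); split=> //.
  by apply: alg0_mul => //; exact: alg0_exp.
by rewrite exprMn cE mulrA.
Qed.

Lemma homog_val d c : homogeneous d c -> c != 0 -> vL c = d%:E.
Proof.
case=> [->|[N [g [a [N0 hg g0 ha cE]]]] c0]; first by rewrite eqxx.
have [e ce] := val_real vL c0.
have a0 : a != 0.
  apply: contraNneq c0 => a0; move/eqP: cE.
  by rewrite a0 mul0r expf_eq0 => /andP[].
have h1 := valX_real N ce.
have := valM_real (alg0_val ha a0) (etrans (vLf g) (gr_val gG hg g0)).
rewrite -cE h1 add0r ce => -[/eqP]; rewrite -subr_eq0 -mulrnBl mulrn_eq0.
by rewrite (gtn_eqF N0) subr_eq0 => /eqP ->.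
Qed.

Lemma homog_graded : graded_pieces vL homogeneous.
Proof.
split.
- by move=> d; left.
- move=> d x y hx hy; have [->|x0] := eqVneq x 0; first by rewrite add0r.
  have -> : x + y = (1 + y / x) * x by rewrite mulrDl mul1r divfK.
  apply: homog_scale => //; apply: alg0_add alg0_1 _; exact: homog_ratio hx hy.
- move=> d x hx; rewrite -mulN1r; apply: homog_scale => //.
  exact/algebraic_opp/alg0_1.
- by rewrite -(rmorph1 f); apply: homog_emb; exact: gr1 gG.
- move=> d e x y.
  case=> [->|[N [g [a [N0 hg g0 ha xE]]]]]; first by rewrite mul0r; left.
  case=> [->|[M [h [b [M0 hh h0 hb yE]]]]]; first by rewrite mulr0; left.
  right; exists (N * M)%N, (g ^+ M * h ^+ N), (a ^+ M * b ^+ N); split.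
  + by rewrite muln_gt0 N0.
  + rewrite mulrnDl; apply: (grM gG); first by rewrite mulrnA; exact: (grX gG).
    by rewrite mulnC mulrnA; exact: (grX gG).
  + by rewrite mulf_neq0 ?expf_neq0.
  + by apply: alg0_mul; exact: alg0_exp.
  + by rewrite exprMn exprM xE mulnC exprM yE !exprMn -!rmorphXn rmorphM mulrACA.
- move=> d x; case=> [->|[N [g [a [N0 hg g0 ha xE]]]]]; first by rewrite invr0; left.
  right; exists N, g^-1, a^-1; split=> //.
  + by rewrite mulNrn; exact: (grV gG).
  + by rewrite invr_eq0.
  + exact: alg0_inv.
  + by rewrite exprVn xE fmorphV invfM.
- exact: homog_val.
Qed.

(** Rescale the variable by a radical u of the ratio of two nonzero
    coefficients: powers of the new coefficients lie in G 0, so c / u is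
    algebraic over G 0. *)
Lemma homog_root (p : {poly K}) mu d c : p != 0 ->
  (forall i, G (mu - d *+ i) p`_i) -> root (map_poly f p) c -> homogeneous d c.
Proof.
move=> p0 hp pc; have [->|c0] := eqVneq c 0; first by left.
pose n := (size p).-1; have pS : size p = n.+1 by rewrite polySpred.
pose l := lead_coef p; have l0 : l != 0 by rewrite lead_coef_eq0.
have pn : p`_n = l by [].
have [j jn pj] : exists2 j, (j < n)%N & p`_j != 0.
  apply: contrapT => none; move: pc.
  rewrite rootE (@horner_coef_wide _ n.+1) ?size_map_poly ?pS // big_ord_recr /=.
  rewrite big1 ?add0r => [|i _].
    by rewrite coef_map pn mulf_eq0 fmorph_eq0 (negPf l0) expf_eq0 (negPf c0) andbF.
  rewrite coef_map; have [pi|pi] := eqVneq p`_i 0.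
    by apply/eqP; rewrite pi mulf_eq0 fmorph_eq0 eqxx.
  by case: none; exists i.
pose N := (n - j)%N; have N0 : (0 < N)%N by rewrite subn_gt0.
pose g := p`_j / l.
have g0 : g != 0 by rewrite mulf_neq0 ?invr_eq0.
have ratio i : (i <= n)%N -> G (d *+ (n - i)) (p`_i / l).
  move=> ijn; rewrite mulrnBr //.
  have -> : d *+ n - d *+ i = (mu - d *+ i) - (mu - d *+ n) by ring.
  exact: (gr_div gG).
have hg : G (d *+ N) g by apply: ratio; exact: ltnW.
have [u uE] : exists u, u ^+ N = f g.
  have [|u] := splits_root (p := 'X^N - (f g)%:P) splitL.
    by rewrite size_XnsubC.
  by rewrite rootE !hornerE subr_eq0 => /eqP; exists u.
have u0 : u != 0.
  apply: contraNneq g0 => u0; rewrite -(fmorph_eq0 f) -uE u0 expr0n.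
  by rewrite (gtn_eqF N0).
suff hz : A0 (c / u).
  right; exists N, g, ((c / u) ^+ N); split=> //; first exact: alg0_exp.
  by rewrite -uE -exprMn divfK.
pose q := \poly_(i < n.+1) (f (p`_i / l) * (u ^+ (n - i))^-1).
apply: (@alg0_root q).
- apply/eqP => /(congr1 (fun q : {poly L} => q`_n)).
  rewrite coef_poly ltnSn coef0 subnn expr0 invr1 mulr1 pn divff // rmorph1.
  by move/eqP; rewrite oner_eq0.
- rewrite rootE horner_poly; move: pc; rewrite rootE.
  rewrite (@horner_coef_wide _ n.+1) ?size_map_poly ?pS // => /eqP e.
  apply/eqP; transitivity ((f l)^-1 * (u ^+ n)^-1 * \sum_(i < n.+1) (map_poly f p)`_i * c ^+ i).
    rewrite mulr_sumr; apply: eq_bigr => i _.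
    rewrite coef_map fmorph_div expr_div_n.
    have -> : u ^+ n = u ^+ (n - i) * u ^+ i by rewrite -exprD subnK // -ltnS.
    by rewrite [in RHS]invfM; ring.
  by rewrite e mulr0.
move=> i; rewrite coef_poly; case: ltnP => [|_]; last exact: alg0_0.
rewrite ltnS => ijn; apply: (@alg0_exp_inv _ N) => //.
rewrite exprMn exprVn -exprM mulnC exprM uE -!rmorphXn -fmorphV -rmorphM.
apply: alg0_emb; rewrite -(subrr (d *+ (n - i) *+ N)); apply: (gr_div gG).
  by apply: (grX gG); exact: ratio.
by rewrite mulrnAC; exact: (grX gG).
Qed.

Hypothesis dense : forall x, homog_closure vK G setT x.

Lemma leading_form d x : vge vK d x -> exists2 g, G d g & vgt vK d (x - g).
Proof.
move=> dx; have [xd|nx] := pselect (vgt vK d x).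
  by exists 0; [exact: gr0 gG d | rewrite subr0].
by have [h hh [_ ?]] := homog_closure_leading gG (dense x) (val_between dx nx); exists h.
Qed.

(** The leading form of x in K is also its leading form in L, and a homogeneous
    element is its own leading form. *)
Lemma homog_descend d x : homogeneous d (f x) -> G d x.
Proof.
move=> h; have [|g hg xg] := @leading_form d x.
  by apply/(vge_emb vLf); exact: gr_vge homog_graded _ _ h.
suff -> : x = g by [].
apply: (fmorph_inj f); apply: (gr_leading_unique homog_graded h (homog_emb hg)).
by rewrite -rmorphB; apply/(vgt_emb vLf).
Qed.

Hypothesis algf : forall c, algebraicOver f c.

(** In a polynomial over K vanishing at c, replace each coefficient by its part
    that contributes to the least value of the terms at c. The resulting
    polynomial has homogeneous coefficients, so its roots are homogeneous by
    [homog_root], and its value at c is larger than that of its terms, so one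
    of its roots is close to c. *)
Lemma homog_leading_form c d : vL c = d%:E ->
  exists2 h, homogeneous d h & vgt vL d (c - h).
Proof.
move=> cd; have c0 := val_real_neq0 cd.
have [p p0 pc] := algf c.
have [mu [[i0 i0p hi0] hmu]] : exists mu,
    (exists2 i, i \in iota 0 (size p) & vL (f p`_i * c ^+ i) = mu%:E) /\
    forall i, i \in iota 0 (size p) -> vge vL mu (f p`_i * c ^+ i).
  apply: (@val_min_exists _ _ _ _ _ _ (size p).-1).
    by rewrite mem_iota /= add0n prednK // size_poly_gt0.
  by rewrite mulf_neq0 ?expf_neq0 // fmorph_eq0 lead_coef_eq0.
have cX i := valX_real i cd.
have hp i : vge vK (mu - d *+ i) p`_i.
  have [ip|ip] := ltnP i (size p); last by rewrite nth_default //; exact: vge0r.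
  apply/(vge_emb vLf); rewrite -[f _](mulfK (expf_neq0 i c0)).
  by apply: vge_div (cX i) _; apply: hmu; rewrite mem_iota.
have lead i : exists g, G (mu - d *+ i) g /\ vgt vK (mu - d *+ i) (p`_i - g).
  by have [g ? ?] := leading_form (hp i); exists g.
pose g i := if (i < size p)%N then projT1 (cid (lead i)) else 0.
have gG' i : G (mu - d *+ i) (g i).
  by rewrite /g; case: ifP => _; [case: cid => ? [] | exact: gr0 gG _].
have gp i : vgt vK (mu - d *+ i) (p`_i - g i).
  rewrite /g; case: ltnP => ip; first by case: cid => ? [].
  by rewrite nth_default // subr0; exact: vgt0r.
pose q := \poly_(i < size p) g i.
have qE i : q`_i = g i.
  by rewrite coef_poly; case: ltnP => // ip; rewrite /g ltnNge ip.

have q0 : q != 0.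
  apply/eqP => /(congr1 (fun q : {poly K} => q`_i0)); rewrite qE coef0 => gi0.
  move: (gp i0); rewrite gi0 subr0 => /(vgt_emb vLf) h.
  have : vgt vL (mu - d *+ i0 + d *+ i0) (f p`_i0 * c ^+ i0).
    by apply: vgtM => //; exact: val_vge.
  by rewrite subrK => /(val_nvgt hi0).
have qc : vgt vL mu (map_poly f q).[c].
  have -> : (map_poly f q).[c] = - \sum_(i < size p) f (p`_i - g i) * c ^+ i.
    apply/eqP; rewrite -addr_eq0 addrC.
    rewrite (@horner_coef_wide _ (size p)) ?size_map_poly ?size_poly //.
    rewrite -big_split /=; move: pc.
    rewrite rootE (@horner_coef_wide _ (size p)) ?size_map_poly //.
    move=> /eqP pc; apply/eqP; rewrite -[RHS]pc; apply: eq_bigr => i _.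
    by rewrite !coef_map qE -mulrDl -rmorphD subrK.
  apply/vgtN; apply: vgt_sum => i _; rewrite -(subrK (d *+ i) mu).
  by apply: vgtM; [exact/(vgt_emb vLf) | exact: val_vge].
have [s [qs sq]] := closed_split (map_poly f q) splitL.
have {}sq : size q = (size s).+1 by rewrite -sq ?map_poly_eq0 // size_map_poly.
have hl : vL (lead_coef (map_poly f q)) = (mu - d *+ size s)%:E.
  rewrite lead_coef_map vLf; apply: (gr_val gG); last by rewrite lead_coef_eq0.
  by rewrite lead_coefE sq qE.
have [|y] := @vgt_prod _ _ _ d _ _ [seq c - x | x <- s] hl.
  rewrite size_map subrK big_map.
  move: qc; rewrite {1}qs hornerZ horner_prod.
  by under eq_bigr do rewrite hornerXsubC.
move=> /mapP[x xs ->] hx; exists x => //.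
apply: (homog_root q0 (mu := mu)) => [i|]; first by rewrite qE.
by rewrite qs rootZ ?lead_coef_eq0 ?map_poly_eq0 // root_prod_XsubC.
Qed.

End HomogeneousElements.

(** * The field generated by the homogeneous elements *)

Section AlgebraicClosure.
Variables (R : realType) (K : fieldType) (L : fieldType) (f : {rmorphism K -> L}).
Variables (vK : valuation R K) (vL : valuation R L).
Hypothesis splitL : splits L.
Hypothesis vLf : forall x, vL (f x) = vK x.
Variable G : R -> set K.
Hypothesis gG : graded_pieces vK G.
Hypothesis dense : forall x, homog_closure vK G setT x.
Hypothesis algf : forall c, algebraicOver f c.
Hypothesis complete : val_complete vK.
Hypothesis char0 : forall n, n.+1%:R != 0 :> K.
Hypothesis nontrivial : exists e g, [/\ 0 < e, G e g & g != 0].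
Implicit Types (d e l mu : R) (c h x y : L) (S : set R).
Local Notation H := (homogeneous f gG).
Local Notation gH := (homog_graded vLf gG).

(** The K-linear combinations of homogeneous elements. As products of homogeneous
    elements are homogeneous and all elements are algebraic over K, this is the
    field generated by the homogeneous elements. *)
Inductive homog_span : L -> Prop :=
| homog_span0 : homog_span 0
| homog_span_cons a d b x : H d b -> homog_span x -> homog_span (f a * b + x).

Lemma homog_span_homog a d b : H d b -> homog_span (f a * b).
Proof. by move=> h; rewrite -[_ * b]addr0; apply: homog_span_cons h homog_span0. Qed.

Lemma homog_span_emb a : homog_span (f a).
Proof. by rewrite -[f a]mulr1; apply: homog_span_homog (gr1 gH). Qed.

Lemma homog_span1 : homog_span 1.
Proof. by rewrite -(rmorph1 f); exact: homog_span_emb. Qed.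

Lemma homog_span_gen d b : H d b -> homog_span b.
Proof. by move=> h; rewrite -[b]mul1r -(rmorph1 f); apply: homog_span_homog h. Qed.

Lemma homog_span_add x y : homog_span x -> homog_span y -> homog_span (x + y).
Proof.
move=> hx hy; elim: hx => [|a d b z hb _ IH]; first by rewrite add0r.
by rewrite -addrA; exact: homog_span_cons hb IH.
Qed.

Lemma homog_span_scale a d b x : H d b -> homog_span x -> homog_span (f a * b * x).
Proof.
move=> hb; elim=> [|a' d' b' z hb' _ IH]; first by rewrite mulr0; exact: homog_span0.
by rewrite mulrDr mulrACA -rmorphM; apply: homog_span_cons IH; exact: (grM gH hb hb').
Qed.

Lemma homog_span_mul x y : homog_span x -> homog_span y -> homog_span (x * y).
Proof.
move=> hx hy; elim: hx => [|a d b z hb _ IH]; first by rewrite mul0r; exact: homog_span0.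
by rewrite mulrDl; apply: homog_span_add IH; exact: homog_span_scale hb hy.
Qed.

Lemma homog_span_opp x : homog_span x -> homog_span (- x).
Proof.
move=> hx; rewrite -mulN1r -(rmorph1 f) -rmorphN; apply: homog_span_mul hx.
exact: homog_span_emb.
Qed.

Lemma homog_span_horner (p : {poly K}) x : homog_span x -> homog_span (map_poly f p).[x].
Proof.
move=> hx; rewrite horner_coef; elim/big_ind: _ => [||i _]; first exact: homog_span0.
  exact: homog_span_add.
rewrite coef_map; apply: homog_span_mul; first exact: homog_span_emb.
elim: (nat_of_ord i) => [|n IH]; first exact: homog_span1.
by rewrite exprS; exact: homog_span_mul.
Qed.

Lemma homog_span_inv x : homog_span x -> homog_span x^-1.
Proof.
have [->|x0] := eqVneq x 0; first by rewrite invr0.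
move=> hx; have [p [pm px pmin]] := minpoly_exists (algf x).
have [q [a pE]] : exists q a, p = q * 'X + a%:P.
  by elim/poly_ind: (p) => [|q a _]; [exists 0, 0; rewrite mul0r addr0 | exists q, a].
have hq : (map_poly f q).[x] * x = - f a.
  move: px; rewrite pE rootE rmorphD rmorphM /= map_polyX map_polyC /= !hornerE.
  by rewrite addr_eq0 => /eqP.
have a0 : a != 0.
  apply/eqP => a0; move: hq; rewrite a0 => /eqP.
  rewrite (_ : f 0 = 0) ?oppr0; last exact: rmorph0.
  rewrite mulf_eq0 (negPf x0) orbF => /pmin.
  have q0 : q != 0.
    by apply: contraNneq (monic_neq0 pm); rewrite pE a0 => ->; rewrite mul0r add0r polyC0.
  by move/(dvdp_leq q0); rewrite pE a0 polyC0 addr0 size_mulX // ltnn.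
have -> : x^-1 = f (- a^-1) * (map_poly f q).[x].
  apply: (mulIf x0); rewrite mulVf // -mulrA hq rmorphN mulrNN -rmorphM mulVf //.
  by rewrite rmorph1.
by apply: homog_span_mul; [exact: homog_span_emb | exact: homog_span_horner].
Qed.

Lemma subfield_hspan : subfield homog_span.
Proof.
split=> [|x y hx hy|x y hx hy]; first exact: homog_span1.
  by apply: homog_span_add => //; exact: homog_span_opp.
by apply: homog_span_mul => //; exact: homog_span_inv.
Qed.

(** This is where characteristic zero enters: integers are nonzero elements of
    degree 0. *)
Lemma natr_val n : vL n.+1%:R = 0%:E.
Proof.
rewrite -(rmorph_nat f) vLf; apply: (gr_val gG) => //.
elim: n => [|n IH]; first exact: gr1 gG.
rewrite -natr1; apply: (grD gG) => //; exact: gr1 gG.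
Qed.

(** For h in this field, x - h and x' - h are conjugate over it, hence they are
    roots of the same minimal polynomial over the complete field K. *)
Lemma homog_span_conjugates x h x' (P : {poly subfield_type subfield_hspan}) :
  let g := subfield_incl subfield_hspan in
  (forall Q, root (map_poly g Q) x -> P %| Q) ->
  root (map_poly g P) x' -> homog_span h -> vL (x' - h) = vL (x - h).
Proof.
move=> g Pmin Px' hh.
have [Q [Qm Qx Qmin]] := minpoly_exists (algf (x - h)).
have [T TE] : exists T, map_poly g T = map_poly f Q \Po ('X - h%:P).
  apply: poly_lift => i; apply: subfield_inclE.
  pose A := subfield_pred subfield_hspan.
  suff : map_poly f Q \Po ('X - h%:P) \is a polyOver A.
    by move=> /polyOverP/(_ i)/subfield_predP.
  apply: polyOver_comp.
    by apply/polyOverP => j; rewrite coef_map; apply/subfield_predP/homog_span_emb.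
  by rewrite polyOverXsubC; exact/subfield_predP.
have rT : root (map_poly g T) x.
  by rewrite TE rootE horner_comp hornerXsubC.
have /dvdpP[U TU] := Pmin T rT.
have : root (map_poly g T) x' by rewrite TU rmorphM rootM Px' orbT.
rewrite TE rootE horner_comp hornerXsubC => Qx'.
by apply/esym; apply: conjugates_val vLf complete _ _ _ Qm Qmin Qx Qx'.
Qed.

(** Let t be the mean of the conjugates of x, which lies in the field, and h a
    leading form of x - t. By the previous lemma h is a leading form of y - t for
    every conjugate y. These differences add up to 0, while n h, with n the
    number of conjugates, has the value of h in characteristic zero. So x = t. *)
Lemma homog_span_full x : homog_span x.
Proof.
pose g := subfield_incl subfield_hspan.
have algx : algebraicOver g x.
  have [p p0 px] := algf x.
  have [q qE] : exists q, map_poly g q = map_poly f p.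
    apply: poly_lift => i; rewrite coef_map; apply: subfield_inclE.
    exact: homog_span_emb.
  by exists q; [rewrite -(map_poly_eq0 g) qE map_poly_eq0 | rewrite qE].
have [P [Pm Px Pmin]] := minpoly_exists algx.
have [s [Ps _]] := closed_split (map_poly g P) splitL.
have {}Ps : map_poly g P = \prod_(y <- s) ('X - y%:P).
  by rewrite Ps lead_coef_map (monicP Pm) rmorph1 scale1r.
have s0 : size s != 0%N.
  by move: Px; rewrite Ps root_prod_XsubC; case: (s).
pose n := (size s).-1; have sn : size s = n.+1 by rewrite prednK // lt0n.
pose sg := \sum_(y <- s) y.
have hsg : homog_span sg.
  have -> : sg = - (map_poly g P)`_n by rewrite Ps coefPn_prod_XsubC // opprK.
  by apply: homog_span_opp; rewrite coef_map; exact: subfield_inclP.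
have n0 : n.+1%:R != 0 :> L by exact: val_real_neq0 (natr_val n).
pose t := sg / n.+1%:R.
have ht : homog_span t.
  apply: homog_span_mul => //; rewrite -(rmorph_nat f) -fmorphV; exact: homog_span_emb.
have [/eqP|xt] := eqVneq (x - t) 0; first by rewrite subr_eq0 => /eqP ->.
have [d hd] := val_real vL xt.
have [h hh xth] := homog_leading_form splitL vLf gG dense algf hd.
have h0 := val_real_neq0 (val_near hd xth).
have hth : homog_span (t + h) by apply: homog_span_add => //; exact: homog_span_gen hh.
have far y : y \in s -> vgt vL d (y - (t + h)).
  move=> ys; rewrite /vgt (homog_span_conjugates (x := x) Pmin) //.
    by rewrite opprD addrA.
  by rewrite Ps root_prod_XsubC.
have : vgt vL d (\sum_(y <- s) (y - (t + h))).
  by rewrite big_seq; apply: vgt_sum.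
rewrite sumrB -/sg big_const_seq count_predT iter_addr_0 sn.
rewrite -mulr_natr mulrDl divfK // opprD addNKr => /vgtN.
move=> hv; exfalso; apply: (val_nvgt _ hv).
by rewrite (valM_real (gr_val gH hh h0) (natr_val n)) addr0.
Qed.

Lemma homog_dense x : homog_closure vL H setT x.
Proof.
elim: (homog_span_full x) => [|a d b z hb _ IH]; first by apply: homog_sum_closure; exact: homog_sum0.
apply: (homog_closure_add _ IH); rewrite mulrC; apply: (homog_closure_scale gH (S := setT) _ hb) => //.
move=> l; have [y hy vy] := dense a l; exists (f y).
  elim: hy => [|i g w _ hg _ IHy]; first by rewrite rmorph0; exact: homog_sum0.
  by rewrite rmorphD; apply: homog_sum_cons IHy => //; exact: homog_emb hg.
by rewrite -rmorphB; apply/(vge_emb vLf).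
Qed.

(** * Roots of polynomials with finitely generated supports *)

Local Notation W := (fg_supported vL H).

Lemma fg_supported_mulrn x n : W x -> W (x *+ n).
Proof.
move=> hx; elim: n => [|n IH]; first exact: fg_supported0 gH.
by rewrite mulrS; exact: fg_supported_add.
Qed.

Lemma fg_supported_emb a : fg_supported vK G a -> W (f a).
Proof.
case=> s s0 hs; exists s => // l; have [y hy vy] := hs l; exists (f y).
  elim: hy => [|i g w Si hg _ IH]; first by rewrite rmorph0; exact: homog_sum0.
  by rewrite rmorphD; apply: homog_sum_cons Si _ IH; exact: homog_emb hg.
by rewrite -rmorphB; apply/(vge_emb vLf).
Qed.

Lemma homog_large (l : R) : exists e g, [/\ l < e, 0 < e, G e g & g != 0].
Proof.
have [e [g [e0 hg g0]]] := nontrivial.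
have [N [N0 lN]] := mulrn_above l e0.
exists (e *+ N), (g ^+ N); split.
- by [].
- by rewrite pmulrn_lgt0.
- exact: (grX gG).
- by rewrite expf_neq0.
Qed.

(** Newton's method. Write x = b + c z with b a finite sum of homogeneous
    elements very close to x and c homogeneous of degree larger than the value
    dl of P' at x. Divided by h c, with h the leading form of P'(b), the Taylor
    expansion of P at b becomes an equation z = A(z) whose coefficients have
    positive value; only homogeneous elements are inverted, so the supports stay
    finitely generated and [fg_supported_fixpoint] applies. *)
Lemma fg_supported_simple_root (P : {poly L}) x : (forall i, W P`_i) -> vge vL 0 x ->
  root P x -> P^`().[x] != 0 -> W x.
Proof.
move=> PW x0 Px P'x.
have [dl hdl] := val_real vL P'x.
have [lm [g [dlm lm0 hg g0]]] := homog_large dl.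
pose c := f g; have hc : H lm c by exact: homog_emb hg.
have c0 : c != 0 by rewrite fmorph_eq0.
have vc := gr_val gH hc c0.
have [b0 hb0 xb0] := homog_dense x (lm + 1).
pose b := b0; pose et := x - b.
have het : vgt vL lm et by apply: vge_gt xb0; lra.
have b_ge0 : vge vL 0 b.
  rewrite -(subrK x b); apply: vgeD => //; apply: vgeBC; apply: vge_trans (vgt_ge het).
  exact: ltW.
have bW : W b.
  by apply: (fg_supported_homog_sum gH _ (homog_sum_from gH hb0 b_ge0)) => i [].
pose r k := P^`N(k).[b].
have rW k : W (r k).
  apply: (fg_supported_horner gH) bW => i; rewrite coef_nderivn; exact: fg_supported_mulrn.
have sP : (1 < size P)%N.
  apply: contraNT P'x; rewrite -leqNgt => /size1_polyC ->.
  by rewrite derivC horner0.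
have taylor : \sum_(k < size P) r k * et ^+ k = 0.
  rewrite -nderiv_taylor; last exact: mulrC.
  by rewrite /et subrKC; apply/eqP.
have r1 : r 1%N = P^`().[b] by rewrite /r poly.nderivn1.
have vr1 : vL (r 1%N) = dl%:E.
  rewrite r1; apply: val_near hdl _; apply: (@vge_gt _ _ _ _ (0 + lm)); first by rewrite add0r.
  apply: (horner_contract (v := vL)) => //; last exact: vgt_ge.
  move=> i; rewrite coef_deriv; apply: (fg_supported_vge0 gH); exact: fg_supported_mulrn.
have [s _ hs] := rW 1%N.
have [h hh [h0 r1h]] := homog_closure_leading gH hs vr1.
have hhc := grM gH hh hc; have hc0 := mulf_neq0 h0 c0.
pose z := et / c.
have z0 : vge vL 0 z by apply/vgt_ge; rewrite -(subrr lm); exact: vgt_div.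
(* The Taylor equation reads h c z = - sum_k q k z^k, once the leading part h c z
   of its linear term is isolated. *)
pose q k := r k * c ^+ k - (if k == 1%N then h * c else 0).
have qW k : W (q k).
  apply: fg_supported_add.
    apply: (fg_supported_mul gH (rW k)); apply: (fg_supported_exp gH).
    exact: (fg_supported_homog _ (ltW lm0) hc).
  apply: (fg_supported_opp gH); case: (k == 1%N); last exact: fg_supported0 gH.
  apply: (fg_supported_homog _ _ hhc); apply: addr_ge0; last exact: ltW.
  exact: val_vge_le vr1 (fg_supported_vge0 gH (rW 1%N)).
have tail (y : L) k : vge vL lm y -> vgt vL (dl + lm) (r k.+2 * y ^+ k.+2).
  move=> hy; rewrite exprS exprS; apply: (@vge_gt _ _ _ _ (0 + (lm + (lm + 0)))); first lra.
  apply: vgeM; first exact: (fg_supported_vge0 gH).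
  do 2 (apply: vgeM => //); apply: vgeX; apply: vge_trans hy; exact: ltW.
have qv k : vgt vL (dl + lm) (q k).
  case: k => [|[|k]]; rewrite /q /= ?subr0.
  - have -> : r 0%N * c ^+ 0 = - \sum_(k < (size P).-1) r k.+1 * et ^+ k.+1.
      move: taylor; rewrite -(prednK (ltnW sP)) big_ord_recl !expr0 => /eqP.
      by rewrite addr_eq0 => /eqP ->.
    apply/vgtN; apply: vgt_sum => -[[|k] kP] _ /=; last exact/tail/vgt_ge.
    by rewrite addrC mulrC; apply: vgtM => //; exact: val_vge.
  - by rewrite expr1 -mulrBl; apply: vgtM => //; exact: val_vge.
  - exact/tail/val_vge.
pose A := \poly_(k < size P) - (q k / (h * c)).
have AE k : A`_k = if (k < size P)%N then - (q k / (h * c)) else 0 by rewrite coef_poly.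
suff zW : W z.
  have -> : x = b + c * z by rewrite mulrC divfK // subrKC.
  apply: fg_supported_add => //; apply: (fg_supported_mul gH) => //.
  exact: (fg_supported_homog _ (ltW lm0) hc).
apply: (fg_supported_fixpoint gH (p := A)) => //.
- move=> k; rewrite AE; case: ifP => _; last exact: fg_supported0 gH.
  by apply: (fg_supported_opp gH); apply: (fg_supported_shift gH hhc hc0).
- move=> k; rewrite AE; case: ifP => _; last exact: vgt0r.
  apply/vgtN; rewrite -(subrr (dl + lm)); apply: vgt_div => //.
  exact: (gr_val gH hhc hc0).
rewrite horner_poly.
have -> : \sum_(k < size P) - (q k / (h * c)) * z ^+ k =
    - (\sum_(k < size P) (r k * et ^+ k - (if k == 1%N :> nat then h * et else 0))) / (h * c).
  rewrite mulNr mulr_suml -sumrN; apply: eq_bigr => k _; rewrite mulNr mulrAC; congr (- (_ / _)).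
  rewrite /q mulrBl; congr (_ - _); first by rewrite -mulrA -exprMn [c * _]mulrC divfK.
  by case: eqP => [->|_]; rewrite ?mul0r // expr1 -mulrA [c * _]mulrC divfK.
rewrite sumrB taylor sub0r opprK (bigD1 (Ordinal sP)) //= big1 ?addr0 => [|k].
  by rewrite -mulf_div divff // mul1r.
by rewrite -val_eqE /= => /negPf ->.
Qed.

(** In characteristic zero, x is a simple root of a polynomial of least degree
    among those with coefficients in W that vanish at x. *)
Theorem fg_supported_integrally_closed (P : {poly L}) x : P != 0 -> (forall i, W P`_i) ->
  root P x -> vge vL 0 x -> W x.
Proof.
move=> P0 PW Px x0.
pose B m := `[< exists Q : {poly L}, [/\ Q != 0, forall i, W Q`_i, root Q x & size Q = m] >].
have /ex_minnP[m /asboolP[Q [Q0 QW Qx Qm]] mmin] : exists m, B m.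
  by exists (size P); apply/asboolP; exists P.
have sQ : (1 < size Q)%N by exact: root_size_gt1 Q0 Qx.
apply: (fg_supported_simple_root QW x0 Qx); apply/negP => Q'x.
have : B (size Q^`()).
  apply/asboolP; exists Q^`(); split=> //.
    apply/eqP => /(congr1 (fun p : {poly L} => p`_(size Q).-2)).
    rewrite coef_deriv coef0 -mulr_natr => /eqP.
    rewrite (negPf (mulf_neq0 _ (val_real_neq0 (natr_val _)))) //.
    by rewrite prednK ?lead_coef_eq0 // -subn1 subn_gt0.
  by move=> i; rewrite coef_deriv; exact: fg_supported_mulrn.
by move/mmin; rewrite leqNgt -Qm lt_size_deriv.
Qed.

(** * Coordinates over the base field *)

(** A representation with the least number of terms is independent, as a
    relation would eliminate one of its terms. *)
Lemma homog_span_independent x : exists m (a : 'I_m -> K) (b : 'I_m -> L) (d : 'I_m -> R),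
  [/\ forall i, H (d i) (b i), independent f b & x = \sum_i f (a i) * b i].
Proof.
pose B m := `[< exists (a : 'I_m -> K) (b : 'I_m -> L) (d : 'I_m -> R),
  (forall i, H (d i) (b i)) /\ x = \sum_i f (a i) * b i >].
have /ex_minnP[m /asboolP[a [b [d [hb xE]]]] mmin] : exists m, B m.
  rewrite /B; elim: (homog_span_full x) => [|a d b z hb _ [m /asboolP[a' [b' [d' [hb' ->]]]]]].
    exists 0%N; apply/asboolP; exists (fun=> 0), (fun=> 0), (fun=> 0).
    by split=> [[]|]; rewrite ?big_ord0.
  exists m.+1; apply/asboolP.
  exists (fun i => oapp a' a (unlift ord0 i)), (fun i => oapp b' b (unlift ord0 i)),
    (fun i => oapp d' d (unlift ord0 i)); split.
    by move=> i; case: (unlift ord0 i) => [j|] /=; [exact: hb' | exact: hb].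
  rewrite big_ord_recl unlift_none; congr (_ + _).
  by apply: eq_bigr => i _; rewrite liftK.
exists m, a, b, d; split=> // c c0 i0.
apply/eqP/negPn/negP => ci0.
case: m a b d hb xE mmin c c0 i0 ci0 => [|m] a b d hb xE mmin c c0 i0 ci0.
  by case: i0 {ci0}.
have : B m.
  apply/asboolP; exists (fun i => a (lift i0 i) - a i0 * c (lift i0 i) / c i0).
  exists (b \o lift i0), (d \o lift i0); split=> [i|]; first exact: hb.
  have bE : b i0 = - \sum_i f (c (lift i0 i) / c i0) * b (lift i0 i).
    apply: (mulfI (_ : f (c i0) != 0)); first by rewrite fmorph_eq0.
    apply/eqP; rewrite mulrN -addr_eq0 -[X in _ == X]c0 [X in _ == X](bigD1_ord i0) //=.
    rewrite mulr_sumr; apply/eqP; congr (_ + _); apply: eq_bigr => i _.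
    by rewrite mulrA -rmorphM [c i0 * _]mulrC divfK.
  rewrite xE (bigD1_ord i0) //= bE mulrN mulr_sumr addrC -sumrB.
  apply: eq_bigr => i _; rewrite rmorphB mulrBl; congr (_ - _).
  by rewrite mulrA -rmorphM mulrA.
by move/mmin; rewrite ltnn.
Qed.

Section Coordinates.
Variables (m : nat) (b : 'I_m -> L) (d : 'I_m -> R).
Hypothesis hb : forall i, H (d i) (b i).
Hypothesis ib : independent f b.
Implicit Type a : 'I_m -> K.

Lemma independent_neq0 i : b i != 0.
Proof.
apply/eqP => bi; have := ib (c := fun j => if j == i then 1 else 0).
have -> : \sum_j f (if j == i then 1 else 0) * b j = 0.
  rewrite big1 // => j _; case: eqP => [->|_]; first by rewrite bi mulr0.
  by apply/eqP; rewrite mulf_eq0 fmorph_eq0 eqxx.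
by move=> /(_ erefl i); rewrite eqxx => /eqP; rewrite oner_eq0.
Qed.

Lemma vge_coord l a i : vge vL l (f (a i) * b i) <-> vge vK (l - d i) (a i).
Proof.
have vb := gr_val gH (hb i) (independent_neq0 i).
split=> h; last first.
  by rewrite -(subrK (d i) l); apply: vgeM; [exact/(vge_emb vLf) | exact: val_vge].
apply/(vge_emb vLf); rewrite -[f _](mulfK (independent_neq0 i)).
exact: vge_div.
Qed.

Lemma leading_coords mu a : (forall i, vge vK (mu - d i) (a i)) ->
  exists g, [/\ forall i, G (mu - d i) (g i), forall i, vgt vK (mu - d i) (a i - g i),
    H mu (\sum_i f (g i) * b i) & vgt vL mu (\sum_i f (a i) * b i - \sum_i f (g i) * b i)].
Proof.
move=> ha.
have lead i : exists g, G (mu - d i) g /\ vgt vK (mu - d i) (a i - g).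
  by have [g ? ?] := leading_form gG dense (ha i); exists g.
have [g hg] : exists g, forall i, G (mu - d i) (g i) /\ vgt vK (mu - d i) (a i - g i).
  by exists (fun i => projT1 (cid (lead i))) => i; case: cid.
exists g; split; [by move=> i; have [] := hg i | by move=> i; have [] := hg i | |].
- apply: (gr_bigsum gH) => i _; rewrite -(subrK (d i) mu); apply: (grM gH) => //.
  by apply: homog_emb; have [] := hg i.
- rewrite -sumrB; apply: vgt_sum => i _; rewrite -mulrBl -rmorphB -(subrK (d i) mu).
  apply: vgtM; last exact: (gr_vge gH).
  by apply/(vgt_emb vLf); have [] := hg i.
Qed.

(** The value of a combination is the least value of its terms. The leading
    forms of the terms of least value add up to a homogeneous element; if these
    terms cancelled, it would vanish, a linear relation over K. *)
Lemma coords_orthogonal l a : vge vL l (\sum_i f (a i) * b i) ->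
  forall i, vge vK (l - d i) (a i).
Proof.
move=> hl i; have [ai|ai] := eqVneq (a i) 0; first by rewrite ai; exact: vge0r.
have [|mu [[j _ hj] hmu]] :=
    @val_min_exists _ _ vL _ (index_enum _) (fun i => f (a i) * b i) i (mem_index_enum _).
  by rewrite mulf_neq0 ?fmorph_eq0 ?independent_neq0.
have [lmu|mul] := leP l mu.
  by apply/vge_coord; apply: vge_trans lmu _; apply: hmu; exact: mem_index_enum.
have [|g [hg ag Hg vg]] := @leading_coords mu a.
  by move=> k; apply/vge_coord; apply: hmu; exact: mem_index_enum.
have g0 : \sum_i f (g i) * b i = 0.
  apply: (gr_vgt_eq0 gH Hg); rewrite -[X in vgt _ _ X](subKr (\sum_i f (a i) * b i)).
  by apply: vgtB => //; exact: vge_gt hl.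
have := ag j; rewrite (ib g0) subr0 => /(vgt_emb vLf) haj.
have : vgt vL (mu - d j + d j) (f (a j) * b j).
  by apply: vgtM => //; exact: (gr_vge gH).
by rewrite subrK => /(val_nvgt hj).
Qed.

(** Peel off the terms of y in increasing degree: as long as the degree is below
    the precision l, the next term is the leading form of the remaining
    combination, and by orthogonality it is obtained from leading forms of the
    coordinates. *)
Lemma coords_approx (S : set R) l a y : homog_sum H S y ->
  vge vL l (\sum_i f (a i) * b i - y) ->
  exists c : 'I_m -> K, forall i,
    homog_sum G [set e | S (e + d i)] (c i) /\ vge vK (l - d i) (a i - c i).
Proof.
move=> /(homog_sum_normal_form gH)[w [r [wH wS _ ur ->]]].
rewrite -(perm_big _ (permEl (perm_sort <=%R r))) /=.
have : sorted <%R (sort <=%R r).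
  by rewrite lt_sorted_uniq_le sort_uniq ur /= sort_sorted //; exact: le_total.
elim: (sort _ _) a => [|j t IH] a /=.
  rewrite big_nil subr0 => _ h; exists (fun=> 0) => i; split; first exact: homog_sum0.
  by rewrite subr0; exact: coords_orthogonal.
move=> jt; rewrite big_cons => h.
move: (jt); rewrite (path_sortedE lt_trans) => /andP[/allP jlt st].
have [wj|wj] := eqVneq (w j) 0; first by apply: IH => //; move: h; rewrite wj add0r.
have vt : vgt vL j (\sum_(k <- t) w k).
  rewrite big_seq; apply: vgt_sum => k kt; apply: vge_gt (gr_vge gH (wH k)).
  exact: jlt.
have [lj|jl] := leP l j.
  exists (fun=> 0) => i; split; first exact: homog_sum0.
  rewrite subr0; apply: coords_orthogonal.
  rewrite -(subrK (w j + \sum_(k <- t) w k) (\sum_i f (a i) * b i)).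
  apply: (vgeD h); apply: vgeD; first exact: vge_trans lj (gr_vge gH (wH j)).
  by apply: vge_trans lj _; exact: vgt_ge.
have xj : vgt vL j (\sum_i f (a i) * b i - w j).
  rewrite -[X in vgt _ _ X](subrK (\sum_(k <- t) w k)) -[X in X + _]addrA -opprD.
  by apply: vgtD => //; exact: vge_gt h.
have [|g [hg ag Hg vg]] := @leading_coords j a.
  move=> i; apply: coords_orthogonal.
  rewrite -(subrK (w j) (\sum_i f (a i) * b i)); apply: vgeD; first exact: vgt_ge.
  exact: (gr_vge gH).
have wE : w j = \sum_i f (g i) * b i.
  by apply: (gr_leading_unique gH (wH j) Hg); apply: vgt_dist vg; exact: vgtBC.
have [|c hc] := IH (fun i => a i - g i) st.
  under eq_bigr do rewrite rmorphB mulrBl.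
  by rewrite sumrB -wE -addrA -opprD.
exists (fun i => g i + c i) => i; have [c1 c2] := hc i; split; last by rewrite opprD addrA.
by apply: homog_sum_cons (hg i) c1 => /=; rewrite subrK; exact: wS.
Qed.

End Coordinates.

(** The coordinates of x in an independent homogeneous family have supports in
    translates of the semigroup of x; multiplying by a homogeneous element of
    large degree, kept as a denominator, brings them back into a finitely
    generated semigroup of nonnegative reals. *)
Theorem fg_supported_coords x : W x ->
  exists m (a c : 'I_m -> K) (b : 'I_m -> L) (d : 'I_m -> R),
  [/\ forall i, H (d i) (b i) /\ 0 <= d i, forall i, fg_supported vK G (a i),
    forall i, fg_supported vK G (c i) /\ c i != 0 & x = \sum_i f (a i / c i) * b i].
Proof.
case=> s s0 hs; have [m [a [b [d [hb ib xE]]]]] := homog_span_independent x.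
have ha i : homog_closure vK G [set e | sgen s (e + d i)] (a i).
  move=> l; have [y hy vy] := hs (l + d i).
  rewrite xE in vy; have [c /(_ i)[c1 c2]] := coords_approx hb ib hy vy.
  by exists (c i); rewrite // -(addrK (d i) l).
have big i : exists eg : R * K, [/\ d i < eg.1, - d i < eg.1, 0 < eg.1, G eg.1 eg.2 & eg.2 != 0].
  have [e [g [h1 h2 h3 h4]]] := homog_large (Num.max (d i) (- d i)).
  by exists (e, g); move: h1; rewrite gt_max => /andP[].
pose e i := (projT1 (cid (big i))).1; pose g i := (projT1 (cid (big i))).2.
have hg i : [/\ d i < e i, - d i < e i, 0 < e i, G (e i) (g i) & g i != 0].
  by rewrite /e /g; case: cid.
exists m, (fun i => g i * a i), (fun i => g i * g i), (fun i => f (g i) * b i), (fun i => e i + d i).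
split.
- move=> i; have [h1 h2 h3 h4 h5] := hg i; split; last lra.
  by apply: (grM gH) => //; exact: homog_emb.
- move=> i; have [h1 h2 h3 h4 h5] := hg i; exists (e i - d i :: s).
    by move=> u; rewrite inE => /predU1P[->|/s0 //]; lra.
  apply: (homog_closure_scale gG _ h4 (ha i)) => u /= hu.
  have -> : e i + u = (e i - d i) + (u + d i) by ring.
  apply: sgenD; first exact: mem_head.
  by apply: sgen_sub hu => v vs; rewrite inE vs orbT.
- move=> i; have [h1 h2 h3 h4 h5] := hg i; split; last by rewrite mulf_neq0.
  by apply: (fg_supported_mul gG); exact: (fg_supported_homog _ (ltW h3) h4).
rewrite xE; apply: eq_bigr => i _; have [_ _ _ _ g0] := hg i.
by rewrite mulrA -rmorphM; congr (f _ * _); field.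
Qed.

Theorem full_coords x :
  exists m (a : 'I_m -> K) (b : 'I_m -> L) (d : 'I_m -> R),
  (forall i, H (d i) (b i) /\ 0 <= d i) /\ x = \sum_i f (a i) * b i.
Proof.
have [m [a [b [d [hb _ xE]]]]] := homog_span_independent x.
have big i : exists eg : R * K, [/\ - d i < eg.1, G eg.1 eg.2 & eg.2 != 0].
  by have [e [g [h1 h2 h3 h4]]] := homog_large (- d i); exists (e, g).
pose e i := (projT1 (cid (big i))).1; pose g i := (projT1 (cid (big i))).2.
have hg i : [/\ - d i < e i, G (e i) (g i) & g i != 0] by rewrite /e /g; case: cid.
exists m, (fun i => a i / g i), (fun i => f (g i) * b i), (fun i => e i + d i); split.
  move=> i; have [h1 h2 h3] := hg i; split; last lra.
  by apply: (grM gH) => //; exact: homog_emb.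
rewrite xE; apply: eq_bigr => i _; have [_ _ g0] := hg i.
by rewrite mulrA -rmorphM divfK.
Qed.

End AlgebraicClosure.

(** * Density of homogeneous sums in a completed fraction field *)

Section InverseClosure.
Variables (R : realType) (K : fieldType) (v : valuation R K) (X : R -> set K).
Hypothesis gX : graded_pieces v X.

(** With h the leading form of x, write x = h (1 - u) where u has positive value,
    and expand 1 / (1 - u) as a geometric series. *)
Lemma homog_closure_inv x : homog_closure v X setT x -> homog_closure v X setT x^-1.
Proof.
have [->|x0] := eqVneq x 0; first by rewrite invr0.
move=> hx; have [d xd] := val_real v x0.
have [h hh [h0 xh]] := homog_closure_leading gX hx xd.
have vh := gr_val gX hh h0.
pose u := 1 - x / h.
have hu : homog_closure v X setT u.
  apply: homog_closure_add; first by apply: homog_sum_closure; exact: homog_sum_homog (gr1 gX).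
  apply: (homog_closure_opp gX); rewrite mulrC.
  by apply: (homog_closure_scale gX (S := setT) _ (grV gX hh)).
have u0 : vgt v 0 u.
  have -> : u = (h - x) / h by rewrite /u mulrBl divff.
  by rewrite -(subrr d); apply: vgt_div vh _; exact: vgtBC.
have [e e0 ue] : exists2 e, 0 < e & vge v e u.
  have [->|u1] := eqVneq u 0; first by exists 1 => //; exact: vge0r.
  have [e he] := val_real v u1; exists e; last exact: val_vge.
  exact: val_vgt_lt he u0.
have v1u : v (1 - u) = 0%:E by rewrite /u subKr -(subrr d); exact: valM_real xd (valV_real vh).
have -> : x^-1 = h^-1 * (1 - u)^-1 by rewrite /u subKr invf_div mulrA mulVf // mul1r.
apply: (homog_closure_scale gX (S := setT) _ (grV gX hh)) => //.
apply: homog_closure_closed => l; have [N [_ lN]] := mulrn_above l e0.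
exists (\sum_(i < N) u ^+ i).
  elim/big_ind: _ => [||i _]; first by apply: homog_sum_closure; exact: homog_sum0.
    by move=> ? ? ? ?; exact: homog_closure_add.
  elim: (nat_of_ord i) => [|n IH]; first by apply: homog_sum_closure; exact: homog_sum_homog (gr1 gX).
  by rewrite exprS; apply: (homog_closure_mul gX).
have -> : (1 - u)^-1 - \sum_(i < N) u ^+ i = u ^+ N / (1 - u).
  apply: (mulIf (val_real_neq0 v1u)); rewrite mulrBl mulVf ?(val_real_neq0 v1u) //.
  rewrite divfK ?(val_real_neq0 v1u) //.
  have -> : (\sum_(i < N) u ^+ i) * (1 - u) = 1 - u ^+ N.
    by rewrite mulrC -(opprB u 1) mulNr -subrX1 opprB.
  by rewrite subKr.
rewrite -(subr0 l); apply: vgt_ge; apply: vgt_div v1u _.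
exact: vge_gt lN (vgeXn N ue).
Qed.

End InverseClosure.

Section MonomialValuation.
Variables (R : realType) (r : nat) (F : fieldType) (al : 'I_r -> R).

Lemma weight0 : weight al 0%MM = 0.
Proof. by rewrite /weight big1 // => i _; rewrite mnm0E. Qed.

Lemma weightD m m' : weight al (m + m')%MM = weight al m + weight al m'.
Proof. by rewrite /weight -big_split; apply: eq_bigr => i _; rewrite mnmDE mulrnDr. Qed.

Lemma monomial_val_const (phi : powser r F) m e : pscoef phi m != 0 ->
  (forall m, pscoef phi m != 0 -> weight al m = e) -> monomial_val al phi = e%:E.
Proof.
move=> hm he; rewrite /monomial_val (_ : [set _ | _ in _] = [set e%:E]) ?ereal_inf1 //.
apply/seteqP; split=> [_ [m' hm' <-]|_ ->] /=; first by rewrite he.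
by exists m => //; rewrite he.
Qed.

Lemma monomial_val_monomial (c : F) m : c != 0 ->
  monomial_val al (ps_of_mpoly (c *: 'X_[m])) = (weight al m)%:E.
Proof.
move=> c0; apply: (@monomial_val_const _ m) => [|m'] /=; rewrite mcoeffZ mcoeffX.
  by rewrite eqxx mulr1.
have [->//|_] := eqVneq m m'.
by rewrite mulr0 eqxx.
Qed.

Hypothesis al0 : forall j, 0 < al j.

Lemma weight_ge : exists2 e, 0 < e & forall m, e *+ mdeg m <= weight al m.
Proof.
have [e e0 he] : exists2 e, 0 < e & forall j, e <= al j.
  suff [e e0 he] : exists2 e, 0 < e & forall j, j \in enum 'I_r -> e <= al j.
    by exists e => // j; apply: he; rewrite mem_enum.
  elim: (enum _) => [|j s [e e0 IH]]; first by exists 1.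
  exists (Num.min e (al j)) => [|i]; first by rewrite lt_min e0 al0.
  by rewrite inE => /predU1P[->|/IH h]; rewrite ge_min ?lexx ?orbT // h.
exists e => // m; rewrite mdegE -mulr_natl natr_sum mulr_suml.
by apply: ler_sum => i _; rewrite mulr_natl lerMn2r he orbT.
Qed.

Variables (K : fieldType) (v : valuation R K) (X : R -> set K).
Hypothesis gX : graded_pieces v X.
Variable J : {rmorphism powser r F -> K}.
Hypothesis vJ : forall phi, v (J phi) = monomial_val al phi.
Hypothesis JX : forall c m, X (weight al m) (J (ps_of_mpoly (c *: 'X_[m]))).

(** A power series is the limit of its truncations: all weights are positive, so
    the remainder beyond total degree N has value at least N times the least
    weight. *)
Lemma homog_closure_powser phi : homog_closure v X setT (J phi).
Proof.
move=> l; have [e e0 he] := weight_ge.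
have [N [_ lN]] := mulrn_above l e0.
exists (J (ps_of_mpoly (ps_trunc N phi))).
  rewrite /ps_trunc !rmorph_sum; apply: homog_sum_bigsum => m _.
  exact: homog_sum_homog (JX _ _).
rewrite -rmorphB /vge vJ; apply: le_ereal_inf_tmp => _ [m /= hm <-].
rewrite lee_fin; apply: le_trans (he m).
have Nm : (N <= mdeg m)%N.
  rewrite leqNgt; apply: contraNN hm => mN.
  by change (pscoef phi m - (ps_trunc N phi)@_m == 0); rewrite ps_truncE mN subrr.
exact: le_trans (ltW lN) (ler_wpMn2l (ltW e0) Nm).
Qed.

End MonomialValuation.

Lemma div_perturb (K : fieldType) (a a' b b' : K) : b != 0 -> b' != 0 ->
  a / b - a' / b' = ((a - a') - (b - b') * (a / b)) / b'.
Proof. by move=> b0 b'0; field; rewrite b0 b'0. Qed.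

Section Completion.
Variables (R : realType) (D Vh : idomainType) (w : valuation R D).
Hypothesis w_ge0 : forall a, (0 <= w a)%E.
Local Notation V := (valring (val_frac w)).
Variables (vh : valuation R Vh) (iota : {rmorphism V -> Vh}).
Hypothesis compl : is_completion (fun x : V => val_frac w (valring_val x)) vh iota.
Local Notation Kh := {fraction Vh}.
Local Notation v := (vhK vh).

Lemma dring_subproof a : tofrac a \in valring_pred (val_frac w).
Proof. by rewrite valring_predE val_frac_tofrac. Qed.
Definition dring a : V := ValRing (dring_subproof a).

Lemma dring_is_zmod_morphism : zmod_morphism dring.
Proof. by move=> a b; apply: val_inj; rewrite /= rmorphB. Qed.
Lemma dring_is_monoid_morphism : monoid_morphism dring.
Proof. by split=> [|a b]; apply: val_inj; rewrite /= ?rmorph1 ?rmorphM. Qed.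
HB.instance Definition _ := GRing.isZmodMorphism.Build D V dring dring_is_zmod_morphism.
HB.instance Definition _ := GRing.isMonoidMorphism.Build D V dring dring_is_monoid_morphism.

(** The map from D to the fraction field of the completion of the valuation
    ring of Frac D. *)
Definition compl_emb : {rmorphism D -> Kh} := @tofrac Vh \o (iota \o dring).

Lemma tofrac_val (x : Vh) : v (tofrac x) = vh x. Proof. exact: val_frac_tofrac. Qed.

Lemma iota_val (x : V) : v (tofrac (iota x)) = val_frac w (valring_val x).
Proof. by rewrite tofrac_val; case: compl. Qed.

Lemma compl_emb_val a : v (compl_emb a) = w a.
Proof. by rewrite [LHS]iota_val val_frac_tofrac. Qed.

Lemma compl_emb_eq0 a : (compl_emb a == 0) = (a == 0).
Proof.
apply/eqP/eqP => [a0|->]; last exact: rmorph0.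
apply/(val_eqy (val_funP w)); rewrite -compl_emb_val a0; exact: val0.
Qed.

Lemma iota_frac (x : V) : exists a b, b != 0 /\
  tofrac (iota x) = compl_emb a / compl_emb b.
Proof.
exists (\n_(repr (valring_val x))), (\d_(repr (valring_val x))).
have d0 := denom_ratioP (repr (valring_val x)); split=> //.
apply: (canRL (mulfK _)); first by rewrite compl_emb_eq0.
rewrite /compl_emb /= -!rmorphM; congr (tofrac (iota _)); apply: val_inj => /=.
by rewrite {1}(frac_numden (valring_val x)) divfK // tofrac_eq0.
Qed.

Lemma approx (x : Vh) l : exists a, vge v l (tofrac x - tofrac (iota a)).
Proof.
by have [_ h _] := compl; have [a ha] := h x l; exists a; rewrite -rmorphB /vge tofrac_val.
Qed.

Lemma tofrac_vge0 (x : Vh) : vge v 0 (tofrac x).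
Proof.
have [a ha] := approx x 0; rewrite -(subrK (tofrac (iota a)) (tofrac x)).
apply: vgeD => //; rewrite /vge iota_val; exact: (valP a).
Qed.

Lemma frac_Vh (x : Kh) : exists a b : Vh, b != 0 /\ x = tofrac a / tofrac b.
Proof.
by exists \n_(repr x), \d_(repr x); split; [exact: denom_ratioP | exact: frac_numden].
Qed.

Lemma approx_frac (x : Kh) l : vge v 0 x -> exists a, vge v l (x - tofrac (iota a)).
Proof.
move=> x0; have [a [b [b0 xE]]] := frac_Vh x.
have tb0 : tofrac b != 0 by rewrite tofrac_eq0.
have [be hb] := val_real v tb0.
have be0 := val_vge_le hb (tofrac_vge0 b).
pose l0 := Num.max 0 l; have l00 : 0 <= l0 by rewrite le_max lexx.
(* the precision must absorb the value be of the denominator *)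
pose N := l0 + be + 1.
have [a' ha] := approx a N; have [b' hb'] := approx b N.
have vb' : v (tofrac (iota b')) = be%:E.
  by apply: val_near hb _; apply: vge_gt hb'; rewrite /N; lra.
have b'0 := val_real_neq0 vb'.
pose y := tofrac (iota a') / tofrac (iota b') : Kh.
have xy : vge v l0 (x - y).
  have -> : x - y = ((tofrac a - tofrac (iota a')) - (tofrac b - tofrac (iota b')) * x) / tofrac (iota b').
    by rewrite xE; exact: div_perturb.
  apply: (@vge_trans _ _ _ _ (N - be)); first by rewrite /N; lra.
  apply: vge_div vb' _; apply: vgeB => //.
  by rewrite -[N]addr0; exact: vgeM.
have y0 : vge v 0 y.
  rewrite -(subKr x y); apply: vgeB => //; exact: vge_trans xy.
have vb'0 : valring_val b' != 0.
  by apply: contraNneq b'0 => e; rewrite (_ : b' = 0) ?rmorph0 //; exact: val_inj.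
have hu : valring_val a' / valring_val b' \in valring_pred (val_frac w).
  move: y0; rewrite /vge valring_predE /y !val_mul !valV // !iota_val.
  by [].
pose u : V := ValRing hu.
exists u; suff -> : tofrac (iota u) = y by apply: vge_trans xy; rewrite le_max lexx orbT.
apply: (canRL (mulfK b'0)); rewrite -!rmorphM; congr (tofrac (iota _)).
by apply: val_inj; rewrite /= divfK.
Qed.

Lemma Vh_complete : forall u : nat -> Vh,
  (forall l : R, exists N, forall p q, (N <= p)%N -> (N <= q)%N ->
     vge v l (tofrac (u p) - tofrac (u q))) ->
  exists x, forall l : R, exists N, forall p, (N <= p)%N -> vge v l (tofrac x - tofrac (u p)).
Proof.
move=> u hu; have [_ _ hc] := compl.
have [l|x hx] := hc u.
  have [N hN] := hu l; exists N => p q Np Nq.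
  by have := hN p q Np Nq; rewrite -rmorphB /vge tofrac_val.
by exists x => l; have [N hN] := hx l; exists N => p Np; rewrite -rmorphB /vge tofrac_val hN.
Qed.

(** The completed ring is the whole valuation ring of its fraction field: an
    integral quotient is a limit of quotients of elements of D, which lie in the
    valuation ring of Frac D. *)
Lemma valring_Vh (x : Kh) : vge v 0 x -> exists a, x = tofrac a.
Proof.
move=> x0; pose u n := iota (projT1 (cid (approx_frac n%:R x0))).
have hu n : vge v n%:R (x - tofrac (u n)) by rewrite /u; case: cid.
have [l|y hy] := @Vh_complete u.
  have [N hN] := nat_above l; exists N => p q Np Nq.
  apply: (@vge_dist _ _ _ _ x); first by apply: vgeBC; exact: vge_trans (hN _ Np) (hu p).
  exact: vge_trans (hN _ Nq) (hu q).
exists y; apply/eqP; rewrite -subr_eq0; apply/eqP; apply: (@vge_eq0 _ _ v) => l.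
have [N hN] := nat_above l; have [M hM] := hy l; pose p := maxn N M.
apply: (@vge_dist _ _ _ _ (tofrac (u p))).
  by apply: vge_trans (hu p); apply: hN; rewrite leq_maxl.
by apply: vgeBC; apply: hM; rewrite leq_maxr.
Qed.

Lemma Kh_complete : val_complete v.
Proof.
move=> u hu; have [N0 hN0] := hu 0.
have lift p : exists a, u (N0 + p)%N - u N0 = tofrac a.
  by apply: valring_Vh; apply: hN0 => //; rewrite leq_addr.
pose a p := projT1 (cid (lift p)).
have ha p : u (N0 + p)%N - u N0 = tofrac (a p) by rewrite /a; case: cid.
have [l|x hx] := @Vh_complete a.
  have [N hN] := hu l; exists N => p q Np Nq.
  rewrite -!ha opprB addrA subrK; apply: hN; exact: leq_trans (leq_addl _ _).
exists (u N0 + tofrac x) => l; have [N hN] := hx l; exists (N0 + N)%N => p Np.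
have N0p : (N0 <= p)%N by rewrite (leq_trans _ Np) ?leq_addr.
have -> : u N0 + tofrac x - u p = tofrac x - tofrac (a (p - N0)%N).
  by rewrite -ha subnKC // opprB addrA [tofrac x + _]addrC.
by apply: hN; rewrite leq_subRL.
Qed.

Lemma value_in_group (x : Kh) i : v x = i%:E -> exists y, val_frac w y = i%:E.
Proof.
move=> xi; have [a [b [b0 xE]]] := frac_Vh x.
have key (c : Vh) : c != 0 -> exists y, y != 0 /\ val_frac w y = v (tofrac c).
  move=> c0; have [d hd] : exists d, v (tofrac c) = d%:E by apply: val_real; rewrite tofrac_eq0.
  have [y hy] := approx c (d + 1); exists (valring_val y).
  have vy : v (tofrac (iota y)) = d%:E by apply: val_near hd _; apply: vge_gt hy; lra.
  by move: vy; rewrite iota_val hd => vy; split=> //; exact: val_real_neq0 vy.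
have a0 : a != 0.
  apply: contraNneq (val_real_neq0 xi) => a0; by rewrite xE a0 rmorph0 mul0r.
have [y [y0 hy]] := key a a0; have [z [z0 hz]] := key b b0.
exists (y / z); rewrite -xi xE !val_mul !valV ?tofrac_eq0 // hy hz //.
Qed.

Variable X : R -> set Kh.
Hypothesis gX : graded_pieces v X.

(** The limits of finite homogeneous sums form a closed subfield, by
    [homog_closure_inv]; once it contains D it contains the completion and its
    fraction field. *)
Lemma dense_from : (forall a, homog_closure v X setT (compl_emb a)) -> forall x, homog_closure v X setT x.
Proof.
move=> hD.
have hfrac x y : homog_closure v X setT x -> homog_closure v X setT y -> homog_closure v X setT (x / y).
  by move=> hx hy; apply: (homog_closure_mul gX) => //; exact: homog_closure_inv.
have hV a : homog_closure v X setT (tofrac a).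
  apply: homog_closure_closed => l; have [y hy] := approx a l; exists (tofrac (iota y)) => //.
  by have [n [d [_ ->]]] := iota_frac y; exact: hfrac.
by move=> x; have [a [b [_ ->]]] := frac_Vh x; exact: hfrac.
Qed.

End Completion.

(** * The two families of graded pieces *)

Section Pieces.
Variables (R : realType) (k : fieldType) (n : nat) (nu : ps_valuation R n k).
Variables (Vh : idomainType) (vh : valuation R Vh) (iota : {rmorphism Vnu nu -> Vh}).
Hypothesis Vh_completion : is_completion (fun x => nuK nu (valring_val x)) vh iota.
Local Notation Kh := {fraction Vh}.
Local Notation v := (vhK vh).
Local Notation J := (compl_emb (psval_ge0 nu) iota).

Lemma ps_valringE f : ps_valring nu f = dring (psval_ge0 nu) f.
Proof. exact: val_inj. Qed.

Lemma ps_emb_val f : v (J f) = nu f.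
Proof. exact: (compl_emb_val (psval_ge0 nu) Vh_completion). Qed.

Section Monomial.
Variable alpha : 'I_n -> R.
Hypothesis alpha0 : forall j, 0 < alpha j.
Hypothesis nuE : forall f, nu f = monomial_val alpha f.

Definition mpoly_emb : {rmorphism {mpoly k[n]} -> Kh} := J \o @ps_of_mpoly n k.
Local Notation Q := mpoly_emb.

Lemma mpoly_emb_val a : v (Q a) = nu (ps_of_mpoly a). Proof. exact: ps_emb_val. Qed.

Definition homog_weight (e : R) (a : {mpoly k[n]}) :=
  forall m, m \in msupp a -> weight alpha m = e.

Lemma homog_weight_val e a : a != 0 -> homog_weight e a -> v (Q a) = e%:E.
Proof.
move=> a0 ha; rewrite mpoly_emb_val nuE; apply: (@monomial_val_const _ _ _ _ _ (mlead a)).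
  by rewrite /= mleadc_eq0.
by move=> m /=; rewrite -mcoeff_msupp => /ha.
Qed.

Lemma homog_weightD e a b : homog_weight e a -> homog_weight e b -> homog_weight e (a + b).
Proof. by move=> ha hb m /msuppD_le; rewrite mem_cat => /orP[/ha|/hb]. Qed.

Lemma homog_weightN e a : homog_weight e a -> homog_weight e (- a).
Proof. by move=> ha m; rewrite (perm_mem (msuppN a)) => /ha. Qed.

Lemma homog_weightM e e' a b : homog_weight e a -> homog_weight e' b ->
  homog_weight (e + e') (a * b).
Proof.
move=> ha hb m /msuppM_le /allpairsP[[m1 m2] /= [/ha h1 /hb h2 ->]].
by rewrite weightD h1 h2.
Qed.

Lemma homog_weight1 : homog_weight 0 1.
Proof. by move=> m; rewrite msupp1 inE => /eqP ->; exact: weight0. Qed.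

Lemma homog_weightX (c : k) m : homog_weight (weight alpha m) (c *: 'X_[m]).
Proof.
by move=> m' /msuppZ_le; rewrite msuppX inE => /eqP ->.
Qed.

Lemma monomial_piecesP i h : monomial_pieces iota alpha i h <->
  h = 0 \/ exists a b e e', [/\ a != 0, b != 0, homog_weight e a, homog_weight e' b
    & e - e' = i /\ h = Q a / Q b].
Proof.
split=> [[->|[a [b [a0 b0 [e ha] [e' hb] [hi ->]]]]]|[->|[a [b [e [e' [a0 b0 ha hb [hi ->]]]]]]]];
  [by left| |by left|]; right.
  exists a, b, e, e'; split=> //; rewrite !ps_valringE; split=> //.
  have := homog_weight_val a0 ha; have := homog_weight_val b0 hb.
  by rewrite !mpoly_emb_val => hb' ha'; move: hi; rewrite ha' hb' -EFinB => -[].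
exists a, b; split=> //; [by exists e|by exists e'|].
have := homog_weight_val a0 ha; have := homog_weight_val b0 hb.
rewrite !mpoly_emb_val => -> ->; rewrite -EFinB hi; split=> //.
by rewrite !ps_valringE.
Qed.

Lemma mpoly_emb_neq0 e a : a != 0 -> homog_weight e a -> Q a != 0.
Proof. by move=> a0 ha; exact: val_real_neq0 (homog_weight_val a0 ha). Qed.

Lemma monomial_graded : graded_pieces v (monomial_pieces iota alpha).
Proof.
split.
- by move=> i; left.
- move=> i x y /monomial_piecesP[->|[a [b [e [f [a0 b0 ha hb [ei ->]]]]]]].
    by rewrite add0r.
  move=> /monomial_piecesP[->|[a' [b' [e' [f' [a'0 b'0 ha' hb' [ei' ->]]]]]]].
    by rewrite addr0; apply/monomial_piecesP; right; exists a, b, e, f.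
  apply/monomial_piecesP; have [z|nz] := eqVneq (a * b' + a' * b) 0.
    left; rewrite addf_div ?(mpoly_emb_neq0 _ hb) ?(mpoly_emb_neq0 _ hb') //.
    by rewrite -!rmorphM -rmorphD z rmorph0 mul0r.
  right; exists (a * b' + a' * b), (b * b'), (e + f'), (f + f'); split=> //.
  + by rewrite mulf_neq0.
  + apply: homog_weightD; first exact: homog_weightM.
    have -> : e + f' = e' + f by lra.
    exact: homog_weightM.
  + exact: homog_weightM.
  split; first lra.
  rewrite addf_div ?(mpoly_emb_neq0 _ hb) ?(mpoly_emb_neq0 _ hb') //.
  by rewrite -!rmorphM -rmorphD.
- move=> i x /monomial_piecesP[->|[a [b [e [f [a0 b0 ha hb [ei ->]]]]]]].
    by rewrite oppr0; left.
  apply/monomial_piecesP; right; exists (- a), b, e, f.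
  by rewrite oppr_eq0 rmorphN mulNr; split=> //; exact: homog_weightN.
- apply/monomial_piecesP; right; exists 1, 1, 0, 0.
  by rewrite oner_eq0 subr0 rmorph1 divr1; split=> //; exact: homog_weight1.
- move=> i j x y /monomial_piecesP[->|[a [b [e [f [a0 b0 ha hb [ei ->]]]]]]].
    by rewrite mul0r; left.
  move=> /monomial_piecesP[->|[a' [b' [e' [f' [a'0 b'0 ha' hb' [ei' ->]]]]]]].
    by rewrite mulr0; left.
  apply/monomial_piecesP; right; exists (a * a'), (b * b'), (e + e'), (f + f').
  rewrite !mulf_neq0 // mulf_div -!rmorphM; split=> //; [exact: homog_weightM..|].
  by split=> //; lra.
- move=> i x /monomial_piecesP[->|[a [b [e [f [a0 b0 ha hb [ei ->]]]]]]].
    by rewrite invr0; left.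
  by apply/monomial_piecesP; right; exists b, a, f, e; rewrite invf_div; split=> //; split=> //; lra.
- move=> i x /monomial_piecesP[->|[a [b [e [f [a0 b0 ha hb [ei ->]]]]] _]].
    by rewrite eqxx.
  by rewrite (valM_real (homog_weight_val a0 ha) (valV_real (homog_weight_val b0 hb))) ei.
Qed.

Lemma monomial_dense x : homog_closure v (monomial_pieces iota alpha) setT x.
Proof.
apply: (dense_from (w_ge0 := psval_ge0 nu) Vh_completion monomial_graded) => a.
apply: (homog_closure_powser (al := alpha) alpha0 (J := J)) => [phi|c m]; first by rewrite ps_emb_val nuE.
apply/monomial_piecesP; have [->|c0] := eqVneq c 0.
  by left; rewrite scale0r !rmorph0.
right; exists (c *: 'X_[m]), 1, (weight alpha m), 0.
rewrite scaler_eq0 (negPf c0) -msupp_eq0 msuppX oner_eq0 subr0 rmorph1 divr1.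
split=> //; [exact: homog_weightX|exact: homog_weight1].
Qed.

End Monomial.

Section Model.
Variable M : abhyankar_model vh iota.
Local Notation L := (am_field M).
Local Notation r := (am_dim M).
Local Notation w := (@am_weight _ _ _ _ _ _ _ M).
Local Notation G := (model_pieces M).

Definition series_emb : {rmorphism powser r L -> Kh} := @tofrac Vh \o am_ext M.
Definition const_emb : {rmorphism L -> Kh} :=
  series_emb \o (@ps_of_mpoly r L \o @mpolyC r L).
Local Notation C := const_emb.
Local Notation Z := (fun j => series_emb (ps_of_mpoly 'X_j)).
Local Notation mono b := (\prod_j Z j ^ (b j)).

Lemma series_emb_val phi : v (series_emb phi) = monomial_val w phi.
Proof. by rewrite [LHS]tofrac_val am_ext_monomial. Qed.

Lemma const_emb_val l : l != 0 -> v (C l) = 0%:E.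
Proof.
move=> l0; rewrite [LHS](series_emb_val (ps_of_mpoly l%:MP)).
have -> : l%:MP = l *: 'X_[0%MM] :> {mpoly L[r]} by rewrite mpolyX0 -mul_mpolyC mulr1.
by rewrite monomial_val_monomial // weight0.
Qed.

Lemma par_val j : v (Z j) = (w j)%:E.
Proof.
rewrite series_emb_val -['X_j]scale1r monomial_val_monomial ?oner_neq0 //.
rewrite /weight (bigD1 j) //= big1 ?addr0 => [|i ij]; first by rewrite mnm1E eqxx.
by rewrite mnm1E eq_sym (negPf ij) mulr0n.
Qed.

Lemma par_neq0 j : Z j != 0. Proof. exact: val_real_neq0 (par_val j). Qed.

Lemma valXz x e (z : int) : v x = e%:E -> v (x ^ z) = (e *~ z)%:E.
Proof.
move=> xe; case: z => m; first exact: valX_real.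
by rewrite NegzE -invr_expz mulrNz; apply: valV_real; exact: valX_real.
Qed.

Lemma mono_val (b : 'I_r -> int) : v (mono b) = (\sum_j w j *~ b j)%:E.
Proof.
elim/big_rec2: _ => [|j y x _ IH]; first exact: Defs.val1.
by apply: valM_real => //; apply: valXz; exact: par_val.
Qed.

Lemma monoD (b b' : 'I_r -> int) : mono b * mono b' = mono (fun j => b j + b' j).
Proof. by rewrite -big_split; apply: eq_bigr => j _; rewrite expfzDr // par_neq0. Qed.

Lemma monoV (b : 'I_r -> int) : (mono b)^-1 = mono (fun j => - b j).
Proof. by rewrite -prodfV; apply: eq_bigr => j _; rewrite -invr_expz. Qed.

Lemma model_piecesP i h : G i h <-> h = 0 \/
  exists l b, \sum_j w j *~ b j = i /\ h = C l * mono b.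
Proof. by []. Qed.

(** The weights of the parameters are independent over the integers, so each
    degree belongs to a single Laurent monomial; this makes the pieces stable
    under addition. *)
Lemma weight_inj (b b' : 'I_r -> int) :
  \sum_j w j *~ b j = \sum_j w j *~ b' j -> b = b'.
Proof.
move=> e; apply: funext => j; apply/eqP; rewrite -subr_eq0; apply/eqP.
move: j; apply: (@am_weight_free _ _ _ _ _ _ _ M).
apply/eqP; rewrite (eq_bigr (fun j => w j *~ b j - w j *~ b' j)) => [|j _].
  by rewrite sumrB subr_eq0 e.
by rewrite mulrzBr.
Qed.

Lemma model_graded : graded_pieces v G.
Proof.
split.
- by move=> i; left.
- move=> i x y /model_piecesP[->|[l [b [hb ->]]]]; first by rewrite add0r.
  move=> /model_piecesP[->|[l' [b' [hb' ->]]]].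
    by rewrite addr0; apply/model_piecesP; right; exists l, b.
  apply/model_piecesP; right; exists (l + l'), b; split=> //.
  by rewrite (@weight_inj b' b) ?hb' // rmorphD mulrDl.
- move=> i x /model_piecesP[->|[l [b [hb ->]]]]; first by rewrite oppr0; left.
  by apply/model_piecesP; right; exists (- l), b; rewrite rmorphN mulNr.
- apply/model_piecesP; right; exists 1, (fun=> 0); rewrite rmorph1 mul1r.
  split; rewrite big1 // => j _; by rewrite ?mulr0z ?expr0z.
- move=> i j x y /model_piecesP[->|[l [b [hb ->]]]]; first by rewrite mul0r; left.
  move=> /model_piecesP[->|[l' [b' [hb' ->]]]]; first by rewrite mulr0; left.
  apply/model_piecesP; right; exists (l * l'), (fun j => b j + b' j).
  rewrite mulrACA -rmorphM monoD; split=> //.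
  by rewrite -hb -hb' -big_split; apply: eq_bigr => m _; rewrite mulrzDr.
- move=> i x /model_piecesP[->|[l [b [hb ->]]]]; first by rewrite invr0; left.
  apply/model_piecesP; right; exists l^-1, (fun j => - b j).
  rewrite invfM monoV fmorphV; split=> //.
  by rewrite -hb -sumrN; apply: eq_bigr => m _; rewrite mulrNz.
- move=> i x /model_piecesP[->|[l [b [hb ->]]]]; first by rewrite eqxx.
  move=> nz; have l0 : l != 0 by apply: contraNneq nz => ->; rewrite rmorph0 mul0r.
  by rewrite (valM_real (const_emb_val l0) (mono_val b)) add0r hb.
Qed.

Lemma am_val_ge0 a : (0 <= am_val M a)%E.
Proof. by rewrite am_valE; exact: (valP (am_incl M a)). Qed.

Lemma model_dense x : homog_closure v G setT x.
Proof.
apply: (dense_from (w_ge0 := am_val_ge0) (@am_completion _ _ _ _ _ _ _ M) model_graded) => a.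
have -> : compl_emb am_val_ge0 (am_iota M) a = series_emb (am_series M a).
  by rewrite /compl_emb /series_emb /= am_ext_series (@am_iotaE _ _ _ _ _ _ _ M a).
apply: (homog_closure_powser (al := w) (@am_weight_gt0 _ _ _ _ _ _ _ M) (J := series_emb)) => [phi|c m].
  exact: series_emb_val.
apply/model_piecesP; right; exists c, (fun j => (m j)%:Z); split=> //.
rewrite -mul_mpolyC !rmorphM mpolyXE_id !rmorph_prod; congr (_ * _).
by apply: eq_bigr => j _; rewrite !rmorphXn.
Qed.

End Model.

Lemma pieces_graded G : is_pieces vh iota G -> graded_pieces v G.
Proof.
case=> [[M ->]|[alpha [alpha0 nuE ->]]]; first exact: model_graded.
exact: monomial_graded.
Qed.

Lemma pieces_dense G : is_pieces vh iota G -> forall x, homog_closure v G setT x.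
Proof.
case=> [[M ->]|[alpha [alpha0 nuE ->]]]; first exact: model_dense.
exact: monomial_dense.
Qed.

Lemma Kh_char0 : [pchar k] =i pred0 -> forall m, m.+1%:R != 0 :> Kh.
Proof.
move=> char_k m; have -> : m.+1%:R = J (ps_of_mpoly (m.+1%:R)%:MP) :> Kh by rewrite !rmorph_nat.
rewrite (compl_emb_eq0 (psval_ge0 nu) Vh_completion); apply/eqP => /(congr1 (fun f => pscoef f 0%MM)) /=.
by rewrite mcoeffC eqxx mulr1 => /eqP; have /pcharf0P -> := char_k.
Qed.

Lemma Kh_nontrivial : (0 < n)%N -> exists2 x, x != 0 & vgt v 0 x.
Proof.
move=> n0; exists (J (ps_of_mpoly 'X_(Ordinal n0))).
  rewrite (compl_emb_eq0 (psval_ge0 nu) Vh_completion).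
  apply/eqP => /(congr1 (fun f => pscoef f U_(Ordinal n0)%MM)) /=.
  by rewrite mcoeffXU eqxx => /eqP; rewrite oner_eq0.
rewrite /vgt ps_emb_val; apply/psval_gt0 => /=; rewrite mcoeffX mnm1_eq0 //.
Qed.

End Pieces.

(** * Supports in finitely generated semigroups *)

Section Supports.
Variable R : realType.

Lemma semigroup_gen_sgen d (s : 'I_d -> R) : semigroup_gen s `<=` sgen [seq s j | j <- enum 'I_d].
Proof.
move=> _ [c ->]; elim/big_ind: _ => [||j _]; first exact: sgen0.
  by move=> ? ? ? ?; exact: sgen_add.
by apply/sgen_mulrn/sgen_gen/map_f; rewrite mem_enum.
Qed.

Lemma sgen_semigroup_gen (s : seq R) : sgen s `<=` semigroup_gen (fun j : 'I_(size s) => s`_j).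
Proof.
move=> x; elim=> [|a b sa _ [c ->]].
  by exists (fun=> 0%N); rewrite big1.
have ia : (index a s < size s)%N by rewrite index_mem.
pose i := Ordinal ia; exists (fun j => (j == i) + c j)%N.
under [RHS]eq_bigr do rewrite mulrnDr.
rewrite big_split /=; congr (_ + _); rewrite (bigD1 i) //= eqxx nth_index //.
by rewrite big1 ?addr0 // => j /negPf ->.
Qed.

Lemma sgen_discrete (s : seq R) A : nonneg_seq s -> A `<=` sgen s -> is_discrete A.
Proof.
move=> s0 As; split.
  pose r (m : nat) := projT1 (cid (sgen_locally_finite m%:R s0)).
  have hr m x : sgen s x -> x <= m%:R -> x \in r m by rewrite /r; case: cid => t; exact.
  apply: (@sub_countable _ _ _ (\bigcup_(m in setT) [set` r m])); last first.
    by apply: bigcup_countable => // m _; exact/finite_set_countable/finite_seq.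
  apply: subset_card_le => x /As sx; have [m hm] := nat_above x; exists m => //=.
  by apply: hr => //; exact: hm.
move=> x; have [r hr] := sgen_locally_finite (x + 1) s0.
have [e [e0 e1 he]] : exists e, [/\ 0 < e, e <= 1 & forall y, y \in r -> y != x -> e <= `|y - x|].
  elim: (r) => [|y t [e [e0 e1 he]]]; first by exists 1.
  have [->|yx] := eqVneq y x.
    by exists e; split=> // z; rewrite inE => /predU1P[->|/he //]; rewrite eqxx.
  exists (Num.min e `|y - x|); split.
  - by rewrite lt_min e0 normr_gt0 subr_eq0.
  - by rewrite ge_min e1.
  - move=> z; rewrite inE => /predU1P[->|/he h /h]; first by rewrite ge_min lexx orbT.
    by rewrite ge_min => ->.
exists e => // y /As sy yx; have [yl|yl] := leP y (x + 1); first by apply: he => //; exact: hr.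
by apply: (le_trans e1); rewrite ler_normr; apply/orP; left; lra.
Qed.

Lemma finite_uniq_seq (T : eqType) (A : set T) : finite_set A -> exists2 s : seq T, uniq s & A = [set` s].
Proof.
move=> /finite_seqP[s ->]; exists (undup s); first exact: undup_uniq.
by apply/seteqP; split=> x /=; rewrite mem_undup.
Qed.

End Supports.

Lemma tofrac_inj (D : idomainType) : injective (@tofrac D).
Proof. by move=> x y /eqP; rewrite tofrac_eq => /eqP. Qed.

Section FracSubfield.
Variables (F : fieldType) (S : set F).
Hypothesis S1 : S 1.
Hypothesis SB : forall x y, S x -> S y -> S (x - y).
Hypothesis SM : forall x y, S x -> S y -> S (x * y).

Lemma subring0 : S 0. Proof. by rewrite -(subrr 1); exact: SB. Qed.

Lemma fracs_incl x : S x -> fracs S x.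
Proof. by move=> Sx; exists x, 1; rewrite oner_eq0 divr1. Qed.

Lemma subfield_fracs : subfield (fracs S).
Proof.
split; first exact: fracs_incl.
- move=> _ _ [a [b [Sa Sb b0 ->]]] [c [d [Sc Sd d0 ->]]].
  exists (a * d - c * b), (b * d); split; [by apply: SB; exact: SM|exact: SM|by rewrite mulf_neq0|].
  by rewrite -mulNr addf_div // mulNr.
- move=> _ _ [a [b [Sa Sb b0 ->]]] [c [d [Sc Sd d0 ->]]].
  have [->|c0] := eqVneq c 0.
    by rewrite mul0r invr0 mulr0; apply: fracs_incl; exact: subring0.
  exists (a * d), (b * c); split; [exact: SM|exact: SM|by rewrite mulf_neq0|].
  by rewrite invf_div mulf_div.
Qed.

Lemma common_denominator (s : seq F) : (forall x, x \in s -> fracs S x) ->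
  exists c, [/\ S c, c != 0 & forall x, x \in s -> S (c * x)].
Proof.
elim: s => [|x s IH] h; first by exists 1; rewrite oner_eq0.
have [|c [Sc c0 hc]] := IH; first by move=> y ys; apply: h; rewrite inE ys orbT.
have [a [b [Sa Sb b0 xE]]] := h x (mem_head _ _).
exists (b * c); split; [exact: SM|by rewrite mulf_neq0|].
move=> y; rewrite inE => /predU1P[->|/hc ?]; last by rewrite -mulrA; exact: SM.
by rewrite xE mulrC mulrA divfK //; exact: SM.
Qed.

End FracSubfield.

Lemma subfield_image (F L : fieldType) (f : {rmorphism F -> L}) (E : set F) :
  subfield E -> subfield [set f x | x in E].
Proof.
move=> hE; split.
- by exists 1; [exact: subfield1 hE | rewrite rmorph1].
- by move=> _ _ [x Ex <-] [y Ey <-]; exists (x - y); [exact: subfieldB | rewrite rmorphB].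
- by move=> _ _ [x Ex <-] [y Ey <-]; exists (x / y); [exact: subfield_div | rewrite fmorph_div].
Qed.

Section GradedProducts.
Variables (R : realType) (L : fieldType) (v : valuation R L) (H : R -> set L).
Hypothesis gH : graded_pieces v H.

Lemma graded_prod_coef d (s : seq L) : (forall x, x \in s -> H d x) ->
  forall i, (i <= size s)%N -> H (d *+ (size s - i)) (\prod_(x <- s) ('X - x%:P))`_i.
Proof.
elim: s => [|x s IH] hs i.
  by rewrite leqn0 => /eqP ->; rewrite big_nil coef1; exact: gr1 gH.
have hx : H d x by apply: hs; exact: mem_head.
have {}IH j : (j <= size s)%N -> H (d *+ (size s - j)) (\prod_(x <- s) ('X - x%:P))`_j.
  by apply: IH => y ys; apply: hs; rewrite inE ys orbT.
rewrite big_cons mulrBl coefB coefXM coefCM.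
case: i => [_|j] /=.
  rewrite sub0r subn0 mulrS; apply: (grN gH); apply: (grM gH) => //.
  by have := IH 0%N (leq0n _); rewrite subn0.
rewrite ltnS subSS => js; apply: (grD gH); first exact: IH.
apply: (grN gH); move: js; rewrite leq_eqVlt => /predU1P[->|js].
  rewrite nth_default ?size_prod_XsubC // mulr0; exact: gr0 gH _.
by rewrite -subSS subSn // mulrS; apply: (grM gH) => //; exact: IH.
Qed.

End GradedProducts.

(** * The algebraic closures *)

Section Assembly.
Variables (R : realType) (k : fieldType) (n : nat).
Hypothesis char_k : [pchar k] =i pred0.
Hypothesis n_ge2 : (2 <= n)%N.
Variable nu : ps_valuation R n k.
Variables (Vh : idomainType) (vh : valuation R Vh) (iota : {rmorphism Vnu nu -> Vh}).
Hypothesis Vh_completion : is_completion (fun x => nuK nu (valring_val x)) vh iota.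
Variable G : R -> set {fraction Vh}.
Hypothesis G_pieces : is_pieces vh iota G.
Variables (Om : fieldType) (emb : {rmorphism {fraction Vh} -> Om}).
Hypothesis splitOm : splits Om.
Hypothesis Om_algebraic : forall x, algebraicOver emb x.
Variable nuO : valuation R Om.
Hypothesis nuO_ext : forall x, nuO (emb x) = vhK vh x.

Local Notation Kh := {fraction Vh}.
Local Notation v := (vhK vh).
Local Notation gG := (pieces_graded Vh_completion G_pieces).
Local Notation dense := (pieces_dense Vh_completion G_pieces).
Local Notation H := (homogeneous emb gG).
Local Notation gH := (homog_graded nuO_ext gG).
Local Notation W := (fg_supported nuO H).

Let complete : val_complete v.
Proof. exact: Kh_complete Vh_completion. Qed.
Let char0 : forall m, m.+1%:R != 0 :> Kh.
Proof. exact: Kh_char0 Vh_completion char_k. Qed.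
Let vge0_Vh x : vge v 0 x -> exists a, x = tofrac a.
Proof. exact: valring_Vh Vh_completion x. Qed.

Let nontrivial : exists e g, [/\ 0 < e, G e g & g != 0].
Proof.
have [x x0 hx] := Kh_nontrivial Vh_completion (ltnW n_ge2).
have [e xe] := val_real v x0.
have [g hg [g0 _]] := homog_closure_leading gG (dense x) xe.
by exists e, g; split=> //; exact: val_vgt_lt xe hx.
Qed.

(** Summable expansions and finite approximations carry the same information:
    approximations determine the coefficients of an expansion, whose support is
    discrete because a finitely generated semigroup of nonnegative reals is. *)
Lemma Vfg_fgcl a : Vfg nu vh G a <-> fg_supported v G (tofrac a).
Proof.
split.
  move=> [A [w [wG _ _ wA] ->] [d [s [s0 As]]]].
  exists [seq s j | j <- enum 'I_d] => [x /mapP[j _ ->] //|l].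
  have [F [/finite_uniq_seq[t ut ->] tA ht]] := wA l.
  exists (\sum_(i \in [set` t]) w i); last by apply: ht.
  rewrite -fsbig_seq // big_seq; apply: homog_sum_bigsum => i it.
  by apply: homog_sum_homog (wG i); apply/semigroup_gen_sgen/As/tA.
move=> [s s0 hs]; have [w [wG wS ww]] := homog_closure_expansion gG hs.
have wS' : [set i | w i != 0] `<=` sgen s by move=> i /wS.
exists [set i | w i != 0]; last first.
  exists (size s), (fun j : 'I_(size s) => s`_j); split.
    by move=> j; apply/s0/mem_nth.
  by move=> i /wS'; exact: sgen_semigroup_gen.
exists w => //; split=> //.
- move=> i /= wi; split; last exact: sgen_ge0 s0 (wS' i wi).
  exact: (value_in_group Vh_completion (gr_val gG (wG i) wi)).
- exact: sgen_discrete s0 wS'.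
- move=> l; have [t [ut tw ht]] := ww l; exists [set` t]; split=> //.
  move=> F' /finite_uniq_seq[t' ut' ->] tt' _.
  by rewrite -fsbig_seq //; apply: ht.
Qed.

(** Homogeneity of degree d follows from a polynomial equation over K, namely an
    equation over G 0 for c^N / g; hence it passes to conjugates. *)
Lemma homog_conjugates d c : H d c -> exists q : {poly Kh},
  root (map_poly emb q) c /\ forall y, root (map_poly emb q) y -> H d y.
Proof.
case=> [->|[N [g [a [N0 hg g0 [q0 q00 q0a] cE]]]]].
  by exists 'X; rewrite map_polyX rootX eqxx; split=> // y; rewrite rootX => /eqP ->; left.
have gN0 : emb g != 0 by rewrite fmorph_eq0.
pose q := map_poly (subfield_incl (subfield_degree0 gG)) q0 \Po (g^-1 *: 'X^N).
have rq y : root (map_poly emb q) y = root (map_poly (degree0_emb emb gG) q0) (y ^+ N / emb g).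
  rewrite /q map_comp_poly map_polyZ map_polyXn /= -map_poly_comp /=.
  by rewrite !rootE horner_comp !hornerE fmorphV mulrC.
exists q; split; first by rewrite rq cE mulfK.
move=> y; rewrite rq => hy; right; exists N, g, (y ^+ N / emb g); split=> //.
  by exists q0.
by rewrite divfK.
Qed.

(** A minimal polynomial with coefficients in the pieces has homogeneous roots by
    [homog_root]. Conversely the conjugates of c are homogeneous of degree d, so
    the coefficients, symmetric functions of them, are homogeneous elements of
    the base field, that is, elements of the pieces. *)
Lemma homogeneous_iff d c : 0 <= d -> is_homogeneous G emb d c <-> H d c.
Proof.
move=> d0; split.
  move=> [_ [P [[Pm Pc _] _ PG]]]; pose p := map_poly (@tofrac Vh) P.
  have sp : size p = size P by rewrite size_map_inj_poly ?rmorph0 //; exact: tofrac_inj.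
  apply: (homog_root splitOm gG (p := p) (mu := d *+ (size P).-1)) => //.
    exact: monic_neq0.
  move=> i; have [iP|iP|iP] := ltngtP i (size P).-1.
  - have P0 : (0 < size P)%N by apply: leq_ltn_trans (leq0n i) _; apply: leq_trans iP (leq_pred _).
    have := PG ((size P).-1 - i)%N.
    rewrite subKn ?(ltnW iP) // => hG.
    rewrite /p coef_map -mulrnBr ?(ltnW iP) // -mulr_natr; apply: hG.
    rewrite subn_gt0 iP /=; apply: leq_ltn_trans (leq_subr _ _) _.
    by rewrite prednK.
  - rewrite [p`_i]nth_default ?sp; first exact: gr0 gG _.
    by move: iP; case: (size P).
  - have p1 : p`_(size P).-1 = 1 by rewrite -sp -lead_coefE; exact/monicP.
    rewrite iP subrr p1; exact: gr1 gG.
move=> hc; split=> //.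
have [p [pm pc pmin]] := minpoly_exists (Om_algebraic c).
have p0 := monic_neq0 pm.
have [s [ps sp]] := closed_split (map_poly emb p) splitOm.
have {}sp : size p = (size s).+1 by rewrite -sp ?map_poly_eq0 // size_map_poly.
have {}ps : map_poly emb p = \prod_(y <- s) ('X - y%:P).
  by rewrite ps lead_coef_map (monicP pm) rmorph1 scale1r.
have hs y : y \in s -> H d y.
  move=> ys; have [q [qc qH]] := homog_conjugates hc.
  have /dvdpP[u qE] := pmin q qc; apply: qH.
  rewrite qE rmorphM rootM; apply/orP; right; change (is_true (root (map_poly emb p) y)).
  by rewrite ps root_prod_XsubC.
have pG i : (i <= size s)%N -> G (d *+ (size s - i)) p`_i.
  move=> si; apply: (homog_descend nuO_ext dense (gG := gG)).
  by rewrite -coef_map ps; exact: graded_prod_coef gH _ _ hs _ si.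
have [P PE] : exists P, map_poly (@tofrac Vh) P = p.
  apply: poly_lift => i; have [|a ->] := @vge0_Vh p`_i; last by exists a.
  have [si|si] := leqP i (size s); last by rewrite nth_default ?sp //; exact: vge0r.
  by apply: vge_trans (gr_vge gG (pG i si)); rewrite mulrn_wge0.
have sP : size P = size p by rewrite -PE size_map_inj_poly ?rmorph0 //; exact: tofrac_inj.
have tofrac_poly_inj : injective (map_poly (@tofrac Vh)).
  by apply: map_inj_poly; [exact: tofrac_inj | exact: rmorph0].
have lP : lead_coef P = 1.
  apply: tofrac_inj; rewrite rmorph1 -(monicP pm) -PE lead_coef_map_inj ?rmorph0 //.
  exact: tofrac_inj.
have P0 : P != 0 by rewrite -lead_coef_eq0 lP oner_eq0.
have s1 : (1 < size P)%N.
  rewrite sP -(size_map_poly emb); apply: root_size_gt1 pc.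
  by rewrite map_poly_eq0.
have factor (a b : {poly Vh}) : P = a * b ->
    root (map_poly emb (map_poly (@tofrac Vh) a)) c -> b \is a GRing.unit.
  move=> Pab ra; have a0 : a != 0 by apply: contraNneq P0; rewrite Pab => ->; rewrite mul0r.
  have b0 : b != 0 by apply: contraNneq P0; rewrite Pab => ->; rewrite mulr0.
  have : (size p <= size a)%N.
    rewrite -(size_map_inj_poly (@tofrac_inj Vh) (rmorph0 _) a); apply: dvdp_leq (pmin _ ra).
    by apply: contraNneq a0 => e; apply/eqP/tofrac_poly_inj; rewrite e rmorph0.
  rewrite -sP Pab size_mul // => sab.
  have sb : size b = 1%N.
    apply/eqP; rewrite eqn_leq size_poly_gt0 b0 andbT.
    by move: sab; rewrite -subn1 leq_subLR addnC leq_add2r.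
  rewrite poly_unitE sb eqxx /=; apply/unitrPr; exists (lead_coef a).
  by rewrite -lP Pab lead_coefM mulrC [lead_coef b]lead_coefE sb.
exists P; split.
- by split; rewrite PE.
- split=> // [|a b Pab].
    by rewrite poly_unitE; move: s1; case: (size P) => [|[|]].
  have : root (map_poly emb (map_poly (@tofrac Vh) (a * b))) c by rewrite -Pab PE.
  rewrite !rmorphM rootM => /orP[/(factor _ _ Pab)|]; first by right.
  by rewrite mulrC in Pab; move=> /(factor _ _ Pab); left.
- move=> j /andP[j0 jP]; rewrite -coef_map PE.
  have js : (j <= size s)%N by move: jP; rewrite sP sp ltnS.
  have := pG (size s - j)%N (leq_subr _ _).
  by rewrite subKn // sP sp /= mulr_natr.
Qed.

Lemma homogeneous_ge0 c : (exists d, is_homogeneous G emb d c) -> exists2 d, 0 <= d & H d c.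
Proof.
move=> [d hd]; have d0 : 0 <= d by case: hd.
by exists d => //; apply/homogeneous_iff.
Qed.

Lemma adjoin_lincomb (B : set Om) m (a b : 'I_m -> Om) : B 0 ->
  (forall i, B (a i)) -> adjoin B b (\sum_i a i * b i).
Proof.
move=> B0 Ba; exists (\sum_i a i *: 'X_i) => [mo|]; last first.
  by rewrite rmorph_sum /=; apply: eq_bigr => i _; rewrite mevalZ mevalXU.
rewrite raddf_sum /=; have [[i ->]|no] := pselect (exists i, mo = U_(i)%MM).
  rewrite (bigD1 i) //= mcoeffZ mcoeffXU eqxx mulr1 big1 ?addr0 // => j ji.
  by rewrite mcoeffZ mcoeffXU (negPf ji) mulr0.
rewrite big1 // => i _; rewrite mcoeffZ mcoeffX; case: eqP => [e|]; last by rewrite mulr0.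
by case: no; exists i.
Qed.

Lemma tofrac_image_subring (B : set Vh) : B 1 -> (forall a b, B a -> B b -> B (a - b)) ->
  (forall a b, B a -> B b -> B (a * b)) ->
  subfield (fracs [set tofrac a | a in B]).
Proof.
move=> B1 BB BM; apply: subfield_fracs.
- by exists 1 => //; rewrite rmorph1.
- by move=> _ _ [a Ba <-] [b Bb <-]; exists (a - b); [exact: BB | rewrite rmorphB].
- by move=> _ _ [a Ba <-] [b Bb <-]; exists (a * b); [exact: BM | rewrite rmorphM].
Qed.

Lemma Kof_Vfg_subfield : subfield (Kof emb (Vfg nu vh G)).
Proof.
apply: subfield_image; apply: tofrac_image_subring.
- by apply/Vfg_fgcl; rewrite rmorph1; exact: fg_supported1 gG.
- move=> a b /Vfg_fgcl ha /Vfg_fgcl hb; apply/Vfg_fgcl; rewrite rmorphB.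
  by apply: fg_supported_add => //; exact: (fg_supported_opp gG).
- move=> a b /Vfg_fgcl ha /Vfg_fgcl hb; apply/Vfg_fgcl; rewrite rmorphM.
  exact: (fg_supported_mul gG).
Qed.

Lemma Kof_setT_subfield : subfield (Kof emb [set: Vh]).
Proof. by apply: subfield_image; exact: tofrac_image_subring. Qed.

Lemma Kof_setT a : Kof emb [set: Vh] (emb a).
Proof.
exists a => //; have [x [y [y0 ->]]] := frac_Vh a.
by exists (tofrac x), (tofrac y); split; [exists x|exists y|rewrite tofrac_eq0|].
Qed.

Lemma Kof_VfgP x : Kof emb (Vfg nu vh G) x <->
  exists a c, [/\ fg_supported v G a, fg_supported v G c, c != 0 & x = emb (a / c)].
Proof.
split=> [[_ [_ [_ [[a ha <-] [c hc <-] c0 ->]]] <-]|[a [c [ha hc c0 ->]]]].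
  by exists (tofrac a), (tofrac c); split=> //; exact/Vfg_fgcl.
have [a' aE] := vge0_Vh (fg_supported_vge0 gG ha); have [c' cE] := vge0_Vh (fg_supported_vge0 gG hc).
exists (a / c) => //; exists a, c; split=> //.
  by exists a'; [apply/Vfg_fgcl; rewrite -aE | rewrite aE].
by exists c'; [apply/Vfg_fgcl; rewrite -cE | rewrite cE].
Qed.

Lemma Vbar_setT x : Vbar G emb nuO [set: Vh] x <-> vge nuO 0 x.
Proof.
split=> [[s [g [_ _]]] //|x0].
have [m [a [b [d [hb xE]]]]] :=
  full_coords splitOm nuO_ext gG dense Om_algebraic complete char0 nontrivial x.
exists m, b; split=> //.
  by move=> i; have [hi di] := hb i; exists (d i); apply/homogeneous_iff.
rewrite xE; apply: adjoin_lincomb => [|i]; last exact: Kof_setT.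
by rewrite -(rmorph0 emb); exact: Kof_setT.
Qed.

(** The adjunction ring is contained in Frac W, and its elements of nonnegative
    value are in W because W is integrally closed; conversely
    [fg_supported_coords] writes an element of W over the fraction field of the
    ring of elements with finitely generated supports. *)
Lemma Vbar_Vfg x : Vbar G emb nuO (Vfg nu vh G) x <-> W x.
Proof.
have W_alg := fg_supported_integrally_closed splitOm nuO_ext dense Om_algebraic complete char0 nontrivial (gG := gG).
split.
  move=> [s [g [hg [P PB xE] x0]]].
  have [c [cW c0 cx]] : exists c, [/\ W c, c != 0 & W (c * x)].
    have frac y : Kof emb (Vfg nu vh G) y -> fracs W y.
      move=> /Kof_VfgP[a [c [ha hc c0 ->]]]; exists (emb a), (emb c).
      by rewrite fmorph_eq0 fmorph_div; split=> //; exact: (fg_supported_emb nuO_ext).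
    have [|c [cW c0 hc]] := @common_denominator _ W (fg_supported1 gH) (fg_supported_mul gH)
        [seq P@_m | m <- msupp P].
      by move=> _ /mapP[m _ ->]; exact: frac.
    exists c; split=> //; rewrite xE mevalE mulr_sumr big_seq.
    apply: (fg_supported_sum gH) => m mP; rewrite mulrA; apply: (fg_supported_mul gH).
      by apply: hc; exact: map_f.
    elim/big_ind: _ => [||i _]; [exact: fg_supported1 gH|exact: (fg_supported_mul gH)|].
    apply: (fg_supported_exp gH); have [d d0 hd] := homogeneous_ge0 (hg i).
    exact: fg_supported_homog d0 hd.
  apply: (W_alg (c *: 'X - (c * x)%:P)) => //.
  - apply/eqP => /(congr1 (fun p : {poly Om} => p`_1)).
    by rewrite coefB coefZ coefX coefC coef0 mulr1 subr0 => /eqP; rewrite (negPf c0).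
  - move=> i; rewrite coefB coefZ coefX coefC; apply: fg_supported_add.
      by case: (i == 1%N); rewrite ?mulr1 ?mulr0 //; exact: fg_supported0 gH.
    by apply: (fg_supported_opp gH); case: (i == 0%N) => //; exact: fg_supported0 gH.
  - by rewrite rootE !hornerE subrr.
move=> hx; have [m [a [c [b [d [hb ha hc xE]]]]]] :=
  fg_supported_coords splitOm nuO_ext dense Om_algebraic complete char0 nontrivial hx.
exists m, b; split; last exact: (fg_supported_vge0 gH hx).
  by move=> i; have [hi di] := hb i; exists (d i); apply/homogeneous_iff.
rewrite xE; apply: adjoin_lincomb => [|i]; first exact: subfield0 Kof_Vfg_subfield.
by apply/Kof_VfgP; exists (a i), (c i); have [] := hc i.
Qed.

Lemma Kbar_VfgE : Kbar G emb nuO (Vfg nu vh G) = fracs W.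
Proof. by rewrite /Kbar; congr fracs; apply/seteqP; split=> x /Vbar_Vfg. Qed.

Lemma Kbar_setT : Kbar G emb nuO [set: Vh] = setT.
Proof.
apply/seteqP; split=> // x _.
have V1 : Vbar G emb nuO [set: Vh] 1 by apply/Vbar_setT; rewrite /vge Defs.val1.
have [x0|x0] := pselect (vge nuO 0 x).
  by exists x, 1; rewrite oner_eq0 divr1; split=> //; exact/Vbar_setT.
have nz : x != 0 by apply: contra_notN x0 => /eqP ->; exact: vge0r.
exists 1, x^-1; rewrite invr_eq0 invrK mul1r; split=> //.
apply/Vbar_setT; rewrite /vge valV //; have [d hd] := val_real nuO nz.
by move/negP: x0; rewrite /vge hd -ltNge -EFinN lee_fin lte_fin oppr_ge0; exact: ltW.
Qed.

Lemma subfield_W : subfield (fracs W).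
Proof.
apply: subfield_fracs; [exact: fg_supported1 gH| |exact: (fg_supported_mul gH)].
by move=> x y hx hy; apply: fg_supported_add => //; exact: (fg_supported_opp gH).
Qed.

Lemma fracs_W_closed : is_alg_closed_field (fracs W).
Proof.
have W_alg := fg_supported_integrally_closed splitOm nuO_ext dense Om_algebraic complete char0 nontrivial (gG := gG).
split; first exact: subfield_W.
move=> P PW sP; have [x Px] := splits_root splitOm sP; exists x => //.
have P0 : P != 0 by rewrite -size_poly_gt0 ltnW.
(* An element of negative value is made integral by a homogeneous factor y, and
   y x is then a root of the polynomial Q obtained by scaling the coefficients. *)
have [y [y0 yW yx]] : exists y, [/\ y != 0, W y & vge nuO 0 (y * x)].
  have [->|x0] := eqVneq x 0.
    by exists 1; rewrite oner_eq0 mulr0; split=> //; [exact: fg_supported1 gH | exact: vge0r].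
  have [d hd] := val_real nuO x0.
  have [e [g [h1 h2 h3 h4]]] := homog_large gG nontrivial (- d).
  exists (emb g); rewrite fmorph_eq0; split=> //.
    exact: fg_supported_homog (ltW h2) (homog_emb emb gG h3).
  apply: (@vge_trans _ _ _ _ (e + d)); first lra.
  apply: vgeM; last exact: val_vge.
  by apply: (gr_vge gH); exact: homog_emb.
suff yxW : W (y * x) by exists (y * x), y; split=> //; rewrite mulrC mulKf.
have [|c [cW c0 hc]] := @common_denominator _ W (fg_supported1 gH) (fg_supported_mul gH) P.
  by move=> z /(nthP 0)[i _ <-]; exact: PW.
pose m := (size P).-1; have Pm : size P = m.+1 by rewrite polySpred.
pose Q := \poly_(i < m.+1) (c * P`_i * y ^+ (m - i)).
apply: (W_alg Q) => //.
- apply/eqP => /(congr1 (fun p : {poly Om} => p`_m)).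
  rewrite coef_poly ltnSn coef0 subnn expr0 mulr1 => /eqP.
  by rewrite mulf_eq0 (negPf c0) -lead_coefE lead_coef_eq0 (negPf P0).
- move=> i; rewrite coef_poly; case: ltnP => iP; last exact: fg_supported0 gH.
  apply: (fg_supported_mul gH); last exact: (fg_supported_exp gH).
  by apply: hc; apply: mem_nth; rewrite Pm.
- rewrite rootE horner_poly.
  have -> : \sum_(i < m.+1) c * P`_i * y ^+ (m - i) * (y * x) ^+ i = c * y ^+ m * P.[x].
    rewrite (@horner_coef_wide _ m.+1) ?Pm // mulr_sumr; apply: eq_bigr => i _.
    have -> : y ^+ m = y ^+ (m - i) * y ^+ i by rewrite -exprD subnK // -ltnS.
    by rewrite exprMn; ring.
  by rewrite (rootP Px) mulr0.
Qed.

Lemma homog_algebraic (E : set Om) d c (hE : subfield E) : (forall e g, 0 <= e -> G e g -> E (emb g)) ->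
  0 <= d -> H d c -> algebraicOver (subfield_incl hE) c.
Proof.
move=> EG d0 /(homogeneous_iff _ d0)[_ [P [[Pm Pc _] _ PG]]].
pose p := map_poly (@tofrac Vh) P.
have sp : size p = size P by rewrite size_map_inj_poly ?rmorph0 //; exact: tofrac_inj.
have [q qE] : exists q, map_poly (subfield_incl hE) q = map_poly emb p.
  apply: poly_lift => i; rewrite coef_map; apply: subfield_inclE.
  have [iP|iP|iP] := ltngtP i (size P).-1.
  - have P0 : (0 < size P)%N by apply: leq_ltn_trans (leq0n i) _; apply: leq_trans iP (leq_pred _).
    have := PG ((size P).-1 - i)%N; rewrite subKn ?(ltnW iP) // => hG; rewrite /p coef_map.
    apply: (EG (d * ((size P).-1 - i)%:R)); first by rewrite mulr_ge0.
    apply: hG; rewrite subn_gt0 iP /=; apply: leq_ltn_trans (leq_subr _ _) _.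
    by rewrite prednK.
  - rewrite [p`_i]nth_default ?sp; last by move: iP; case: (size P).
    by have := subfield0 hE; rewrite -{1}(rmorph0 emb).
  - have p1 : p`_(size P).-1 = 1 by rewrite -sp -lead_coefE; exact/monicP.
    by have := subfield1 hE; rewrite iP p1 -{1}(rmorph1 emb).
exists q; last by rewrite qE.
by rewrite -(map_poly_eq0 (subfield_incl hE)) qE map_poly_eq0 monic_neq0.
Qed.

Lemma algebraic_over_subfield (E : set Om) (hE : subfield E) x :
  algebraicOver (subfield_incl hE) x -> algebraic_over E x.
Proof.
move=> [p p0 px]; exists (map_poly (subfield_incl hE) p); split=> //.
  by rewrite map_poly_eq0.
by move=> i; rewrite coef_map; exact: subfield_inclP.
Qed.

Lemma fg_closure : is_alg_closure (Kof emb (Vfg nu vh G)) (fracs W).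
Proof.
have hE := Kof_Vfg_subfield.
split=> //; last exact: fracs_W_closed.
  move=> x /Kof_VfgP[a [c [ha hc c0 ->]]]; exists (emb a), (emb c).
  by rewrite fmorph_eq0 fmorph_div; split=> //; exact: (fg_supported_emb nuO_ext).
move=> _ [x [y [hx hy y0 ->]]].
have algW z : W z -> algebraicOver (subfield_incl hE) z.
  move=> hz; have [m [a [c [b [d [hb ha hc ->]]]]]] :=
    fg_supported_coords splitOm nuO_ext dense Om_algebraic complete char0 nontrivial hz.
  elim/big_ind: _ => [||i _]; [exact: algebraic0|exact: algebraic_add|].
  have [hi di] := hb i; have [ci c0] := hc i.
  apply: algebraic_mul; last first.
    apply: homog_algebraic di hi => e g e0 hg.
    apply/Kof_VfgP; exists g, 1; rewrite oner_eq0 divr1; split=> //; last exact: fg_supported1 gG.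
    exact: fg_supported_homog e0 hg.
  have [u <-] : exists u, subfield_incl hE u = emb (a i / c i).
    by apply: subfield_inclE; apply/Kof_VfgP; exists (a i), (c i).
  exact: algebraic_id.
apply: (@algebraic_over_subfield _ hE); apply: algebraic_div; exact: algW.
Qed.

Lemma full_closure : is_alg_closure (Kof emb [set: Vh]) [set: Om].
Proof.
split=> //; first exact: Kof_setT_subfield.
  move=> x _; have [p p0 px] := Om_algebraic x; exists (map_poly emb p); split=> //.
    by rewrite map_poly_eq0.
  by move=> i; rewrite coef_map; exact: Kof_setT.
split=> // P _ sP; have [x Px] := splits_root splitOm sP; by exists x.
Qed.

End Assembly.

Theorem corollary4p4 (R : realType) (k : fieldType) (n : nat)
  (char_k : [pchar k] =i pred0) (n_ge2 : (2 <= n)%N)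
  (nu : ps_valuation R n k) (nu_abhyankar : is_abhyankar nu)
  (Vh : idomainType) (vh : valuation R Vh) (iota : {rmorphism Vnu nu -> Vh})
  (Vh_completion : is_completion (fun x => nuK nu (valring_val x)) vh iota)
  (G : R -> set {fraction Vh}) (G_pieces : is_pieces vh iota G)
  (Om : closedFieldType) (emb : {rmorphism {fraction Vh} -> Om})
  (Om_algebraic : forall x, algebraicOver emb x)
  (nuO : valuation R Om) (nuO_ext : forall x, nuO (emb x) = vhK vh x) :
  let Kfg := Kof emb (Vfg nu vh G) in
  let Khat := Kof emb [set: Vh] in
  let Kbar_fg := Kbar G emb nuO (Vfg nu vh G) in
  let Kbar_nu := Kbar G emb nuO [set: Vh] in
  (is_alg_closed_field Kbar_fg /\ is_alg_closure Kfg Kbar_fg) /\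
  (is_alg_closed_field Kbar_nu /\ is_alg_closure Khat Kbar_nu).
Proof.
move=> Kfg Khat Kbar_fg Kbar_nu.
have splitOm : splits Om.
  by move=> p; have [r e] := closed_field_poly_normal p; exists r.
have Efg : Kbar_fg = fracs (fg_supported nuO (homogeneous emb (pieces_graded Vh_completion G_pieces))).
  exact: (Kbar_VfgE char_k n_ge2).
have Enu : Kbar_nu = setT by exact: (Kbar_setT char_k n_ge2 Vh_completion G_pieces).
have cfg := fg_closure char_k n_ge2 Vh_completion G_pieces splitOm Om_algebraic nuO_ext.
have cnu := full_closure splitOm Om_algebraic.
rewrite Efg Enu; split; split=> //; [by case: cfg|by case: cnu].
Qed.
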